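(* Assume that $\tau>\frac52$, $\alpha>1$ and $\alpha>\frac{1}{\tau-2}$. Let $\mathcal{G}=(\mathcal{V},\mathcal{E})$ be a (Euclidean) GIRG with parameters $\tau,\alpha,\theta_1,\theta_2,d,n$, and suppose the rumour starts in a random vertex (chosen uniformly at random). There exist a constant $\rho>0$ and a function $k=k(n)=\Omega\left(\frac{\log n}{\log\log n}\right)$ such that with high probability at most $O(n^{1-\rho})$ vertices are informed of the rumour after $k$ rounds of the push-pull protocol.
   Context: All asymptotics are for $n\to\infty$ with the other parameters constant; ''with high probability'' (whp) means with probability $1-o(1)$. $\log$ is the natural logarithm. GIRG. Let $\tau>2$, $\alpha>1$, $0<\theta_1\le\theta_2\le 1$, $d,n\in\mathbb{N}$, and let $\mathcal{D}$ be a power-law distribution on $[1,\infty)$ with exponent $\tau$ (it has a density $f$ with $f(x)=\Theta(x^{-\tau})$, or, in the discrete case, point probabilities $\Theta(x^{-\tau})$). Let $\mathbb{T}^d=\mathbb{R}^d/\mathbb{Z}^d$ be the $d$-dimensional torus; for $a,b\in[0,1]$ let $|a-b|_T=\min\{|a-b|,1-|a-b|\}$, and for $x,y\in\mathbb{T}^d$ let $|x-y|_\infty=\max_{1\le i\le d}|x_i-y_i|_T$. Let $V_\infty(r)=\mathrm{Vol}(\{x\in\mathbb{T}^d: |x|_\infty\le r\})$. A (Euclidean) Geometric Inhomogeneous Random Graph (GIRG) is the random graph obtained as follows: (1) the vertex set $\mathcal{V}$ is a Poisson point process of intensity $n$ on $\mathbb{T}^d$; $x_v$ denotes the position of vertex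 $v$; (2) every vertex $v$ independently draws a weight $W_v\sim\mathcal{D}$; (3) every two distinct vertices $u,v$ are joined by an edge independently with probability $p_{uv}$ satisfying $\theta_1 m\le p_{uv}\le\theta_2 m$, where $m=\min\left\{\left(\frac{W_uW_v}{nV_\infty(|x_u-x_v|_\infty)}\right)^{\alpha},1\right\}$. (Synchronous) push-pull protocol. Initially only the start vertex knows the rumour. In each round, every (non-isolated) vertex independently chooses a uniformly random neighbour, and the two vertices share the rumour: if one of them knew it before this round, then both know it after this round. *)

(* Defs.v *)
From HB Require Import structures.
From mathcomp Require Export all_boot all_order all_algebra.
From mathcomp Require Export all_classical all_reals all_analysis.
Set Implicit Arguments.
Unset Strict Implicit.
Unset Printing Implicit Defensive.
Import Order.TTheory GRing.Theory Num.Theory.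
Import numFieldNormedType.Exports.
Local Open Scope classical_set_scope.
Local Open Scope ring_scope.

(* The torus R^d / Z^d is represented by its fundamental domain [0, 1)^d, with
   points d-tuples of coordinates. *)
Notation torus_point R d := (d.-tuple (measurableTypeR R)).

Section torus.
Context {R : realType}.

Definition torus (d : nat) : set (torus_point R d) :=
  [set x | forall c : 'I_d, 0 <= tnth x c < 1].

(* Lebesgue measure on [0, 1)^d, as an iterated integral over the coordinates
   (the way product_measure1 defines a product measure). *)
Fixpoint torus_vol (d : nat) : set (torus_point R d) -> \bar R :=
  match d return set (torus_point R d) -> \bar R with
  | 0%N => fun A => \d_([tuple] : torus_point R 0) A
  | d'.+1 => fun A =>
      (\int[@lebesgue_measure R]_(a in `[0%R, 1%R[)
         torus_vol [set x : torus_point R d' | A [tuple of a :: x]])%E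
  end.

Definition circle_dist (a b : R) : R := Num.min `|a - b| (1 - `|a - b|).

Definition torus_dist (d : nat) (x y : torus_point R d) : R :=
  \big[Num.max/0]_(c < d) circle_dist (tnth x c) (tnth y c).

Definition torus0 (d : nat) : torus_point R d := [tuple (0 : R) | _ < d].

Definition V_infty (d : nat) (r : R) : R :=
  fine (torus_vol [set x : torus_point R d |
                     torus x /\ torus_dist x (torus0 d) <= r]).

End torus.
Arguments V_infty {R} d r.

(* The density, respectively the point probabilities, are Theta(x^-tau) as
   x -> oo; a discrete power law lives on the positive integers. *)
Definition power_law {R : realType} (tau : R)
    (D : probability (measurableTypeR R) R) : Prop :=
  D `[1%R, +oo[%classic = 1%E /\
  ((exists f : R -> R,
     [/\ measurable_fun setT f, forall x, 0 <= f x,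
         forall A : set (measurableTypeR R), measurable A ->
           D A = (\int[lebesgue_measure]_(x in A) (f x)%:E)%E &
         f \is 'Theta_(pinfty_nbhs R) (fun x => x `^ (- tau))])
   \/
   (D (range (fun k : nat => k.+1%:R)) = 1%E /\
    (fun k : nat => fine (D [set k%:R])) \is
      'Theta_\oo (fun k : nat => k%:R `^ (- tau)))).

Section conditional_laws.
Context {d : measure_display} {Omega : measurableType d} {R : realType}.

(* sigma-algebra generated by F and the family Z *)
Definition sigma_join {I : Type} {d'} {T : measurableType d'}
    (F : set (set Omega)) (Z : I -> Omega -> T) : set (set Omega) :=
  <<s F `|` \bigcup_i preimage_set_system setT (Z i) measurable >>.

Definition adapted {d'} {T : measurableType d'} (F : set (set Omega))
    (f : Omega -> T) : Prop :=
  forall A, measurable A -> F (f @^-1` A).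

(* Conditionally on the sigma-algebra F, the Z i are independent with laws q i
   (q i is meant to be F-measurable, and a probability on dom i); nothing is
   required of Z i outside the event dom i, which is meant to be in F. *)
Definition cond_indep_law (P : probability Omega R) (F : set (set Omega))
    {I : eqType} {d'} {T : measurableType d'} (dom : I -> set Omega)
    (Z : I -> Omega -> T) (q : I -> Omega -> set T -> \bar R) : Prop :=
  forall (s : seq I) (A : I -> set T) (B : set Omega),
    uniq s -> (forall i, measurable (A i)) ->
    F B -> (forall i, i \in s -> B `<=` dom i) ->
    P (B `&` [set w | forall i, i \in s -> A i (Z i w)]) =
    (\int[P]_(w in B) \prod_(i <- s) q i w (A i))%E.

End conditional_laws.

Definition uniform_on {R : realType} {T : Type} (s : seq T) (A : set T) :
    \bar R :=
  ((count (fun x => x \in A) s)%:R / (size s)%:R)%:E.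

(* A finite random set of points X 0, ..., X (N - 1), in an arbitrary
   (possibly random) labelling. *)
Section poisson_process.
Context {R : realType} {disp : measure_display} {Omega : measurableType disp}.
Context {d : nat}.
Implicit Types (P : probability Omega R) (N : Omega -> nat).
Implicit Types (X : nat -> Omega -> torus_point R d).

Definition num_points N X (A : set (torus_point R d)) (w : Omega) : nat :=
  count (fun i => X i w \in A) (iota 0 (N w)).

Definition poisson_point_process P (intensity : R) N X : Prop :=
  [/\ measurable_fun setT N,
      forall i, measurable_fun setT (X i),
      forall w i, (i < N w)%N -> torus (X i w),
      (* the second argument of poisson_prob is a dummy *)
      forall (A : set (torus_point R d)) (k : nat), measurable A ->
        P [set w | num_points N X A w = k] =
        poisson_prob (intensity * fine (torus_vol A)) 0 [set k] &
      forall (m : nat) (A : 'I_m -> set (torus_point R d)) (k : 'I_m -> nat),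
        (forall i, measurable (A i)) -> trivIset setT A ->
        P [set w | forall i, num_points N X (A i) w = k i] =
        (\prod_(i < m) P [set w | num_points N X (A i) w = k i])%E].

End poisson_process.

(* The vertices are the labels i < N w, with positions X i w, weights W i w,
   and adjacency relation E i j w. The connection probabilities p i j may be any
   function of the positions and weights within the prescribed bounds. *)
Section girg.
Context {R : realType} {disp : measure_display} {Omega : measurableType disp}.
Context {d : nat}.
Implicit Types (P : probability Omega R) (N : Omega -> nat).
Implicit Types (X : nat -> Omega -> torus_point R d).
Implicit Types (W : nat -> Omega -> measurableTypeR R).
Implicit Types (E : nat -> nat -> Omega -> bool).

Definition sigma_positions N X : set (set Omega) :=
  sigma_join (preimage_set_system setT N measurable) X.

Definition sigma_weights N X W : set (set Omega) :=
  sigma_join (sigma_positions N X) W.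

Definition sigma_graph N X W E : set (set Omega) :=
  sigma_join (sigma_weights N X W) (fun ij : nat * nat => E ij.1 ij.2).

(* min {(wu wv / (n V(|xu - xv|)))^alpha, 1}, where the quotient is +oo when
   the denominator vanishes *)
Definition girg_kernel (alpha : R) (n : nat)
    (xu xv : torus_point R d) (wu wv : R) : R :=
  let V := V_infty d (torus_dist xu xv) in
  if n%:R * V == 0 then 1
  else Num.min ((wu * wv / (n%:R * V)) `^ alpha) 1.

Record girg (alpha theta1 theta2 : R)
    (D : probability (measurableTypeR R) R) (n : nat) P N X W
    (p : nat -> nat -> Omega -> measurableTypeR R) E : Prop := {
  girg_positions : poisson_point_process P n%:R N X ;
  girg_weight_measurable : forall i, measurable_fun setT (W i) ;
  girg_weights : cond_indep_law P (sigma_positions N X)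
    (fun _ => setT) W (fun _ _ => D) ;
  girg_prob_adapted : forall i j, adapted (sigma_weights N X W) (p i j) ;
  girg_prob_bounds : forall w i j, (i < j < N w)%N ->
    let m := girg_kernel alpha n (X i w) (X j w) (W i w) (W j w) in
    theta1 * m <= p i j w <= theta2 * m ;
  girg_edge_measurable : forall i j, measurable_fun setT (E i j) ;
  girg_simple : forall w, symmetric (fun i j => E i j w) /\
                          irreflexive (fun i j => E i j w) ;
  girg_edges : cond_indep_law P (sigma_weights N X W)
    (fun ij : nat * nat => [set w | (ij.1 < ij.2 < N w)%N])
    (fun ij => E ij.1 ij.2)
    (fun ij w => bernoulli_prob (p ij.1 ij.2 w))
}.

End girg.

Section push_pull.

Definition neighbours (N : nat) (e : rel nat) (i : nat) : seq nat :=
  [seq j <- iota 0 N | e i j].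

(* Vertices knowing the rumour after t rounds, in the graph e on {0,...,N-1},
   from start vertex s, when i contacts y r i in the r-th round (r >= 0). The
   entry y r i is ignored unless it is a neighbour of i. *)
Fixpoint informed (N : nat) (e : rel nat) (s : nat) (y : nat -> nat -> nat)
    (t : nat) (i : nat) : bool :=
  if t is r.+1 then
    informed N e s y r i ||
    has (fun j => informed N e s y r j && ((y r i == j) || (y r j == i)))
        (neighbours N e i)
  else i == s.

Definition num_informed (N : nat) (e : rel nat) (s : nat)
    (y : nat -> nat -> nat) (t : nat) : nat :=
  count (informed N e s y t) (iota 0 N).

Context {R : realType} {disp : measure_display} {Omega : measurableType disp}.
Context {d : nat}.

(* Uniform start vertex S, given the graph; independent uniform neighbours
   Y r i in all rounds r, given the graph and the start vertex. *)
Record push_pull (P : probability Omega R) (N : Omega -> nat)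
    (X : nat -> Omega -> torus_point R d)
    (W : nat -> Omega -> measurableTypeR R) (E : nat -> nat -> Omega -> bool)
    (S : Omega -> nat) (Y : nat -> nat -> Omega -> nat) : Prop := {
  start_measurable : measurable_fun setT S ;
  start_uniform : cond_indep_law P (sigma_graph N X W E)
    (fun _ : unit => [set w | (0 < N w)%N]) (fun _ => S)
    (fun _ w => uniform_on (iota 0 (N w))) ;
  choice_measurable : forall r i, measurable_fun setT (Y r i) ;
  choice_uniform : cond_indep_law P
    (sigma_join (sigma_graph N X W E) (fun _ : unit => S))
    (fun ri : nat * nat => [set w | (ri.2 < N w)%N /\
       neighbours (N w) (fun i j => E i j w) ri.2 <> [::]])
    (fun ri => Y ri.1 ri.2)
    (fun ri w => uniform_on (neighbours (N w) (fun i j => E i j w) ri.2))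
}.

End push_pull.

(* Main.v *)
(* Fix the cells of a grid with Q ^ d cells, of about (ln n)^2 vertices each,
   that contain the vertices, and argue conditionally on this configuration;
   configurations with unbalanced cells are excluded by Poisson tails.

   Let g = min (tau - 2) 1 > 1/2. Up to polylogarithmic factors a vertex of
   weight w has degree at least w, so that in a given round two vertices of
   weights a <= b at grid volume L communicate with probability at most
   K = min 1 ((b * a^g / L)^(1/g)); they are captured when K = 1. Every informed
   vertex is the end of a skeleton starting at the start vertex: a path whose
   consecutive vertices are captured or communicate in increasing rounds, and
   which has no shortcut, that is, no captured pair of non-consecutive
   vertices. Deleting the lightest vertex of a skeleton leaves a skeleton, and
   summing over the deleted vertex costs a polylogarithmic factor: for its
   neighbours x and y, K(x,z) K(z,y) is at most of order
   K(x,y) (z^(1+g) / L(x,z) + z^(1+g) / L(y,z)) as {x, y} is not captured. What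
   remains after all deletions is the second moment of the weights truncated
   at n, which is about n^(1/2). So the expected number of informed vertices is
   at most n^(1/2) (polylog n)^k, and Markov's inequality at n^(3/4)
   concludes. *)

Require Import Defs.
From mathcomp Require Import measurable_realfun ring lra zify.
Set Implicit Arguments.
Unset Strict Implicit.
Unset Printing Implicit Defensive.
Import Order.TTheory GRing.Theory Num.Theory.
Import numFieldNormedType.Exports.
Local Open Scope classical_set_scope.
Local Open Scope ring_scope.

(** * Sums over shortcut-free skeletons *)

Section tuple_insert.
Context {V : nmodType} {Z : finType}.

Definition insert_at j (z : Z) (t : seq Z) : seq Z := take j t ++ z :: drop j t.

Lemma insert_atP n j z (t : n.-tuple Z) : size (insert_at j z t) == n.+1.
Proof.
by rewrite /insert_at size_cat /= addnS -size_cat cat_take_drop size_tuple.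
Qed.
Definition insert_tuple n j z (t : n.-tuple Z) : n.+1.-tuple Z := Tuple (insert_atP j z t).

Lemma delete_atP n (j : 'I_n.+1) (s : n.+1.-tuple Z) :
  size (take j s ++ drop j.+1 s) == n.
Proof.
by rewrite size_cat size_take size_drop size_tuple ltn_ord subSS subnKC// -ltnS.
Qed.

Lemma size_take_ord n (j : 'I_n.+1) (t : n.-tuple Z) : size (take j t) = j.
Proof.
rewrite size_take size_tuple; case: ltnP => // jn.
by apply/eqP; rewrite eqn_leq jn -ltnS ltn_ord.
Qed.

Lemma sum_tuple_insert n (j : 'I_n.+1) (P : pred (seq Z)) (F : seq Z -> V) :
  \sum_(s : n.+1.-tuple Z | P s) F s =
  \sum_(t : n.-tuple Z) \sum_(z | P (take j t ++ z :: drop j t))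
    F (take j t ++ z :: drop j t).
Proof.
rewrite pair_big_dep /=.
rewrite (reindex (fun p : n.-tuple Z * Z => insert_tuple j p.2 p.1)) //=.
exists (fun s : n.+1.-tuple Z => (Tuple (delete_atP j s), tnth s j)).
  move=> [t z] _ /=; have jt := size_take_ord j t; congr pair.
    apply/val_inj => /=; rewrite /insert_at -cat_rcons drop_size_cat ?size_rcons ?jt//.
    by rewrite cat_rcons take_size_cat ?cat_take_drop.
  by rewrite (tnth_nth z) /= /insert_at nth_cat jt ltnn subnn.
move=> s _; apply/val_inj => /=; rewrite /insert_at.
have jE : size (take j s) = j by rewrite size_take size_tuple ltn_ord.
rewrite take_size_cat// drop_size_cat// (tnth_nth (tnth s j)) -drop_nth ?size_tuple ?ltn_ord//.
by rewrite cat_take_drop.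
Qed.

End tuple_insert.

Fixpoint shortcut_free (T : Type) (cap : rel T) s :=
  if s is x :: t then all (fun y => ~~ cap x y) (behead t) && shortcut_free cap t
  else true.

Section connection_kernel.
Context {R : realType} {Z : Type} (g : R) (wt : Z -> R) (L : Z -> Z -> R).

Definition capture_radius x y : R :=
  Num.max (wt x) (wt y) * Num.min (wt x) (wt y) `^ g.

Definition captured x y := L x y <= capture_radius x y.

(* The exponent [g^-1 <= alpha] only weakens the kernel of the graph, and makes
   [sum_conn_via_le] hold with [M] polylogarithmic. *)
Definition conn x y : R :=
  if captured x y then 1 else (capture_radius x y / L x y) `^ g^-1.

Fixpoint conn_path x t : R := if t is y :: t' then conn x y * conn_path y t' else 1.

End connection_kernel.

Section skeleton_kernel.
Context {R : realType} (Z : finType) (g q M : R) (wt mu : Z -> R).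
Variable L : Z -> Z -> R.
Hypotheses (g2 : 1 / 2 <= g) (g1 : g <= 1) (q1 : 1 <= q).
Hypotheses (wt1 : forall z, 1 <= wt z) (mu0 : forall z, 0 <= mu z).
Hypotheses (L1 : forall x y, 1 <= L x y) (Lsym : forall x y, L x y = L y x).
Hypothesis Lq : forall x y z, L x y <= q * Num.max (L x z) (L z y).
Hypothesis LM : forall x, \sum_z mu z * (wt z * wt z `^ g) / L x z <= M.

Local Notation capture_radius := (capture_radius g wt).
Local Notation captured := (captured g wt L).
Local Notation conn := (conn g wt L).
Local Notation conn_path := (conn_path g wt L).
Local Notation shortcut_free := (shortcut_free captured).

Let wt0 z : 0 < wt z. Proof. exact: lt_le_trans ltr01 (wt1 z). Qed.
Let L0 x y : 0 < L x y. Proof. exact: lt_le_trans ltr01 (L1 x y). Qed.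
Let g0 : 0 < g. Proof. by apply: lt_le_trans g2; lra. Qed.
Let gV1 : 1 <= g^-1. Proof. by rewrite invf_ge1. Qed.
Let gV2 : g^-1 <= 2.
Proof. by rewrite -[2]invrK lef_pV2 ?posrE ?invr_gt0 //; have := g2; lra. Qed.

Lemma capture_radiusC x y : capture_radius x y = capture_radius y x.
Proof. by rewrite /capture_radius maxC minC. Qed.

Lemma capturedC x y : captured x y = captured y x.
Proof. by rewrite /captured Lsym capture_radiusC. Qed.

Lemma connC x y : conn x y = conn y x.
Proof. by rewrite /conn capturedC Lsym capture_radiusC. Qed.

Lemma conn_ge0 x y : 0 <= conn x y.
Proof. by rewrite /conn; case: ifP => // _; exact: powR_ge0. Qed.

Lemma capture_radius_gt0 x y : 0 < capture_radius x y.
Proof.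
by rewrite /capture_radius mulr_gt0 ?lt_max ?wt0// powR_gt0// lt_min !wt0.
Qed.

Lemma capture_radius_le x z : wt z <= wt x ->
  capture_radius x z = wt x * wt z `^ g.
Proof. by move=> zx; rewrite /capture_radius max_l// min_r. Qed.

Lemma capture_ratio_gt0 x y : 0 < capture_radius x y / L x y.
Proof. by rewrite divr_gt0 ?capture_radius_gt0. Qed.

Lemma conn_le x y : conn x y <= capture_radius x y / L x y.
Proof.
rewrite /conn /captured; case: ifPn => [c|].
  by rewrite ler_pdivlMr ?mul1r.
rewrite -ltNge => c; apply: ge1r_powR => //.
by rewrite capture_ratio_gt0 ler_pdivrMr// mul1r ltW.
Qed.

Lemma conn_le_powR x y : conn x y <= (capture_radius x y / L x y) `^ g^-1.
Proof.
rewrite /conn /captured; case: ifPn => [c|//].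
have r1 : 1 <= capture_radius x y / L x y by rewrite ler_pdivlMr ?mul1r.
by apply: (le_trans r1); exact: le1r_powR.
Qed.

Lemma powR_invr (x r : R) : 0 <= x -> x^-1 `^ r = (x `^ r)^-1.
Proof. by move=> x0; rewrite -powR_inv1// -powRrM mulrC powRrM powR_inv1 ?powR_ge0. Qed.

Lemma powR_radius_ge x y :
  wt x `^ g^-1 * wt y <= capture_radius x y `^ g^-1.
Proof.
have gK t : 0 < t -> (t `^ g) `^ g^-1 = t.
  by move=> t0; rewrite -powRrM mulfV ?gt_eqF// powRr1// ltW.
have [xy|xy] := leP (wt x) (wt y); last first.
  by rewrite capture_radius_le ?(ltW xy)// powRM ?powR_ge0 ?(ltW (wt0 _))// gK.
rewrite capture_radiusC capture_radius_le// powRM ?powR_ge0 ?(ltW (wt0 _))//.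
rewrite gK// -(mulr_powRB1 (ltW (wt0 x))) ?invr_gt0//.
rewrite -(mulr_powRB1 (ltW (wt0 y))) ?invr_gt0//.
have : wt x `^ (g^-1 - 1) <= wt y `^ (g^-1 - 1).
  by apply: ge0_ler_powR; rewrite ?nnegrE ?subr_ge0// ltW.
move=> h; rewrite mulrAC [leRHS]mulrAC [wt y * _]mulrC.
by rewrite ler_wpM2l// mulr_ge0 ?(ltW (wt0 _)).
Qed.

Lemma conn_via_le x y z : ~~ captured x y -> wt z <= wt x -> wt z <= wt y ->
  L x y <= q * L x z ->
  conn x z * conn z y <= q ^+ 2 * conn x y * (wt z * wt z `^ g / L y z).
Proof.
move=> xyNc zx zy Lxy.
have q0 : 0 < q by apply: lt_le_trans q1.
have xz : conn x z <= q ^+ 2 * (wt x `^ g^-1 * wt z / L x y `^ g^-1).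
  apply: (le_trans (conn_le_powR x z)).
  have -> : wt x `^ g^-1 * wt z / L x y `^ g^-1 =
            (capture_radius x z / L x y) `^ g^-1.
    rewrite powRM ?invr_ge0 ?(ltW (capture_radius_gt0 _ _)) ?(ltW (L0 _ _))//.
    rewrite capture_radius_le// powRM ?powR_ge0 ?(ltW (wt0 _))//.
    rewrite -powRrM mulfV ?gt_eqF// powRr1 ?(ltW (wt0 _))//; congr (_ * _).
    by rewrite powR_invr// ltW.
  apply: (@le_trans _ _ ((q * (capture_radius x z / L x y)) `^ g^-1)).
    apply: ge0_ler_powR; rewrite ?nnegrE ?invr_ge0 ?(ltW g0)//.
    - exact: ltW (capture_ratio_gt0 _ _).
    - by rewrite ltW// mulr_gt0// divr_gt0 ?capture_radius_gt0.
    - rewrite mulrCA ler_pM2l ?capture_radius_gt0//.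
      by rewrite ler_pdivlMr// mulrC ler_pdivrMr// mulrC.
  rewrite powRM ?(ltW q0)//; last by rewrite ltW// divr_gt0 ?capture_radius_gt0.
  rewrite ler_wpM2r ?powR_ge0// -[q ^+ 2]powR_mulrn ?(ltW q0)//.
  exact: ler_powR.
have zy' : conn z y <= wt y * wt z `^ g / L y z.
  by rewrite connC -capture_radius_le//; exact: conn_le.
have xyE : wt x `^ g^-1 * wt y / L x y `^ g^-1 <= conn x y.
  rewrite /conn (negbTE xyNc).
  rewrite powRM ?invr_ge0 ?(ltW (capture_radius_gt0 _ _)) ?(ltW (L0 _ _))//.
  by rewrite powR_invr ?(ltW (L0 _ _))// ler_wpM2r ?invr_ge0 ?powR_ge0// powR_radius_ge.
apply: (le_trans (ler_pM (conn_ge0 _ _) (conn_ge0 _ _) xz zy')).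
rewrite [leLHS](_ : _ = q ^+ 2 * (wt x `^ g^-1 * wt y / L x y `^ g^-1) *
  (wt z * wt z `^ g / L y z)); last by ring.
rewrite ler_wpM2r ?ler_wpM2l ?exprn_ge0 ?(ltW q0)//.
by rewrite !mulr_ge0 ?invr_ge0 ?powR_ge0 ?(ltW (wt0 _)) ?(ltW (L0 _ _)).
Qed.

Lemma sum_conn_via_le x y : ~~ captured x y ->
  \sum_(z | (wt z <= wt x) && (wt z <= wt y)) mu z * (conn x z * conn z y) <=
  2 * q ^+ 2 * M * conn x y.
Proof.
move=> xyNc; have q0 : 0 < q by apply: lt_le_trans q1.
pose h z v := mu z * (wt z * wt z `^ g) / L v z.
have h0 z v : 0 <= h z v.
  by rewrite /h !mulr_ge0 ?invr_ge0 ?powR_ge0 ?(ltW (wt0 _)) ?(ltW (L0 _ _)).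
apply: (@le_trans _ _ (\sum_z q ^+ 2 * conn x y * (h z x + h z y))).
  rewrite big_mkcond; apply: ler_sum => z _; case: ifPn => [/andP[zx zy]|_]; last first.
    by rewrite !mulr_ge0 ?exprn_ge0 ?(ltW q0) ?conn_ge0// addr_ge0.
  have [xzy|zyx] := leP (L x z) (L z y); last first.
    apply: (@le_trans _ _ (q ^+ 2 * conn x y * h z y)); last first.
      by rewrite ler_wpM2l ?lerDr// !mulr_ge0 ?exprn_ge0 ?(ltW q0) ?conn_ge0.
    rewrite /h -[mu z * _ / _]mulrA [leRHS]mulrCA; apply: ler_wpM2l => //.
    apply: conn_via_le => //; apply: (le_trans (Lq x y z)).
    by rewrite max_l// ltW.
  apply: (@le_trans _ _ (q ^+ 2 * conn x y * h z x)); last first.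
    by rewrite ler_wpM2l ?lerDl// !mulr_ge0 ?exprn_ge0 ?(ltW q0) ?conn_ge0.
  rewrite /h -[mu z * _ / _]mulrA [leRHS]mulrCA; apply: ler_wpM2l => //.
  rewrite mulrC (connC x y) (connC x z) (connC z y).
  apply: conn_via_le => //; first by rewrite capturedC.
  by apply: (le_trans (Lq y x z)); rewrite (Lsym z x) max_l// (Lsym y).
rewrite -mulr_sumr big_split /= [leRHS](_ : _ = q ^+ 2 * conn x y * (M + M)).
  apply: ler_wpM2l; first by rewrite mulr_ge0 ?conn_ge0 ?exprn_ge0 ?(ltW q0).
  by apply: lerD; exact: LM.
by ring.
Qed.

Lemma sum_conn_end_le x :
  \sum_(z | wt z <= wt x) mu z * (wt z * conn z x) <= M * wt x.
Proof.
apply: (@le_trans _ _ (\sum_z mu z * (wt z * wt z `^ g) / L x z * wt x)).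
  rewrite big_mkcond; apply: ler_sum => z _; case: ifPn => [zx|_]; last first.
    by rewrite !mulr_ge0 ?invr_ge0 ?powR_ge0 ?(ltW (wt0 _)) ?(ltW (L0 _ _)).
  rewrite -!mulrA ler_wpM2l// ler_wpM2l ?(ltW (wt0 _))//.
  rewrite connC; apply: (le_trans (conn_le _ _)).
  by rewrite capture_radius_le// -mulrA mulrC -mulrA.
by rewrite -mulr_suml ler_wpM2r ?(ltW (wt0 _))// LM.
Qed.

Definition skeleton_weight s : R :=
  if s is x :: t then
    wt x * wt (last x t) * (\prod_(z <- s) mu z) * conn_path x t
  else 0.

Lemma conn_path_cat x t1 y t2 :
  conn_path x (t1 ++ y :: t2) =
  conn_path x t1 * conn (last x t1) y * conn_path y t2.
Proof.
elim: t1 x => [x|a t1 IH x] /=; first by rewrite mul1r.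
by rewrite IH !mulrA.
Qed.

Lemma conn_path_ge0 x t : 0 <= conn_path x t.
Proof. by elim: t x => //= y t IH x; rewrite mulr_ge0 ?conn_ge0. Qed.

Lemma skeleton_weight_ge0 s : 0 <= skeleton_weight s.
Proof.
case: s => // x t; rewrite /skeleton_weight !mulr_ge0 ?(ltW (wt0 _)) ?conn_path_ge0//.
by rewrite prodr_ge0.
Qed.

Lemma shortcut_free_del t1 z t2 :
  shortcut_free (t1 ++ z :: t2) -> shortcut_free (t1 ++ t2).
Proof.
elim: t1 => [/= /andP[]//|x t1 IH] /= /andP[h /IH ->]; rewrite andbT.
case: t1 h {IH} => [|y t1] /=; first by case: t2 => //= y t2 /andP[].
by rewrite !all_cat /= => /and3P[-> _ ->].
Qed.

Lemma shortcut_free_via x t1 z y t2 :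
  shortcut_free (x :: t1 ++ z :: y :: t2) -> ~~ captured (last x t1) y.
Proof.
elim: t1 x => [x /= /andP[/andP[]//]|a t1 IH x]; rewrite cat_cons.
by move=> /andP[_ /IH].
Qed.

Let M0 : forall x : Z, 0 <= M.
Proof.
move=> x; apply: le_trans (LM x); apply: sumr_ge0 => z _.
by rewrite !mulr_ge0 ?invr_ge0 ?powR_ge0 ?(ltW (wt0 _)) ?(ltW (L0 _ _)).
Qed.

Let C := 2 * q ^+ 2 * M.

Let MC : forall x : Z, M <= C.
Proof.
move=> x; rewrite -[leLHS]mul1r ler_wpM2r ?(M0 x)//.
by have := ler_pM ler01 ler01 q1 q1; rewrite -expr2 => ?; lra.
Qed.

Lemma sum_insert_le t1 t2 : (0 < size (t1 ++ t2))%N ->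
  \sum_(z | shortcut_free (t1 ++ z :: t2) &&
            all (fun y => wt z <= wt y) (t1 ++ t2)) skeleton_weight (t1 ++ z :: t2)
  <= C * skeleton_weight (t1 ++ t2).
Proof.
case: t1 => [|x t1]; case: t2 => [|y t2] // _.
- set A := wt (last y t2) * (\prod_(v <- y :: t2) mu v) * conn_path y t2.
  have A0 : 0 <= A.
    by rewrite /A !mulr_ge0 ?(ltW (wt0 _)) ?conn_path_ge0// prodr_ge0.
  apply: (@le_trans _ _ (\sum_(z | wt z <= wt y) mu z * (wt z * conn z y) * A)).
    rewrite big_mkcond [leRHS]big_mkcond /=; apply: ler_sum => z _.
    case: ifPn => [/and3P[_ -> _]|_].
      by rewrite /A big_cons le_eqVlt; apply/orP; left; apply/eqP; ring.
    by case: ifP => // _; rewrite mulr_ge0// !mulr_ge0 ?conn_ge0 ?(ltW (wt0 _)).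
  rewrite -mulr_suml; apply: (@le_trans _ _ (C * wt y * A)).
    rewrite ler_wpM2r//; apply: (le_trans (sum_conn_end_le y)).
    by rewrite ler_wpM2r ?(ltW (wt0 _))// (MC y).
  by rewrite /A /= le_eqVlt; apply/orP; left; apply/eqP; ring.
- set y := last x t1.
  set A := wt x * (\prod_(v <- x :: t1) mu v) * conn_path x t1.
  have A0 : 0 <= A.
    by rewrite /A !mulr_ge0 ?(ltW (wt0 _)) ?conn_path_ge0// prodr_ge0.
  apply: (@le_trans _ _ (\sum_(z | wt z <= wt y) mu z * (wt z * conn z y) * A)).
    rewrite big_mkcond [leRHS]big_mkcond /=; apply: ler_sum => z _.
    case: ifPn => [/andP[_ /= /andP[zx]]|_].
      rewrite cats0 => /allP zt1.
      have -> : wt z <= wt y.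
        by rewrite /y; case/lastP: t1 zt1 {y A A0} => // t1 y zt1; rewrite last_rcons zt1// mem_rcons inE eqxx.
      rewrite /A -cat_cons big_cat big_seq1 last_cat/= conn_path_cat /= connC.
      by rewrite le_eqVlt; apply/orP; left; apply/eqP; rewrite /y; ring.
    by case: ifP => // _; rewrite mulr_ge0// !mulr_ge0 ?conn_ge0 ?(ltW (wt0 _)).
  rewrite -mulr_suml; apply: (@le_trans _ _ (C * wt y * A)).
    rewrite ler_wpM2r//; apply: (le_trans (sum_conn_end_le y)).
    by rewrite ler_wpM2r ?(ltW (wt0 _))// (MC y).
  by rewrite /A /= cats0 le_eqVlt; apply/orP; left; apply/eqP; rewrite /y; ring.
set v := last x t1.
have [vy|vyNc] := boolP (captured v y).
  rewrite big_pred0 => [|z]; first by apply: mulr_ge0 (skeleton_weight_ge0 _); apply: le_trans (MC x); exact: M0 x.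
  apply/negbTE; rewrite negb_and; apply/orP; left.
  by apply/negP => /shortcut_free_via; rewrite -/v vy.
set A := wt x * wt (last y t2) * ((\prod_(v <- x :: t1) mu v) * (\prod_(v <- y :: t2) mu v))
  * (conn_path x t1 * conn_path y t2).
have A0 : 0 <= A.
  by rewrite /A !mulr_ge0 ?(ltW (wt0 _)) ?conn_path_ge0// prodr_ge0.
apply: (@le_trans _ _ (\sum_(z | (wt z <= wt v) && (wt z <= wt y))
    mu z * (conn v z * conn z y) * A)).
  rewrite big_mkcond [leRHS]big_mkcond /=; apply: ler_sum => z _.
  case: ifPn => [/andP[_ /= /andP[zx]]|_].
    rewrite all_cat /= => /and3P[/allP zt1 -> _].
    have -> : wt z <= wt v.
      by rewrite /v; case/lastP: t1 zt1 {v vyNc A A0} => // t1 v zt1; rewrite last_rcons zt1// mem_rcons inE eqxx.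
    rewrite /= /A -cat_cons big_cat !big_cons last_cat/= conn_path_cat /=.
    by rewrite le_eqVlt; apply/orP; left; apply/eqP; rewrite /v; ring.
  by case: ifP => // _; rewrite mulr_ge0// !mulr_ge0 ?conn_ge0.
rewrite -mulr_suml; apply: (@le_trans _ _ (C * conn v y * A)).
  by rewrite ler_wpM2r// sum_conn_via_le.
rewrite /A /= -cat_cons big_cat last_cat/= conn_path_cat !big_cons.
by rewrite le_eqVlt; apply/orP; left; apply/eqP; rewrite /v; ring.
Qed.

(* Each deletion of a lightest vertex contributes its number of possible
   positions, whence the factorial. *)
Lemma sum_skeleton_le m :
  \sum_(s : m.+1.-tuple Z | shortcut_free s) skeleton_weight s <=
  (m.+1)`!%:R * C ^+ m * \sum_z mu z * wt z ^+ 2.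
Proof.
have [z0|noZ] := pickP [pred z : Z | true]; last first.
  rewrite !big1 ?mulr0// => [z|s] _; first by have := noZ z.
  by have := noZ (tnth s ord0).
move=> _; have C0 : 0 <= C by apply: le_trans (MC z0); exact: M0 z0.
elim: m => [|m IH].
  rewrite (sum_tuple_insert ord0 shortcut_free skeleton_weight).
  rewrite (eq_bigr (fun _ => \sum_z mu z * wt z ^+ 2)) => [|t _].
    by rewrite sumr_const card_tuple expn0 !mulr1n /= expr0 !mul1r.
  rewrite (tuple0 t); apply: eq_big => // z _.
  by rewrite /skeleton_weight /= big_seq1; ring.
have weakest (s : m.+2.-tuple Z) : exists j : 'I_m.+2,
    all (fun y => wt (tnth s j) <= wt y) (take j s ++ drop j.+1 s).
  pose j := [arg min_(j < ord0 : 'I_m.+2) wt (tnth s j)]%O.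
  exists j; rewrite /j; case: arg_minP => // i _ imin.
  apply/allP => y; rewrite mem_cat => ys.
  have /tnthP[l ->] : y \in tval s.
    by case/orP: ys => [/mem_take|/mem_drop].
  exact: imin.
apply: (@le_trans _ _ (\sum_(j < m.+2) \sum_(s : m.+2.-tuple Z | shortcut_free s &&
    all (fun y => wt (nth z0 s j) <= wt y) (take j s ++ drop j.+1 s)) skeleton_weight s)).
  rewrite (exchange_big_dep (fun s : m.+2.-tuple Z => shortcut_free s)) /=; last first.
    by move=> j s _ /andP[].
  apply: ler_sum => s sf; have [j hj] := weakest s.
  rewrite (bigD1 j) /=; last by rewrite sf -(tnth_nth z0).
  by rewrite lerDl sumr_ge0// => *; exact: skeleton_weight_ge0.
apply: (@le_trans _ _ (\sum_(j < m.+2) C * \sum_(t : m.+1.-tuple Z | shortcut_free t) skeleton_weight t)).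
  apply: ler_sum => j _.
  rewrite (sum_tuple_insert j (fun s => shortcut_free s && all (fun y => wt (nth z0 s j) <= wt y) (take j s ++ drop j.+1 s))).
  rewrite mulr_sumr [leRHS]big_mkcond /=; apply: ler_sum => t _.
  have jt := size_take_ord j t.
  have tE z : take j (take j t ++ z :: drop j t) ++ drop j.+1 (take j t ++ z :: drop j t) = t.
    rewrite take_size_cat// -cat_rcons drop_size_cat ?size_rcons ?jt//.
    by rewrite cat_take_drop.
  have nE z : nth z0 (take j t ++ z :: drop j t) j = z by rewrite nth_cat jt ltnn subnn.
  under eq_bigl => z do rewrite tE nE.
  case: ifPn => [sft|/negP sft]; last first.
    rewrite big_pred0// => z; apply/negbTE/negP => /andP[/shortcut_free_del].
    by rewrite cat_take_drop.
  have := @sum_insert_le (take j t) (drop j t); rewrite cat_take_drop size_tuple.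
  exact.
rewrite sumr_const card_ord -[leLHS]mulr_natl factS natrM exprS.
rewrite [leRHS](_ : _ = m.+2%:R * (C * ((m.+1)`!%:R * C ^+ m * \sum_z mu z * wt z ^+ 2))).
  by rewrite ler_wpM2l// ler_wpM2l.
by generalize C => c; ring.
Qed.

End skeleton_kernel.

(** * Paths of the rumour *)

Section rumour_paths.
Variables (N : nat) (e : rel nat) (y : nat -> nat -> nat).
Hypothesis esym : symmetric e.

Definition transmits r u v := e u v && ((y r u == v) || (y r v == u)).

Lemma informed_path s t i : (i < N)%N -> informed N e s y t i ->
  exists l : seq (nat * nat),
    [/\ path (fun p q => transmits q.1 p.2 q.2) (0%N, s) l,
        sorted ltn (map fst l),
        all (fun p => p.1 < t)%N l,
        all (fun p => p.2 < N)%N l &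
        (last (0%N, s) l).2 = i].
Proof.
elim: t i => [|r IH] i iN /=.
  by move=> /eqP ->; exists [::].
have widen l : all (fun p : nat * nat => p.1 < r)%N l -> all (fun p => p.1 < r.+1)%N l.
  by apply: sub_all => p /= h; exact: leqW.
case/orP => [/(IH _ iN)[l [h1 h2 h3 h4 h5]]|/hasP[j]].
  by exists l; split => //; exact: widen.
rewrite mem_filter mem_iota /= => /andP[eij jN] /andP[/(IH _ jN)[l [h1 h2 h3 h4 h5]] yij].
exists (rcons l (r, i)); split.
- by rewrite rcons_path h1 /= h5 /transmits esym eij /= orbC.
- rewrite map_rcons; case: l h2 h3 {h1 h4 h5} => //= p l h2 /andP[pr lr].
  rewrite rcons_path h2 /=.
  by rewrite (last_map fst) /=; case/lastP: l lr {h2} => //= l q; rewrite all_rcons last_rcons => /andP[].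
- by rewrite all_rcons /= ltnS leqnn; exact: widen.
- by rewrite all_rcons /= iN.
- by rewrite last_rcons.
Qed.

Lemma informed_start s t i : (i < N)%N -> informed N e s y t i -> (s < N)%N.
Proof.
elim: t i => [|r IH] i iN /=; first by move=> /eqP <-.
case/orP => [/(IH _ iN)//|/hasP[j]].
by rewrite mem_filter mem_iota /= => /andP[_ jN] /andP[/(IH _ jN)].
Qed.

Lemma split_last_has (T : Type) (p : pred T) (l : seq T) : has p l ->
  exists l1 a l2, [/\ l = l1 ++ a :: l2, p a & ~~ has p l2].
Proof.
elim: l => //= a l IH; have [hl _|hl] := boolP (has p l).
  by have [l1 [b [l2 [-> pb h]]]] := IH hl; exists (a :: l1), b, l2.
by rewrite orbF => pa; exists [::], a, l.
Qed.

Variable cap : rel nat.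

Definition linked (p q : nat * nat) := cap p.2 q.2 || transmits q.1 p.2 q.2.

(* From the current vertex, jump to the last vertex of the path captured by it. *)
Lemma shorten_path p l : path linked p l ->
  exists l', [/\ path linked p l', subseq l' l, (last p l').2 = (last p l).2,
    uniq (map snd (p :: l')) & shortcut_free cap (map snd (p :: l'))].
Proof.
have [n] := ubnP (size l); elim: n => // n IH in p l *; rewrite ltnS => ln pl.
have [nl|] := boolP (has (fun q => q.2 == p.2) l).
  have [l1 [a [l2 [lE /eqP ap _]]]] := split_last_has nl.
  have : path linked p l2.
    move: pl; rewrite lE cat_path /= => /and3P[_ _].
    by case: (l2) => //= b l3; rewrite /linked ap.
  have l2n : (size l2 < n)%N.
    by apply: leq_trans ln; rewrite lE size_cat /= addnS ltnS leq_addl.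
  move=> /(IH _ _ l2n)[l' [h1 h2 h3 h4 h5]]; exists l'; split => //.
    rewrite lE; apply: (subseq_trans h2); rewrite -cat_rcons.
    exact: suffix_subseq.
  rewrite h3 lE last_cat /=; case: (l2) => //=.
rewrite -all_predC => /allP pNl.
have rest q l2 l1 : l = l1 ++ q :: l2 -> linked p q -> ~~ has (fun b => cap p.2 b.2) l2 ->
  exists l', [/\ path linked p l', subseq l' l, (last p l').2 = (last p l).2,
    uniq (map snd (p :: l')) & shortcut_free cap (map snd (p :: l'))].
  move=> lE pq ncap.
  have l2n : (size l2 < n)%N.
    by apply: leq_trans ln; rewrite lE size_cat /= addnS ltnS leq_addl.
  have : path linked q l2 by move: pl; rewrite lE cat_path /= => /and3P[].
  move=> /(IH _ _ l2n)[l' [h1 h2 h3 h4 h5]]; exists (q :: l').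
  have sub : subseq (q :: l') l.
    rewrite lE; apply: (@subseq_trans _ (q :: l2)); last exact: suffix_subseq.
    by rewrite /= eqxx.
  split => //.
  - by rewrite /= pq.
  - by rewrite lE last_cat.
  - rewrite map_cons cons_uniq h4 andbT; apply/negP => /mapP[b bl' bp].
    by have := pNl b (mem_subseq sub bl'); rewrite /= bp eqxx.
  - rewrite map_cons [shortcut_free _ _]/= -/(shortcut_free cap (q.2 :: map snd l')).
    rewrite h5 andbT; apply/allP => v /mapP[b bl' ->].
    by move: ncap; rewrite -all_predC => /allP /(_ b (mem_subseq h2 bl')).
have [|nc] := boolP (has (fun b => cap p.2 b.2) l).
  move=> /split_last_has[l1 [a [l2 [lE pa nl2]]]]; apply: (rest a l2 l1) => //.
  by rewrite /linked pa.
case: l => [|q l] in rest ln pl nc pNl *; first by exists [::].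
apply: (rest q l [::]) => //; first by move: pl => /andP[].
by move: nc; rewrite /= negb_or => /andP[].
Qed.

(* Type 0: the pair is captured; 1: the first vertex contacts the second one;
   2: the second vertex contacts the first one. *)
Fixpoint step_types u (l : seq (nat * nat)) : seq (nat * nat) :=
  if l is q :: l' then
    (q.1, if cap u q.2 then 0%N else if e u q.2 && (y q.1 u == q.2) then 1%N else 2)
      :: step_types q.2 l'
  else [::].

Lemma step_types_rounds u l : map fst (step_types u l) = map fst l.
Proof. by elim: l u => //= q l IH u; rewrite IH. Qed.

Lemma step_types_lt3 u l rt : rt \in step_types u l -> (rt.2 < 3)%N.
Proof.
elim: l u => //= q l IH u; rewrite inE => /orP[/eqP -> /=|/IH//].
by case: ifP => // _; case: ifP.
Qed.

Lemma size_step_types u l : size (step_types u l) = size l.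
Proof. by elim: l u => //= q l IH u; rewrite IH. Qed.

Lemma step_types_mem r u l st : path linked (r, u) l ->
  st \in zip (zip (u :: map snd l) (map snd l)) (step_types u l) ->
  if st.2.2 == 0%N then cap st.1.1 st.1.2
  else e st.1.1 st.1.2 && (if st.2.2 == 1%N then y st.2.1 st.1.1 == st.1.2
                           else y st.2.1 st.1.2 == st.1.1).
Proof.
elim: l r u => //= -[r' v] l IH r u /andP[uv pl]; rewrite inE => /orP[/eqP -> /=|]; last exact: IH pl.
move: uv; rewrite /linked /transmits /=; case: (cap u v) => //=.
by case: (e u v) => //=; case: (y r' u == v).
Qed.

End rumour_paths.

(** * Countably valued random variables *)

Section discrete_measurability.
Context {Omega : Type} (F : set (set Omega)).
Hypothesis sF : sigma_algebra setT F.

Lemma sigma_algebra_setC A : F A -> F (~` A).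
Proof. by move=> FA; rewrite -setTD; case: sF => _ h _; exact: h. Qed.

Lemma sigma_algebra_bigcup (A : nat -> set Omega) :
  (forall i, F (A i)) -> F (\bigcup_i A i).
Proof. by case: sF => _ _ h FA; exact: h. Qed.

Lemma sigma_algebra_setT : F setT.
Proof. by rewrite -setC0; apply: sigma_algebra_setC; case: sF. Qed.

Lemma sigma_algebra_setU A B : F A -> F B -> F (A `|` B).
Proof.
move=> FA FB; rewrite -bigcup2E; apply: sigma_algebra_bigcup => -[|[|i]] //=.
by case: sF.
Qed.

Lemma sigma_algebra_setI A B : F A -> F B -> F (A `&` B).
Proof.
move=> FA FB; rewrite -[A]setCK -[B]setCK -setCU.
by apply: sigma_algebra_setC; apply: sigma_algebra_setU; exact: sigma_algebra_setC.
Qed.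

(* All sets are considered as measurable: this is used for countable [T] only. *)
Definition dmeas {T : Type} (f : Omega -> T) : Prop := forall A : set T, F (f @^-1` A).

Lemma dmeas_cst {T : Type} (a : T) : dmeas (fun _ => a).
Proof.
move=> A; rewrite /preimage; have [Aa|Aa] := pselect (A a).
  rewrite (_ : mkset _ = setT); first exact: sigma_algebra_setT.
  by apply/seteqP; split.
rewrite (_ : mkset _ = set0); first by case: sF.
by apply/seteqP; split.
Qed.

Lemma dmeas_comp {T U : Type} (h : T -> U) (f : Omega -> T) :
  dmeas f -> dmeas (h \o f).
Proof. by move=> df A; exact: (df (h @^-1` A)). Qed.

Lemma dmeas_dep {T : countType} {U : Type} (f : Omega -> T) (G : T -> Omega -> U) :
  dmeas f -> (forall a, dmeas (G a)) -> dmeas (fun w => G (f w) w).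
Proof.
move=> df dG A.
pose B (i : nat) : set Omega :=
  if unpickle i is Some a then (f @^-1` [set a]) `&` (G a @^-1` A) else set0.
rewrite (_ : _ @^-1` A = \bigcup_i B i).
  apply: sigma_algebra_bigcup => i; rewrite /B; case: unpickle => [a|].
    by apply: sigma_algebra_setI; [exact: df|exact: dG].
  by case: sF.
apply/seteqP; split => [w Aw|w [i _]].
  by exists (pickle (f w)) => //; rewrite /B pickleK.
by rewrite /B; case: unpickle => // a [/= <-].
Qed.

Lemma dmeas2 {T : countType} {U V : Type} (h : T -> U -> V) (f : Omega -> T)
  (g : Omega -> U) : dmeas f -> dmeas g -> dmeas (fun w => h (f w) (g w)).
Proof.
move=> df dg; apply: (dmeas_dep (G := fun a w => h a (g w)) df) => a.
exact: (dmeas_comp (h a)).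
Qed.

Lemma dmeas_map {I : Type} {T : countType} (s : seq I) (f : I -> Omega -> T) :
  (forall i, dmeas (f i)) -> dmeas (fun w => [seq f i w | i <- s]).
Proof.
move=> df; elim: s => [|i s IH]; first exact: dmeas_cst.
exact: (dmeas2 (fun a b => a :: b)).
Qed.

Lemma dmeas_bool (b : Omega -> bool) : dmeas b -> F [set w | b w].
Proof. by move=> db; have := db [set true]. Qed.

End discrete_measurability.

Lemma dmeas_sub {Omega T : Type} (F G : set (set Omega)) (f : Omega -> T) :
  F `<=` G -> dmeas F f -> dmeas G f.
Proof. by move=> FG df A; exact/FG/df. Qed.

Section discrete_probability.
Local Open Scope ereal_scope.
Context {R : realType} {disp : measure_display} {Omega : measurableType disp}.
Variable P : probability Omega R.

Lemma count_markov (I : finType) (A : I -> set Omega) (H : set Omega) (t : R) :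
  (0 <= t)%R -> measurable H -> (forall i, measurable (A i)) ->
  (forall w, H w -> (t <= \sum_i \1_(A i) w)%R) ->
  t%:E * P H <= \sum_i P (A i).
Proof.
move=> t0 mH mA h.
have -> : \sum_i P (A i) = \int[P]_w \sum_i (\1_(A i) w)%:E.
  rewrite ge0_integral_sum//.
  - by apply: eq_bigr => i _; rewrite integral_indic// setIT.
  by move=> i; exact/measurable_EFinP/measurable_indic.
rewrite -integral_cst//.
apply: (@le_trans _ _ (\int[P]_(w in H) \sum_i (\1_(A i) w)%:E)).
  apply: ge0_le_integral => //.
  - by apply: emeasurable_sum => i; exact/measurable_EFinP/measurable_indic.
  - by move=> w Hw; rewrite sumEFin lee_fin; exact: h.
apply: ge0_subset_integral => //.
- by apply: emeasurable_sum => i; exact/measurable_EFinP/measurable_indic.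
- by move=> w _; apply: sume_ge0 => i _; rewrite lee_fin.
Qed.

Lemma union_bound (I : finType) (A : I -> set Omega) (H : set Omega) :
  measurable H -> (forall i, measurable (A i)) ->
  (forall w, H w -> exists i, A i w) -> P H <= \sum_i P (A i).
Proof.
move=> mH mA h; rewrite -[leLHS]mul1e; apply: count_markov => // w /h[i Aiw].
by rewrite (bigD1 i)//= indicE mem_set// lerDl sumr_ge0.
Qed.

Lemma disintegrate_le (T : countType) (f : Omega -> T) (H : set Omega) (c : R) :
  (0 <= c)%R -> measurable H -> (forall a, measurable (f @^-1` [set a])) ->
  (forall a, P (H `&` f @^-1` [set a]) <= c%:E * P (f @^-1` [set a])) ->
  P H <= c%:E.
Proof.
move=> c0 mH mf h.
pose B i : set Omega := if pickle_inv i is Some a then f @^-1` [set a] else set0.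
have mB i : measurable (B i) by rewrite /B; case: pickle_inv.
have Bpickle i w : B i w -> i = pickle (f w).
  by rewrite /B; have := @pickle_invK T i; case: pickle_inv => //= a <- ->.
have tB : trivIset setT B by move=> i j _ _ [w [/Bpickle -> /Bpickle ->]].
have BT : \bigcup_i B i = setT.
  rewrite -subTset => w _; exists (pickle (f w)) => //.
  by rewrite /B pickleK_inv.
have HE : H = \bigcup_i (H `&` B i) by rewrite -setI_bigcupr BT setIT.
rewrite HE measure_bigcup//; last 2 first.
- by move=> i _; exact: measurableI.
- by apply: trivIset_setIl.
apply: (@le_trans _ _ (\sum_(i <oo | i \in setT) (c%:E * P (B i)))).
  apply: lee_nneseries => // i _; rewrite /B; case: pickle_inv => // .
  by rewrite setI0 !measure0 mule0.
rewrite nneseriesZl// -measure_bigcup// BT.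
by rewrite -[leRHS]mule1; apply: lee_wpmul2l; rewrite ?lee_fin//; exact: probability_le1.
Qed.

Lemma cond_indep_law_le (F : set (set Omega)) (I : eqType) d' (T : measurableType d')
    (dom : I -> set Omega) (Z : I -> Omega -> T) (q : I -> Omega -> set T -> \bar R)
    (s : seq I) (A : I -> set T) (B : set Omega) (c : I -> R) :
  cond_indep_law P F dom Z q -> uniq s -> (forall i, measurable (A i)) ->
  F B -> measurable B -> (forall i, i \in s -> B `<=` dom i) ->
  (forall i w, i \in s -> B w -> 0 <= q i w (A i) <= (c i)%:E) ->
  P (B `&` [set w | forall i, i \in s -> A i (Z i w)]) <=
  (\prod_(i <- s) c i)%:E * P B.
Proof.
move=> hZ us mA FB mB Bdom hq; rewrite hZ// -integral_cst//.
have h w : B w -> 0 <= \prod_(i <- s) q i w (A i) <= (\prod_(i <- s) c i)%:E.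
  move=> Bw; elim: s {us Bdom} hq => [_|i s IH hq].
    by rewrite !big_nil lexx lee_fin ler01.
  rewrite !big_cons EFinM.
  have /andP[q0 qc] := hq i w (mem_head _ _) Bw.
  have /andP[s0 sc] : 0 <= \prod_(i <- s) q i w (A i) <= (\prod_(i <- s) c i)%:E.
    by apply: IH => j v js Bv; apply: hq; rewrite // inE js orbT.
  by rewrite mule_ge0//= lee_pmul.
rewrite [leLHS]ge0_integralE; last by move=> w /h/andP[].
rewrite [leRHS]ge0_integralE; last by move=> w /h/andP[]; exact: le_trans.
apply: le_ereal_sup => _ /= [g gle <-]; exists g => // w.
apply: (le_trans (gle w)); rewrite /patch; case: ifPn => // /set_mem Bw.
by have /andP[] := h w Bw.
Qed.

End discrete_probability.

(** * The torus and its grid *)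

Section torus_volume.
Context {R : realType}.
Implicit Type d : nat.

Lemma torus_vol0 d : torus_vol (set0 : set (torus_point R d)) = 0%E.
Proof.
elim: d => [|d IH] /=; first by rewrite diracE in_set0.
rewrite (_ : (fun _ => _) = cst 0%E); first by rewrite integral0.
apply/funext => a; rewrite -[RHS]IH; congr torus_vol.
Qed.

Lemma torus_vol_box d (A : 'I_d -> set R) :
  (forall c, measurable (A c)) ->
  torus_vol [set x : torus_point R d | forall c, A c (tnth x c)] =
  (\prod_(c < d) @lebesgue_measure R (A c `&` `[0%R, 1%R[))%E.
Proof.
elim: d A => [|d IH] A mA.
  by rewrite big_ord0 /= diracE mem_set//= => -[].
rewrite big_ord_recl /=.
have m0 : measurable (A ord0 `&` `[0, 1[) by apply: measurableI => //; exact: mA.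
set v := (\prod_(i < d) _)%E.
have v0 : (0 <= v)%E by rewrite /v; apply: prode_ge0 => i _.
transitivity (\int[@lebesgue_measure R]_(a in `[0%R, 1%R[) ((\1_(A ord0) a)%:E * v))%E.
  apply: eq_integral => a _; rewrite indicE; have [Aa|Aa] := boolP (a \in A ord0).
    rewrite mul1e /v -IH => [|c]; last exact: mA.
    congr torus_vol; apply/seteqP; split => x /= h c.
      by have := h (lift ord0 c); rewrite tnthS.
    case: (unliftP ord0 c) => [c' ->|->]; last by rewrite tnth0; exact: set_mem.
    by rewrite tnthS.
  rewrite mul0e -(torus_vol0 d); congr torus_vol; apply/seteqP; split => // x /= h.
  by have := h ord0; rewrite tnth0 => /mem_set; rewrite (negbTE Aa).
rewrite ge0_integralZr//.
  by rewrite integral_indic//; exact: mA.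
by apply/measurable_EFinP; apply: measurable_indic; exact: mA.
Qed.

Lemma V_inftyE d (r : R) : 0 <= r <= 2^-1 -> V_infty d r = (2 * r) ^+ d.
Proof.
move=> /andP[r0 r1]; rewrite /V_infty.
have -> : [set x : torus_point R d | torus x /\ torus_dist x (torus0 d) <= r] =
    [set x | forall c, (`[0, r] `|` `[1 - r, 1[)%classic (tnth x c)].
  apply/seteqP; split => x /= => [[tx xr] c|h].
    have /andP[x0 x1] := tx c.
    have : circle_dist (tnth x c) (tnth (torus0 d) c) <= r.
      by apply: le_trans xr; rewrite /torus_dist; exact: le_bigmax.
    rewrite tnth_mktuple /circle_dist subr0 ger0_norm// ge_min !in_itv/=.
    by case/orP => h; [left|right]; apply/andP; split => //; lra.
  have hx c : 0 <= tnth x c < 1 /\ circle_dist (tnth x c) 0 <= r.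
    rewrite /circle_dist subr0 ge_min; have := h c.
    rewrite !in_itv/= => -[/andP[a b]|/andP[a b]].
      by rewrite ger0_norm//; split; [apply/andP; split; lra|rewrite b].
    have x0 : 0 <= tnth x c by lra.
    by rewrite ger0_norm//; split; [apply/andP; split; lra|apply/orP; right; lra].
  split; first by move=> c; have [] := hx c.
  rewrite /torus_dist; apply/bigmax_leP; split => // c _.
  by rewrite tnth_mktuple; have [] := hx c.
rewrite (torus_vol_box (A := fun _ => `[0, r] `|` `[1 - r, 1[)) => [|c]; last exact: measurableU.
have -> : (`[0, r] `|` `[1 - r, 1[) `&` `[0, 1[ = `[0, r] `|` `[1 - r, 1[ :> set R.
  apply/setIidPl => x; rewrite /= !in_itv/= => -[|] /andP[a b]; apply/andP; split; lra.
have -> : @lebesgue_measure R (`[0, r] `|` `[1 - r, 1[) = (2 * r)%:E.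
  have [r2|r2] := ltP r 2^-1.
    have E1 : @lebesgue_measure R `[0, r] = r%:E.
      rewrite lebesgue_measure_itv /= lte_fin; case: ltP => r3.
        by rewrite -EFinB subr0.
      by congr EFin; apply/eqP; rewrite eq_le r0.
    have E2 : @lebesgue_measure R `[1 - r, 1[ = r%:E.
      rewrite lebesgue_measure_itv /= lte_fin; case: ltP => r3.
        by rewrite -EFinB; congr EFin; lra.
      by congr EFin; lra.
    transitivity (@lebesgue_measure R `[0%R, r] + @lebesgue_measure R `[(1 - r)%R, 1%R[)%E.
      apply: measureU => //.
      by apply/seteqP; split => // x []; rewrite /= !in_itv/= => /andP[? ?] /andP[? ?]; lra.
    by rewrite E1 E2 -EFinD; congr EFin; lra.
  have -> : r = 2^-1 by apply/eqP; rewrite eq_le r1.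
  rewrite (_ : _ `|` _ = `[0, 1[%classic); last first.
    apply/seteqP; split => x; rewrite /= !in_itv/=.
      by case=> /andP[? ?]; apply/andP; split; lra.
    move=> /andP[? ?]; have [?|?] := leP x 2^-1; [left|right]; apply/andP; split; lra.
  by rewrite lebesgue_measure_itv /= lte_fin ltr01 -EFinB; congr EFin; lra.
by rewrite prodEFin /= prodr_const card_ord.
Qed.

End torus_volume.

Section cyclic_grid.
Context {R : realType}.
Variables (q d : nat).
Notation Q := q.+1.
Implicit Types (a b c : 'I_Q) (x y z : {ffun 'I_d -> 'I_Q}).

Definition cyc_dist a b : nat :=
  minn (maxn a b - minn a b) (Q - (maxn a b - minn a b)).

Lemma cyc_distC a b : cyc_dist a b = cyc_dist b a.
Proof. by rewrite /cyc_dist (maxnC a) (minnC a). Qed.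

Lemma cyc_dist_triangle a b c : (cyc_dist a b <= cyc_dist a c + cyc_dist c b)%N.
Proof.
rewrite /cyc_dist; have := ltn_ord a; have := ltn_ord b; have := ltn_ord c.
lia.
Qed.

Lemma cyc_dist_add a t : cyc_dist a (a + t) = minn t (Q - t).
Proof.
rewrite /cyc_dist /=; have := ltn_ord a; have := ltn_ord t.
have [h|h] := ltnP (a + t) Q; first by rewrite modn_small//; lia.
move=> t1 a1; have -> : ((a + t) %% Q = a + t - Q)%N.
  by rewrite -[in LHS](subnK h) modnDr modn_small//; lia.
lia.
Qed.

Definition grid_dist x y : nat := \max_(i < d) cyc_dist (x i) (y i).

Lemma grid_distC x y : grid_dist x y = grid_dist y x.
Proof. by apply: eq_bigr => i _; rewrite cyc_distC. Qed.

Lemma grid_dist_triangle x y z :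
  (grid_dist x y <= grid_dist x z + grid_dist z y)%N.
Proof.
apply/bigmax_leqP => i _; apply: (leq_trans (cyc_dist_triangle _ _ (z i))).
by apply: leq_add; exact: (leq_bigmax (F := fun i => cyc_dist _ _)).
Qed.

Definition grid_vol x y : R := (grid_dist x y).+1%:R ^+ d.

Lemma grid_volC x y : grid_vol x y = grid_vol y x.
Proof. by rewrite /grid_vol grid_distC. Qed.

Lemma grid_vol_ge1 x y : 1 <= grid_vol x y.
Proof. by rewrite /grid_vol exprn_ege1// ler1n. Qed.

Lemma grid_vol_triangle x y z :
  grid_vol x y <= 2 ^+ d * Num.max (grid_vol x z) (grid_vol z y).
Proof.
have t := grid_dist_triangle x y z.
have step u v : ((grid_dist x y).+1 <= 2 * (grid_dist u v).+1)%N ->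
    grid_vol x y <= 2 ^+ d * grid_vol u v.
  move=> h; rewrite /grid_vol -exprMn lerXn2r ?nnegrE ?mulr_ge0//.
  by rewrite -natrM ler_nat.
have [h|/ltnW h] := leqP (grid_dist z y) (grid_dist x z).
  apply: (le_trans (step x z _)); first lia.
  by rewrite ler_wpM2l ?exprn_ge0// le_max lexx.
apply: (le_trans (step z y _)); first lia.
by rewrite ler_wpM2l ?exprn_ge0// le_max lexx orbT.
Qed.

Definition harm_sum (n : nat) : R := \sum_(j < n) j.+1%:R^-1.

Lemma sum_grid_vol_le x :
  \sum_y (grid_vol x y)^-1 <= (2 * harm_sum Q) ^+ d.
Proof.
apply: (@le_trans _ _ (\sum_(y : {ffun 'I_d -> 'I_Q}) \prod_(i < d) ((cyc_dist (x i) (y i)).+1%:R^-1 : R))).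
  apply: ler_sum => y _; rewrite prodfV lef_pV2 ?posrE ?prodr_gt0//; last first.
    by rewrite exprn_gt0.
  rewrite /grid_vol -[X in _ ^+ X]card_ord -prodr_const; apply: ler_prod => i _.
  by rewrite ler0n ler_nat ltnS (leq_bigmax (F := fun i => cyc_dist _ _)).
rewrite -(bigA_distr_bigA (fun i b => (cyc_dist (x i) b).+1%:R^-1 : R)).
rewrite -[X in _ ^+ X]card_ord -prodr_const; apply: ler_prod => i _.
rewrite sumr_ge0//= (reindex_inj (addrI (x i))) /=.
under eq_bigr => t _ do rewrite cyc_dist_add.
apply: (@le_trans _ _ (\sum_(t < Q) (t.+1%:R^-1 + (Q - t)%:R^-1 : R))).
  apply: ler_sum => t _; have tQ := ltn_ord t; rewrite /minn; case: ifP => _.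
    by rewrite lerDl.
  apply: (@le_trans _ _ (Q - t)%:R^-1); last by rewrite lerDr.
  by rewrite lef_pV2 ?posrE ?ltr0n ?subn_gt0// ler_nat.
rewrite big_split /= mulr_natl mulr2n lerD2l /harm_sum.
rewrite [leRHS](reindex_inj rev_ord_inj) /= le_eqVlt; apply/orP; left; apply/eqP.
by apply: eq_bigr => t _; rewrite subnSK.
Qed.

Lemma card_grid_ball x (j : nat) : (j < Q)%N ->
  (j.+1 ^ d <= #|[pred y | (grid_dist x y <= j)%N]|)%N.
Proof.
move=> jQ; have -> : (j.+1 ^ d = #|{ffun 'I_d -> 'I_j.+1}|)%N.
  by rewrite card_ffun !card_ord.
pose h (t : {ffun 'I_d -> 'I_j.+1}) : {ffun 'I_d -> 'I_Q} :=
  [ffun i => x i + widen_ord jQ (t i)].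
have h_inj : injective h.
  move=> t u /ffunP tu; apply/ffunP => i; have := tu i; rewrite !ffunE.
  by move/addrI/(congr1 val) => /= /val_inj.
rewrite -(card_imset _ h_inj) subset_leq_card//; apply/fintype.subsetP => y /imsetP[t _ ->].
rewrite inE; apply/bigmax_leqP => i _; rewrite ffunE cyc_dist_add /=.
by rewrite geq_min -ltnS ltn_ord.
Qed.

End cyclic_grid.

Section grid_cells.
Context {R : realType}.
Variables (q d : nat).
Notation Q := q.+1.
Implicit Types (x y : torus_point R d) (k : {ffun 'I_d -> 'I_Q}).

Definition cell x : {ffun 'I_d -> 'I_Q} :=
  [ffun i => inord (Num.truncn (Q%:R * tnth x i))].

Lemma circle_cyc_dist (u v : R) (a b : 'I_Q) :
  a%:R <= Q%:R * u < a%:R + 1 -> b%:R <= Q%:R * v < b%:R + 1 ->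
  Q%:R * circle_dist u v <= (cyc_dist a b)%:R + 1 /\
  (cyc_dist a b)%:R <= Q%:R * circle_dist u v + 1.
Proof.
wlog ab : a b u v / (a <= b)%N => [W|] ha hb.
  have [/W|/ltnW/W] := leqP a b; first exact.
  by rewrite cyc_distC /circle_dist distrC; apply.
have [i iE] : exists i, nat_of_ord b = (a + i)%N by exists (b - a)%N; rewrite subnKC.
have iQ : (i < Q)%N by have := ltn_ord b; rewrite iE; lia.
have -> : cyc_dist a b = minn i (Q - i) by rewrite /cyc_dist iE; lia.
have Q0 : 0 < Q%:R :> R by rewrite ltr0n.
rewrite /circle_dist minr_pMr ?(ltW Q0)// mulrBr mulr1.
have -> : Q%:R * `|u - v| = `|Q%:R * u - Q%:R * v|.
  by rewrite -mulrBr normrM ger0_norm// ltW.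
have -> : (minn i (Q - i))%:R = Num.min i%:R (Q%:R - i%:R) :> R.
  rewrite -natrB; last exact: ltnW.
  have [h|/ltnW h] := leqP i (Q - i).
    by rewrite min_l// ler_nat.
  by rewrite min_r// ler_nat.
move: ha hb; rewrite iE natrD => /andP[ha ha'] /andP[hb hb'].
have i0 : 0 <= i%:R :> R by [].
set U := Q%:R * u in ha ha' *; set V := Q%:R * v in hb hb' *.
have : `|U - V| - 1 <= i%:R <= `|U - V| + 1.
  by apply/andP; split; case: (ler0P (U - V)) => ?; lra.
move=> /andP[h1 h2]; rewrite -lerBlDr; split.
  rewrite le_min; apply/andP; split; rewrite lerBlDr ge_min; apply/orP.
    by left; lra.
  by right; lra.
rewrite -lerBlDr le_min; apply/andP; split; rewrite lerBlDr ge_min; apply/orP.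
  by left; lra.
by right; lra.
Qed.

Lemma cell_coord x (i : 'I_d) : torus x ->
  (cell x i)%:R <= Q%:R * tnth x i < (cell x i)%:R + 1.
Proof.
move=> /(_ i)/andP[x0 x1]; rewrite ffunE.
have xQ0 : 0 <= Q%:R * tnth x i by rewrite mulr_ge0.
rewrite inordK; first by rewrite natr1; exact: Num.Theory.truncn_itv.
rewrite -(ltr_nat R); apply: le_lt_trans (_ : Q%:R * tnth x i < _).
  by have /andP[] := Num.Theory.truncn_itv xQ0.
by rewrite gtr_pMr ?ltr0n.
Qed.

Lemma torus_dist_ge0 x y : 0 <= torus_dist x y.
Proof. exact: bigmax_ge_id. Qed.

Lemma torus_dist_half x y : torus x -> torus y -> torus_dist x y <= 2^-1.
Proof.
move=> tx ty; apply/bigmax_leP; split; first by rewrite invr_ge0.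
move=> i _; have /andP[x0 x1] := tx i; have /andP[y0 y1] := ty i.
rewrite /circle_dist ge_min; have [h|h] := leP `|tnth x i - tnth y i| 2^-1 => //=.
by lra.
Qed.

Lemma torus_grid_dist x y : torus x -> torus y ->
  Q%:R * torus_dist x y <= (grid_dist (cell x) (cell y))%:R + 1.
Proof.
move=> tx ty; rewrite mulrC -ler_pdivlMr ?ltr0n//; apply/bigmax_leP; split.
  by rewrite divr_ge0// addr_ge0.
move=> i _; rewrite ler_pdivlMr ?ltr0n// mulrC.
have [h _] := circle_cyc_dist (cell_coord i tx) (cell_coord i ty).
apply: (le_trans h); rewrite lerD2r ler_nat.
exact: (leq_bigmax (F := fun i => cyc_dist _ _)).
Qed.

Lemma grid_torus_dist x y : torus x -> torus y ->
  (grid_dist (cell x) (cell y))%:R <= Q%:R * torus_dist x y + 1.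
Proof.
move=> tx ty; rewrite /grid_dist.
elim/big_ind : _ => [|a b ha hb|i _].
- by rewrite addr_ge0// mulr_ge0// torus_dist_ge0.
- by rewrite /maxn; case: ifP.
have [_ h] := circle_cyc_dist (cell_coord i tx) (cell_coord i ty).
apply: (le_trans h); rewrite lerD2r ler_pM2l ?ltr0n//.
exact: le_bigmax.
Qed.

Lemma volume_rescale (n : nat) (r : R) :
  n%:R * (2 * r) ^+ d = n%:R / Q%:R ^+ d * (2 * (Q%:R * r)) ^+ d.
Proof.
have Qd : Q%:R ^+ d != 0 :> R by rewrite expf_neq0// pnatr_eq0.
by rewrite mulrCA (exprMn _ Q%:R) -mulrA mulKf.
Qed.

Lemma girg_kernel_le (alpha a : R) n x y (wu wv b c : R) :
  torus x -> torus y -> 1 <= a <= alpha -> 2 ^+ d <= n%:R / Q%:R ^+ d :> R ->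
  0 < wu -> 0 < wv -> 1 <= b -> 1 <= c -> wu <= 2 * b -> wv <= 2 * c ->
  girg_kernel alpha n x y wu wv <=
  Num.min 1 ((4 * 2 ^+ d * (b * c) / grid_vol (R := R) (cell x) (cell y)) `^ a).
Proof.
move=> tx ty /andP[a1 aalpha] lam wu0 wv0 b1 c1 wub wvc.
have b0 : 0 < b by apply: lt_le_trans b1.
have c0 : 0 < c by apply: lt_le_trans c1.
have L0 : 0 < grid_vol (R := R) (cell x) (cell y).
  by apply: lt_le_trans (grid_vol_ge1 _ _).
rewrite /girg_kernel; set r := torus_dist x y.
set D := grid_dist (cell x) (cell y); set L := grid_vol _ _ in L0 *.
have r0 : 0 <= r by exact: torus_dist_ge0.
have r1 : r <= 2^-1 by exact: torus_dist_half.
have Q0 : 0 < Q%:R :> R by rewrite ltr0n.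
set t := _ / L.
have d1 : 1 <= 2 ^+ d :> R by rewrite exprn_ege1// ler1n.
have bc : 1 <= b * c by rewrite -[1]mulr1 ler_pM.
have powt : 1 <= t -> 1 <= t `^ a.
  by move=> t1; apply: (le_trans t1); exact: le1r_powR.
rewrite V_inftyE ?r0//.
have [D1|D2] := leqP D 1.
  rewrite [leRHS]min_l; first by case: ifP => // _; rewrite ge_min lexx orbT.
  apply: powt; rewrite /t ler_pdivlMr// mul1r.
  apply: (@le_trans _ _ (2 ^+ d)); first by rewrite /L /grid_vol lerXn2r ?nnegrE// ler_nat.
  rewrite (_ : 4 * 2 ^+ d * (b * c) = 2 ^+ d * (4 * (b * c))); last by ring.
  by rewrite ler_peMr ?exprn_ge0//; lra.
have Dr : D%:R <= Q%:R * r + 1 by exact: grid_torus_dist.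
have nV : L <= n%:R * (2 * r) ^+ d.
  rewrite /L /grid_vol -/D volume_rescale.
  apply: (@le_trans _ _ (2 ^+ d * (2 * (Q%:R * r)) ^+ d)); last first.
    by rewrite ler_wpM2r// exprn_ge0// !mulr_ge0 ?(ltW Q0).
  have D2' : 2 <= D%:R :> R by rewrite ler_nat.
  rewrite -exprMn lerXn2r ?nnegrE ?mulr_ge0 ?(ltW Q0)// -natr1; lra.
have nV0 : 0 < n%:R * (2 * r) ^+ d by apply: lt_le_trans nV.
rewrite gt_eqF//; set s := wu * wv / _.
have s0 : 0 < s by rewrite /s divr_gt0// mulr_gt0.
have st : s <= t.
  rewrite /s /t ler_pM ?invr_ge0 ?(ltW nV0) ?(ltW (mulr_gt0 wu0 wv0))//; last first.
    by rewrite lef_pV2 ?posrE.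
  apply: (@le_trans _ _ (2 * b * (2 * c))); first by rewrite ler_pM// ltW.
  rewrite (_ : 2 * b * (2 * c) = 4 * 1 * (b * c)); last by ring.
  by rewrite ler_wpM2r ?mulr_ge0 ?(ltW b0) ?(ltW c0)// ler_wpM2l.
have [s1|s1] := leP 1 s.
  by rewrite [leRHS]min_l ?ge_min ?lexx ?orbT// powt// (le_trans s1).
have sa : s `^ alpha <= s `^ a by apply: ger_powR; rewrite // s0 ltW.
rewrite le_min !ge_min lexx orbT /=; apply/orP; left; apply: (le_trans sa).
by apply: ge0_ler_powR; rewrite ?nnegrE ?(ltW s0) ?(le_trans (ltW s0) st)//; lra.
Qed.

Lemma girg_kernel_near (alpha : R) n x y (wu wv : R) :
  0 <= alpha -> torus x -> torus y -> 1 <= wv ->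
  n%:R / Q%:R ^+ d * 2 ^+ d * grid_vol (cell x) (cell y) <= wu ->
  girg_kernel alpha n x y wu wv = 1.
Proof.
move=> alpha0 tx ty wv1 nw; rewrite /girg_kernel; case: ifPn => // nV0.
set r := torus_dist x y in nV0 *.
have r0 : 0 <= r by exact: torus_dist_ge0.
have r1 : r <= 2^-1 by exact: torus_dist_half.
have Q0 : 0 < Q%:R :> R by rewrite ltr0n.
rewrite V_inftyE ?r0// in nV0 *.
have V0 : 0 < n%:R * (2 * r) ^+ d.
  by rewrite lt_neqAle eq_sym nV0/= mulr_ge0// exprn_ge0// mulr_ge0.
have VL : n%:R * (2 * r) ^+ d <= wu.
  rewrite volume_rescale; apply: le_trans nw; rewrite -[leRHS]mulrA.
  rewrite ler_wpM2l ?divr_ge0 ?exprn_ge0//.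
  rewrite -exprMn lerXn2r ?nnegrE ?mulr_ge0 ?(ltW Q0)// ler_wpM2l//.
  by rewrite -[leRHS]natr1; exact: torus_grid_dist.
have s1 : 1 <= wu * wv / (n%:R * (2 * r) ^+ d).
  rewrite ler_pdivlMr// mul1r; apply: (le_trans VL); rewrite ler_peMr//.
  exact: le_trans (ltW V0) VL.
apply: min_r; apply: le_trans (ler_powR s1 alpha0).
by rewrite powRr0.
Qed.

Definition cell_set k : set (torus_point R d) := [set x | torus x /\ cell x = k].

Definition cell_side k (i : 'I_d) : set R :=
  `[(k i)%:R / Q%:R, (k i).+1%:R / Q%:R[.

Lemma cell_setE k : cell_set k = [set x | forall i, cell_side k i (tnth x i)].
Proof.
have Q0 : 0 < Q%:R :> R by rewrite ltr0n.
apply/seteqP; split => x /=.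
  move=> [tx <-] i; rewrite /cell_side /= in_itv/=.
  have /andP[h1 h2] := cell_coord i tx.
  by rewrite ler_pdivrMr// ltr_pdivlMr// mulrC h1 -[ltRHS]natr1.
rewrite /cell_side => h.
have hx i : (k i)%:R <= Q%:R * tnth x i < (k i).+1%:R.
  have := h i; rewrite /= in_itv/= ler_pdivrMr// ltr_pdivlMr//.
  by rewrite mulrC.
split=> [i|].
  have /andP[h1 h2] := hx i; apply/andP; split.
    by rewrite -(pmulr_rge0 _ Q0); apply: le_trans h1.
  rewrite -(ltr_pM2l Q0) mulr1; apply: (lt_le_trans h2).
  by rewrite ler_nat ltn_ord.
apply/ffunP => i; rewrite ffunE.
rewrite (Num.Theory.truncn_def (n := k i)) ?inord_val//.
Qed.

Lemma measurable_cell_side k i : measurable (cell_side k i).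
Proof. exact: measurable_itv. Qed.

Lemma measurable_cell_set k : measurable (cell_set k).
Proof.
rewrite cell_setE.
have -> : [set x | forall i, cell_side k i (tnth x i)] =
    \bigcap_(i in [set: 'I_d]) ((fun x : torus_point R d => tnth x i) @^-1` cell_side k i).
  by apply/seteqP; split => x h i; [move=> _; exact: h|exact: h].
apply: fin_bigcap_measurable; first exact: finite_finset.
move=> i _; rewrite -[X in measurable X]setTI.
by apply: (measurable_tnth i) => //; exact: measurable_cell_side.
Qed.

Lemma torus_vol_cell_set k : torus_vol (cell_set k) = (Q%:R ^- d)%:E.
Proof.
have Q0 : 0 < Q%:R :> R by rewrite ltr0n.
rewrite cell_setE torus_vol_box => [|i]; last exact: measurable_cell_side.
rewrite (eq_bigr (fun _ => (Q%:R^-1 : R)%:E)) => [|i _].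
  by rewrite prodEFin prodr_const card_ord exprVn.
rewrite (_ : _ `&` _ = cell_side k i); last first.
  apply/setIidPl => x; rewrite /cell_side /= !in_itv/= => /andP[h1 h2].
  apply/andP; split; first by apply: le_trans h1; rewrite divr_ge0.
  apply: (lt_le_trans h2); rewrite ler_pdivrMr// mul1r ler_nat.
  exact: ltn_ord.
rewrite lebesgue_measure_itv /= lte_fin ltr_pM2r ?invr_gt0// ltr_nat ltnSn.
by rewrite -EFinB -mulrBl -natr1 addrAC subrr add0r mul1r.
Qed.

End grid_cells.

(** * Poisson and power-law tails *)

Section poisson_tails.
Local Open Scope ereal_scope.
Context {R : realType} {disp : measure_display} {Omega : measurableType disp}.
Variable P : probability Omega R.

Lemma level_set_le (nu : probability nat R) (f : Omega -> nat) (U : set nat) (c : R) :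
  (0 <= c)%R -> (forall k, measurable (f @^-1` [set k])) ->
  (forall k, U k -> P (f @^-1` [set k]) <= c%:E * nu [set k]) ->
  P (f @^-1` U) <= c%:E.
Proof.
move=> c0 mf h.
have -> : f @^-1` U = \bigcup_(k in U) f @^-1` [set k].
  by apply/seteqP; split => [w Uw|w [k Uk fw]]; [exists (f w)|rewrite /preimage /= fw].
rewrite measure_bigcup//; last by move=> i j _ _ [w [/= <- <-]].
apply: (@le_trans _ _ (\sum_(k <oo | k \in U) (c%:E * nu [set k]))).
  by apply: lee_nneseries => // k /set_mem; exact: h.
rewrite nneseriesZl// -measure_bigcup//; last by move=> i j _ _ [w [/= -> ->]].
by rewrite -[leRHS]mule1; apply: lee_wpmul2l; rewrite ?lee_fin//; exact: probability_le1.
Qed.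

Lemma poisson_prob1 (rate : R) k : (0 < rate)%R ->
  poisson_prob rate 0 [set k] = (poisson_pmf rate k)%:E.
Proof.
move=> r0; rewrite /poisson_prob r0 esum_set1// lee_fin.
exact: poisson_pmf_ge0.
Qed.

Lemma poisson_pmf_scale (rate c : R) k : (0 < rate)%R -> (0 < c)%R ->
  poisson_pmf rate k = (c ^- k * expR ((c - 1) * rate) * poisson_pmf (c * rate) k)%R.
Proof.
move=> r0 c0; rewrite /poisson_pmf r0 mulr_gt0// exprMn.
rewrite [RHS](_ : _ = (c ^- k * c ^+ k) *
  (rate ^+ k / k`!%:R * (expR ((c - 1) * rate) * expR (- (c * rate)))))%R; last by ring.
rewrite -expRD mulVf ?expf_neq0 ?gt_eqF// mul1r; congr (_ * expR _)%R; ring.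
Qed.

Lemma poisson_upper_tail (rate : R) (f : Omega -> nat) (T : nat) : (0 < rate)%R ->
  (forall k, measurable (f @^-1` [set k])) ->
  (forall k, P (f @^-1` [set k]) = poisson_prob rate 0 [set k]) ->
  P [set w | (T <= f w)%N] <= (2 ^- T * expR rate)%:E.
Proof.
move=> r0 mf hf.
apply: (@level_set_le (poisson_prob (2 * rate) 0) f [set k | (T <= k)%N]) => [|//|k /= Tk].
  by rewrite mulr_ge0// ?invr_ge0 ?exprn_ge0 ?expR_ge0.
rewrite hf !poisson_prob1 ?mulr_gt0// -EFinM lee_fin.
rewrite (@poisson_pmf_scale rate 2)// ler_wpM2r ?poisson_pmf_ge0//.
rewrite (_ : (2 - 1) * rate = rate)%R; last by ring.
rewrite ler_wpM2r ?expR_ge0// lef_pV2 ?posrE ?exprn_gt0//.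
by rewrite ler_eXn2l// ltr1n.
Qed.

Lemma poisson_lower_tail (rate : R) (f : Omega -> nat) (g : nat) : (0 < rate)%R ->
  (forall k, measurable (f @^-1` [set k])) ->
  (forall k, P (f @^-1` [set k]) = poisson_prob rate 0 [set k]) ->
  P [set w | (f w <= g)%N] <= (2 ^+ g * expR (- (rate / 2)))%:E.
Proof.
move=> r0 mf hf.
apply: (@level_set_le (poisson_prob (2^-1 * rate) 0) f [set k | (k <= g)%N]) => [|//|k /= kg].
  by rewrite mulr_ge0// ?exprn_ge0 ?expR_ge0.
rewrite hf !poisson_prob1 ?mulr_gt0 ?invr_gt0// -EFinM lee_fin.
rewrite (@poisson_pmf_scale rate 2^-1) ?invr_gt0// ler_wpM2r ?poisson_pmf_ge0//.
rewrite (_ : (2^-1 - 1) * rate = - (rate / 2))%R; last by field.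
by rewrite ler_wpM2r ?expR_ge0// -exprVn invrK ler_eXn2l// ltr1n.
Qed.

End poisson_tails.

Section power_law_tails.
Context {R : realType}.

Definition unit_itv (m : nat) : set (measurableTypeR R) :=
  `[m%:R, m.+1%:R[%classic.

Lemma measurable_unit_itv m : measurable (unit_itv m).
Proof. exact: measurable_itv. Qed.

Lemma unit_itvP m (x : R) : 0 <= x -> unit_itv m x <-> Num.truncn x = m.
Proof.
move=> x0; rewrite /unit_itv /= in_itv/=; split.
  by move=> h; apply: Num.Theory.truncn_def.
by move=> <-; apply: Num.Theory.truncn_itv.
Qed.

Variables (tau : R) (D : probability (measurableTypeR R) R).
Hypothesis hD : power_law tau D.
Hypothesis tau0 : 0 <= tau.

Lemma powRN_anti (x y : R) : 0 < x -> x <= y -> y `^ (- tau) <= x `^ (- tau).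
Proof.
move=> x0 xy; have y0 : 0 < y by apply: lt_le_trans xy.
by rewrite !powRN lef_pV2 ?posrE ?powR_gt0// ge0_ler_powR// nnegrE ltW.
Qed.

Lemma power_law_unit_mass : exists (c : R) (A : nat), 0 < c /\
  forall m : nat, (A <= m)%N ->
    (D (unit_itv m) <= (c * m%:R `^ (- tau))%:E)%E.
Proof.
case: hD => D1 [[f [mf f0 Df /asboolP[[k1 k2] /= /andP[k1_0 k2_0]]]]|[DN /asboolP[[k1 k2] /= /andP[k1_0 k2_0]]]].
  move=> [A [Areal hA]]; exists k2, (Num.truncn A).+1; split=> // m Am.
  have m0 : 0 < m%:R :> R by rewrite ltr0n; apply: leq_trans Am.
  have Am' : A < m%:R.
    by apply: lt_le_trans (Num.Theory.truncnS_gt A) _; rewrite ler_nat.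
  rewrite Df; last exact: measurable_unit_itv.
  apply: (@le_trans _ _ (\int[lebesgue_measure]_(x in unit_itv m) (k2 * m%:R `^ (- tau))%:E)%E).
    apply: ge0_le_integral => //.
    - exact: measurable_unit_itv.
    - by move=> x _; rewrite lee_fin.
    - by apply/measurable_EFinP; apply: measurable_funTS.
    - move=> x; rewrite /unit_itv /= in_itv/= => /andP[mx _]; rewrite lee_fin.
      have [_] := hA x (lt_le_trans Am' mx).
      rewrite ger0_norm// ger0_norm ?powR_ge0// => h; apply: (le_trans h).
      by rewrite ler_pM2l// powRN_anti.
  rewrite integral_cst; last exact: measurable_unit_itv.
  have mu1 : @lebesgue_measure R (unit_itv m) = 1%E.
    rewrite /unit_itv lebesgue_measure_itv /= lte_fin ltr_nat ltnSn -EFinB.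
    by rewrite -natr1 addrAC subrr add0r.
  by rewrite [X in (_ * X <= _)%E]mu1 mule1.
move=> [A _ hA]; exists k2, A.+1; split=> // m Am.
have := hA m (ltnW Am) => /= -[_].
rewrite ger0_norm ?fine_ge0// ger0_norm ?powR_ge0// -lee_fin fineK ?fin_num_measure// => h.
apply: le_trans h.
have mU := measurable_unit_itv m.
have mN : measurable (range (fun k : nat => k.+1%:R : R)).
  apply: countable_measurable => //.
  by apply: sub_countable (card_image_le _ _) _; exact: countableP.
have DE : D (unit_itv m) = (D (unit_itv m `&` range (fun k : nat => k.+1%:R : R)) + D (unit_itv m `\` range (fun k : nat => k.+1%:R : R)))%E.
  rewrite -measureU ?setUIDK//.
  - exact: measurableI.
  - exact: measurableD.
  by rewrite setIACA setICr setI0.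
rewrite DE.
rewrite (_ : D (_ `\` _) = 0%E) ?adde0; last first.
  apply/eqP; rewrite eq_le measure_ge0 andbT.
  apply: (@le_trans _ _ (D (~` range (fun k : nat => k.+1%:R : R)))).
    by apply: le_measure; [rewrite inE; exact: measurableD|rewrite inE; exact: measurableC|apply: subDsetr].
  rewrite probability_setC//.
  by rewrite [X in (1 - X <= _)%E]DN subee.
apply: le_measure; rewrite ?inE//.
  exact: measurableI.
move=> x [] /[swap] -[k _ <-]; rewrite /unit_itv /= in_itv/= ler_nat ltr_nat => /andP[h1 h2].
by congr (_%:R); apply/eqP; rewrite eqn_leq h1 -ltnS h2.
Qed.

Lemma power_law_mass (g : R) : 0 <= g -> 2 + g <= tau ->
  exists C : R, 0 < C /\ forall m : nat, (0 < m)%N ->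
    (D (unit_itv m) <= (C * m%:R `^ (- (2 + g)))%:E)%E.
Proof.
move=> g0 gtau; have [c [A [c0 hc]]] := power_law_unit_mass.
exists (c + A%:R `^ (2 + g)); split; first by rewrite ltr_wpDr ?powR_ge0.
move=> m m0; have m1 : 1 <= m%:R :> R by rewrite ler1n.
have mpos : 0 < m%:R :> R by rewrite ltr0n.
have [/hc h|Am] := leqP A m.
  apply: (le_trans h); rewrite lee_fin ler_pM ?powR_ge0 ?(ltW c0)//.
    by rewrite lerDl powR_ge0.
  by rewrite ler_powR// lerN2.
apply: (@le_trans _ _ 1%E); first by apply: probability_le1; exact: measurable_unit_itv.
rewrite lee_fin powRN ler_pdivlMr ?powR_gt0// mul1r.
apply: (@le_trans _ _ (A%:R `^ (2 + g))); last by rewrite lerDr ltW.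
by rewrite ge0_ler_powR ?nnegrE ?addr_ge0// ler_nat ltnW.
Qed.

Lemma sum_powR32_le (n K : nat) : (1 < n)%N ->
  \sum_(n <= m < K) (m%:R `^ (- (5 / 2)) : R) <= 2 * n%:R `^ (- (3 / 2)).
Proof.
clear tau0.
move=> n1; have n0 : 0 < n%:R :> R by rewrite ltr0n ltnW.
have h m : (n <= m)%N -> m%:R `^ (- (5 / 2)) <=
    n%:R `^ (- (1 / 2)) * (m.-1%:R^-1 - m%:R^-1) :> R.
  move=> nm; have m1 : (1 < m)%N by apply: leq_trans nm.
  have m0 : 0 < m%:R :> R by rewrite ltr0n ltnW.
  have mp : 0 < m.-1%:R :> R by rewrite ltr0n; case: (m) m1 => [|[]].
  rewrite (_ : - (5 / 2) = - (1 / 2) + - 2); last by field.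
  rewrite powRD; last by rewrite (gt_eqF m0) implybT.
  apply: ler_pM; rewrite ?powR_ge0//.
    rewrite !powRN lef_pV2 ?posrE ?powR_gt0//.
    by apply: ge0_ler_powR; rewrite ?nnegrE ?ler_nat//; lra.
  rewrite powR_invn ?(ltW m0)//.
  have -> : m.-1%:R^-1 - m%:R^-1 = (m.-1%:R * m%:R)^-1 :> R.
    have mE : m%:R = m.-1%:R + 1 :> R by rewrite natr1 prednK// ltnW.
    rewrite mE; field; rewrite -mE.
    by rewrite (gt_eqF mp) (gt_eqF m0).
  rewrite lef_pV2 ?posrE ?exprn_gt0 ?mulr_gt0// expr2 ler_pM2r// ler_nat.
  exact: leq_pred.
apply: (@le_trans _ _ (\sum_(n <= m < K) n%:R `^ (- (1 / 2)) * (m.-1%:R^-1 - m%:R^-1))).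
  by apply: ler_sum_nat => m /andP[nm _]; exact: h.
rewrite -mulr_sumr; have n0' : 0 < n.-1%:R :> R by rewrite ltr0n; case: (n) n1 => [|[]].
have tele : \sum_(n <= m < K) (m.-1%:R^-1 - m%:R^-1) <= n.-1%:R^-1 :> R.
  have [nK|Kn] := leqP n K; last by rewrite big_geq ?invr_ge0// ltnW.
  rewrite (telescope_sumr_eq (fun m => - m.-1%:R^-1)) => [|//|m _]; last first.
    by rewrite opprK addrC.
  by rewrite opprK gerDr oppr_le0 invr_ge0.
apply: (@le_trans _ _ (n%:R `^ (- (1 / 2)) * (2 * n%:R^-1))).
  rewrite ler_wpM2l ?powR_ge0//; apply: (le_trans tele).
  rewrite ler_pdivlMr// mulrC ler_pdivrMr// -natrM ler_nat.
  by case: (n) n1 => // n' ?; lia.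
rewrite mulrCA -[n%:R^-1]powR_inv1 ?(ltW n0)// -powRD; last first.
  by rewrite (gt_eqF n0) implybT.
by rewrite (_ : - (1 / 2) + -1 = - (3 / 2))//; field.
Qed.

Lemma power_law_tail (g C : R) (n : nat) : 1 / 2 <= g ->  (1 < n)%N -> 0 < C ->
  (forall m : nat, (0 < m)%N -> (D (unit_itv m) <= (C * m%:R `^ (- (2 + g)))%:E)%E) ->
  (D `[n%:R, +oo[%classic <= (2 * C * n%:R `^ (- (3 / 2)))%:E)%E.
Proof.
clear tau0.
move=> g12 n1 C0 hC.
have -> : `[n%:R : measurableTypeR R, +oo[%classic =
    \bigcup_(m in [set m | (n <= m)%N]) unit_itv m.
  apply/seteqP; split => x.
    rewrite /= in_itv/= andbT => nx.
    have x0 : 0 <= x by apply: le_trans nx.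
    exists (Num.truncn x); last exact/(unit_itvP _ x0).
    by rewrite /= Num.Theory.truncn_ge_nat.
  move=> [m /= nm]; rewrite /unit_itv /= !in_itv/= andbT => /andP[mx _].
  by apply: le_trans mx; rewrite ler_nat.
rewrite measure_bigcup; last 2 first.
- by move=> m _; exact: measurable_unit_itv.
- move=> i j _ _ [x []]; rewrite /unit_itv /= !in_itv/= => /andP[i1 i2] /andP[j1 j2].
  have := le_lt_trans i1 j2; have := le_lt_trans j1 i2.
  by rewrite !ltr_nat => h1 h2; apply/eqP; rewrite eqn_leq -ltnS h2 -ltnS h1.
apply: lime_le; first by apply: is_cvg_nneseries => m _ _; exact: measure_ge0.
apply: nearW => K; apply: (@le_trans _ _ (\sum_(0 <= m < K | (n <= m)%N) (C * m%:R `^ (- (5 / 2)))%:E)%E).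
  rewrite (eq_bigl (fun m => (n <= m)%N)) => [|m]; last first.
    by apply/idP/idP => [/set_mem//|?]; apply/mem_set.
  rewrite big_seq_cond [leRHS]big_seq_cond; apply: lee_sum => m /andP[_ nm].
  have m0 : (0 < m)%N by apply: leq_trans nm; exact: ltnW.
  apply: (le_trans (hC m m0)); rewrite lee_fin ler_pM2l//.
  by rewrite ler_powR ?ler1n//; lra.
rewrite sumEFin lee_fin -mulr_sumr [2 * C]mulrC -mulrA ler_pM2l//.
apply: le_trans (sum_powR32_le K n1).
by rewrite [leRHS](big_nat_widenl n 0)//.
Qed.

End power_law_tails.

(** * Measurability in the random graph *)

Section sigma_joins.
Context {disp : measure_display} {Omega : measurableType disp}.

Context {I : Type} {d' : measure_display} {T : measurableType d'}.
Variables (F : set (set Omega)) (Z : I -> Omega -> T).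

Lemma sigma_algebra_join : sigma_algebra setT (sigma_join F Z).
Proof. exact: smallest_sigma_algebra. Qed.

Lemma sub_sigma_join : F `<=` sigma_join F Z.
Proof. by move=> A FA; apply: sub_sigma_algebra; left. Qed.

Lemma sigma_join_preimage i A : measurable A -> sigma_join F Z (Z i @^-1` A).
Proof.
move=> mA; apply: sub_sigma_algebra; right; exists i => //.
by exists A => //; rewrite setTI.
Qed.

Lemma sigma_join_measurable : F `<=` measurable ->
  (forall i, measurable_fun setT (Z i)) -> sigma_join F Z `<=` measurable.
Proof.
move=> FM mZ; apply: smallest_sub; first exact: sigma_algebra_measurable.
move=> A [/FM//|[i _ [B mB <-]]]; exact: mZ.
Qed.

End sigma_joins.

Lemma measurable_truncn {R : realType} (A : set nat) :
  measurable ((fun x : measurableTypeR R => Num.truncn x) @^-1` A).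
Proof.
have -> : (fun x : measurableTypeR R => Num.truncn x) @^-1` A =
    \bigcup_(m in A) (fun x : measurableTypeR R => Num.truncn x) @^-1` [set m].
  by apply/seteqP; split => [x Ax|x [m Am xm]]; [exists (Num.truncn x)|rewrite /preimage /= xm].
apply: bigcup_measurable => m _.
have mle k : measurable [set x : measurableTypeR R | (Num.truncn x <= k)%N].
  rewrite (_ : mkset _ = `]-oo, k.+1%:R[%classic); first exact: measurable_itv.
  by apply/seteqP; split => x /=; rewrite in_itv/= Num.Theory.truncn_le_nat.
case: m => [|m].
  rewrite (_ : _ @^-1` _ = [set x : measurableTypeR R | (Num.truncn x <= 0)%N])//.
  by apply/seteqP; split => x /=; rewrite leqn0 => /eqP.
rewrite (_ : _ @^-1` _ = [set x : measurableTypeR R | (Num.truncn x <= m.+1)%N] `\`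
    [set x : measurableTypeR R | (Num.truncn x <= m)%N]); first exact: measurableD.
apply/seteqP; split => x /=.
  by move=> ->; rewrite leqnn ltnn.
by move=> [h1 /negP]; rewrite -ltnNge => h2; apply/eqP; rewrite eqn_leq h1.
Qed.

Lemma dmeas_truncn {R : realType} {Omega : Type} (F : set (set Omega))
    (f : Omega -> measurableTypeR R) :
  (forall A, measurable A -> F (f @^-1` A)) -> dmeas F (fun w => Num.truncn (f w)).
Proof. by move=> hf A; apply: hf (measurable_truncn A). Qed.

Lemma has_filtered (T : Type) (a p : pred T) (s : seq T) :
  has p [seq x <- s | a x] = has (fun x => a x && p x) s.
Proof. by elim: s => //= x s IH; case: (a x) => //=; rewrite IH. Qed.

Section girg_measurability.
Context {R : realType} {disp : measure_display} {Omega : measurableType disp}.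
Variables (d q : nat).
Variables (N : Omega -> nat) (X : nat -> Omega -> torus_point R d).
Variables (W : nat -> Omega -> measurableTypeR R) (E : nat -> nat -> Omega -> bool).
Variables (S : Omega -> nat) (Y : nat -> nat -> Omega -> nat).
Hypotheses (mN : measurable_fun setT N) (mX : forall i, measurable_fun setT (X i)).
Hypotheses (mW : forall i, measurable_fun setT (W i)).
Hypotheses (mE : forall i j, measurable_fun setT (E i j)).
Hypotheses (mS : measurable_fun setT S) (mY : forall r i, measurable_fun setT (Y r i)).

Definition sigma_start := sigma_join (sigma_graph N X W E) (fun _ : unit => S).

Lemma sub_positions_weights : sigma_positions N X `<=` sigma_weights N X W.
Proof. exact: sub_sigma_join. Qed.

Lemma sub_weights_graph : sigma_weights N X W `<=` sigma_graph N X W E.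
Proof. exact: sub_sigma_join. Qed.

Lemma sigma_positions_measurable : sigma_positions N X `<=` measurable.
Proof.
apply: sigma_join_measurable => // A [B mB <-]; exact: mN.
Qed.

Lemma sigma_weights_measurable : sigma_weights N X W `<=` measurable.
Proof. exact: sigma_join_measurable sigma_positions_measurable _. Qed.

Lemma sigma_graph_measurable : sigma_graph N X W E `<=` measurable.
Proof. by apply: sigma_join_measurable sigma_weights_measurable _ => -[]. Qed.

Lemma sigma_start_measurable : sigma_start `<=` measurable.
Proof. exact: sigma_join_measurable sigma_graph_measurable _. Qed.

Lemma dmeas_num : dmeas (sigma_positions N X) N.
Proof.
move=> A; apply: sub_sigma_join; exists A => //.
by rewrite setTI.
Qed.

Lemma dmeas_cell i : dmeas (sigma_positions N X) (fun w => cell q (X i w)).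
Proof.
have dc c : dmeas (sigma_positions N X) (fun w => Num.truncn (q.+1%:R * tnth (X i w) c)).
  apply: dmeas_truncn => A mA.
  have -> : (fun w => q.+1%:R * tnth (X i w) c) @^-1` A =
     X i @^-1` ((fun x : torus_point R d => q.+1%:R * tnth x c) @^-1` A) by [].
  apply: sigma_join_preimage; rewrite -[X in measurable X]setTI.
  have : measurable_fun setT (fun x : torus_point R d => q.+1%:R * tnth x c).
    by apply: measurable_funM => //; exact: measurable_tnth.
  by apply.
pose h (s : seq nat) : {ffun 'I_d -> 'I_q.+1} := [ffun c : 'I_d => inord (nth 0%N s c)].
rewrite (_ : (fun w => _) = fun w => h [seq Num.truncn (q.+1%:R * tnth (X i w) c) | c <- enum 'I_d]).
  apply: (dmeas_comp h); apply: dmeas_map => //; exact: sigma_algebra_join.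
apply/funext => w; apply/ffunP => c; rewrite !ffunE; congr inord.
by rewrite (nth_map c) ?size_enum_ord// nth_ord_enum.
Qed.

Definition cell_seq w : seq {ffun 'I_d -> 'I_q.+1} :=
  [seq cell q (X i w) | i <- iota 0 (N w)].

Lemma dmeas_cell_seq : dmeas (sigma_positions N X) cell_seq.
Proof.
apply: (@dmeas_dep _ _ _ _ _ N (fun n w => [seq cell q (X i w) | i <- iota 0 n])).
- exact: sigma_algebra_join.
- exact: dmeas_num.
by move=> n; apply: dmeas_map => [|i]; [exact: sigma_algebra_join|exact: dmeas_cell].
Qed.

Definition weight_class i w := Num.truncn (W i w).

Lemma dmeas_weight_class i : dmeas (sigma_weights N X W) (weight_class i).
Proof. by apply: dmeas_truncn => A mA; exact: sigma_join_preimage. Qed.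

Lemma dmeas_edge i j : dmeas (sigma_graph N X W E) (E i j).
Proof.
move=> A; exact: (@sigma_join_preimage _ _ _ _ _ _ (fun ij : nat * nat => E ij.1 ij.2) (i, j)).
Qed.

Definition degree u w := size (neighbours (N w) (fun i j => E i j w) u).

Lemma dmeas_degree u : dmeas (sigma_graph N X W E) (degree u).
Proof.
apply: (@dmeas_dep _ _ _ _ _ N (fun n w => size (neighbours n (fun i j => E i j w) u))).
- exact: sigma_algebra_join.
- exact: dmeas_sub sub_weights_graph (dmeas_sub sub_positions_weights dmeas_num).
move=> n.
rewrite (_ : (fun w => _) = fun w => count id [seq E u j w | j <- iota 0 n]).
  apply: (dmeas_comp (count id)); apply: dmeas_map => [|i]; first exact: sigma_algebra_join.
  exact: dmeas_edge.
by apply/funext => w; rewrite /neighbours size_filter count_map.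
Qed.

Lemma dmeas_start : dmeas sigma_start S.
Proof. by move=> A; exact: (@sigma_join_preimage _ _ _ _ _ _ (fun _ : unit => S) tt). Qed.

Let mea {T : Type} (F : set (set Omega)) (f : Omega -> T) :
  F `<=` measurable -> dmeas F f -> dmeas (@measurable disp Omega) f.
Proof. exact: dmeas_sub. Qed.

Lemma dmeas_choice r i : dmeas (@measurable disp Omega) (Y r i).
Proof. by move=> A; rewrite -[X in measurable X]setTI; apply: mY. Qed.

Lemma dmeas_num_informed k : dmeas (@measurable disp Omega) (fun w =>
  num_informed (N w) (fun i j => E i j w) (S w) (fun r i => Y r i w) k).
Proof.
have sM := @sigma_algebra_measurable disp Omega.
apply: (@dmeas_dep _ _ sM _ _ N (fun n w =>
  num_informed n (fun i j => E i j w) (S w) (fun r i => Y r i w) k)).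
  exact: mea sigma_positions_measurable dmeas_num.
move=> n; apply: (@dmeas_dep _ _ sM _ _ S (fun s w =>
  num_informed n (fun i j => E i j w) s (fun r i => Y r i w) k)).
  exact: mea sigma_start_measurable dmeas_start.
move=> s.
have dI t : forall i, dmeas (@measurable disp Omega) (fun w =>
    informed n (fun i j => E i j w) s (fun r i => Y r i w) t i).
  elim: t => [|r IH] i /=; first exact: dmeas_cst.
  apply: (dmeas2 sM orb) => //.
  rewrite (_ : (fun w => _) = fun w => has id [seq E i j w &&
     (informed n (fun i j => E i j w) s (fun r i => Y r i w) r j &&
        ((Y r i w == j) || (Y r j w == i))) | j <- iota 0 n]).
    apply: (dmeas_comp (has id)); apply: dmeas_map => // j.
    apply: (dmeas2 sM andb); first exact: mea sigma_graph_measurable (dmeas_edge _ _).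
    apply: (dmeas2 sM andb) => //; apply: (dmeas2 sM orb).
      exact: dmeas_comp (fun y => y == j) _ (dmeas_choice _ _).
    exact: dmeas_comp (fun y => y == i) _ (dmeas_choice _ _).
  by apply/funext => w; rewrite /neighbours has_filtered has_map.
rewrite (_ : (fun w => _) = fun w => count id [seq
    informed n (fun i j => E i j w) s (fun r i => Y r i w) k i | i <- iota 0 n]).
  by apply: (dmeas_comp (count id)); apply: dmeas_map.
by apply/funext => w; rewrite /num_informed count_map.
Qed.

End girg_measurability.

(** * Skeletons in a fixed configuration *)

Lemma bernoulli_true {R : realType} (p : R) : 0 <= p <= 1 ->
  bernoulli_prob p [set true] = p%:E.
Proof. by move=> p01; rewrite /bernoulli_prob p01 fsbig_set1. Qed.

Lemma bernoulli_false {R : realType} (p : R) : 0 <= p <= 1 ->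
  bernoulli_prob p [set false] = (1 - p)%:E.
Proof. by move=> p01; rewrite /bernoulli_prob p01 fsbig_set1. Qed.

Lemma uniform_on_le {R : realType} (T : eqType) (s : seq T) (x : T) (A : set T) :
  uniq s -> A `<=` [set x] -> (0 <= (uniform_on s A : \bar R) <= ((size s)%:R^-1)%:E)%E.
Proof.
move=> us Ax; rewrite /uniform_on !lee_fin divr_ge0//= -[leRHS]mul1r.
rewrite ler_wpM2r ?invr_ge0// -[1]/1%:R ler_nat.
apply: (@leq_trans (count_mem x s)); last by rewrite count_uniq_mem// leq_b1.
by apply: sub_count => y /= /set_mem/Ax ->.
Qed.

Section skeleton_event.
Context {R : realType} {disp : measure_display} {Omega : measurableType disp}.
Context {d q n : nat} {alpha theta1 theta2 : R}.
Context {D : probability (measurableTypeR R) R} {P : probability Omega R}.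
Context {N : Omega -> nat} {X : nat -> Omega -> torus_point R d}.
Context {W : nat -> Omega -> measurableTypeR R}.
Context {p : nat -> nat -> Omega -> measurableTypeR R}.
Context {E : nat -> nat -> Omega -> bool} {S : Omega -> nat}.
Context {Y : nat -> nat -> Omega -> nat}.
Hypothesis hG : girg alpha theta1 theta2 D n P N X W p E.
Hypothesis hP : push_pull P N X W E S Y.
Hypotheses (theta1_ge0 : 0 <= theta1) (theta2_le1 : theta2 <= 1).
Variables (g C M2 : R).
Hypotheses (g2 : 1 / 2 <= g) (g1 : g <= 1) (galpha : g^-1 <= alpha).
Hypothesis hC : forall m : nat, (0 < m)%N ->
  (D (unit_itv m) <= (C * m%:R `^ (- (2 + g)))%:E)%E.
Hypothesis lam2 : 2 ^+ d <= n%:R / q.+1%:R ^+ d :> R.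

Variable kappa : seq {ffun 'I_d -> 'I_q.+1}.
Let N0 := size kappa.
Definition cell_at i := nth [ffun _ => ord0] kappa i.
Definition config_event := cell_seq q N X @^-1` [set kappa].

Let mN : measurable_fun setT N. Proof. by case: (girg_positions hG). Qed.
Let mX i : measurable_fun setT (X i). Proof. by case: (girg_positions hG). Qed.
Let mW i : measurable_fun setT (W i). Proof. exact: girg_weight_measurable hG i. Qed.
Let mE i j : measurable_fun setT (E i j). Proof. exact: girg_edge_measurable hG i j. Qed.
Let mS : measurable_fun setT S. Proof. exact: start_measurable hP. Qed.
Let mY r i : measurable_fun setT (Y r i). Proof. exact: choice_measurable hP r i. Qed.

Lemma config_num w : config_event w -> N w = N0.
Proof.
by rewrite /config_event /N0 => /= <-; rewrite /cell_seq size_map size_iota.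
Qed.

Lemma config_cell w i : config_event w -> (i < N0)%N ->
  torus (X i w) /\ cell q (X i w) = cell_at i.
Proof.
move=> Bw iN; have NE := config_num Bw; split.
  have [_ _ h _ _] := girg_positions hG; apply: h; by rewrite NE.
rewrite /cell_at -Bw /cell_seq (nth_map 0%N) ?size_iota ?NE//.
by rewrite nth_iota ?NE.
Qed.

Lemma config_positions : sigma_positions N X config_event.
Proof. exact: dmeas_cell_seq. Qed.

Lemma measurable_config : measurable config_event.
Proof. exact: (sigma_positions_measurable mN mX) config_positions. Qed.

Variable cl : nat -> nat.

(* The factors [4] and [2 ^+ d] absorb the rounding of weights and positions. *)
Definition kernel_bound u v : R :=
  Num.min 1 ((4 * 2 ^+ d * ((cl u)%:R * (cl v)%:R) /
              grid_vol (cell_at u) (cell_at v)) `^ g^-1).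

Lemma kernel_boundC u v : kernel_bound u v = kernel_bound v u.
Proof. by rewrite /kernel_bound mulrC [(cl u)%:R * _]mulrC grid_volC mulrC. Qed.

Definition weights_event (us : seq nat) :=
  config_event `&` [set w | forall u, u \in us -> weight_class W u w = cl u].

Lemma weights_event_weights us : sigma_weights N X W (weights_event us).
Proof.
have sF := sigma_algebra_join (sigma_positions N X) W.
apply: (sigma_algebra_setI sF) => //.
  exact: sub_sigma_join config_positions.
elim: us => [|u us IH].
  by rewrite (_ : mkset _ = setT); [exact: (sigma_algebra_setT sF)|apply/seteqP; split].
rewrite (_ : mkset _ = (weight_class W u @^-1` [set cl u]) `&`
   [set w | forall v, v \in us -> weight_class W v w = cl v]).
  by apply: (sigma_algebra_setI sF) => //; exact: dmeas_weight_class.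
apply/seteqP; split => w /= => [h|[h1 h2] v].
  by split=> [|v vus]; apply: h; rewrite inE ?eqxx ?vus ?orbT.
by rewrite inE => /orP[/eqP ->|/h2].
Qed.

Lemma weights_event_le us : uniq us -> (forall u, u \in us -> (0 < cl u)%N) ->
  (P (weights_event us) <=
   (\prod_(u <- us) (C * (cl u)%:R `^ (- (2 + g))))%:E * P config_event)%E.
Proof.
move=> uus cl0; set A := fun u => (fun x : measurableTypeR R => Num.truncn x) @^-1` [set cl u].
have -> : weights_event us = config_event `&` [set w | forall u, u \in us -> A u (W u w)] by [].
apply: (cond_indep_law_le (girg_weights hG)) => //.
- by move=> u; exact: measurable_truncn.
- exact: config_positions.
- exact: measurable_config.
move=> u w /cl0 c0 _; rewrite measure_ge0/=; apply: le_trans (hC c0).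
apply: le_measure; rewrite ?inE; [exact: measurable_truncn|exact: measurable_unit_itv|].
move=> x; rewrite /A /= => xc; apply/unit_itvP => //.
by apply: (@le_trans _ _ 1) => //; rewrite -Num.Theory.truncn_gt0 xc.
Qed.

Definition edges_event us (es : seq (nat * nat)) :=
  weights_event us `&` [set w | forall e, e \in es -> E e.1 e.2 w].

Lemma edges_event_graph us es : sigma_graph N X W E (edges_event us es).
Proof.
have sF := sigma_algebra_join (sigma_weights N X W) (fun ij : nat * nat => E ij.1 ij.2).
apply: (sigma_algebra_setI sF) => //.
  exact: sub_sigma_join (weights_event_weights us).
elim: es => [|e es IH].
  by rewrite (_ : mkset _ = setT); [exact: (sigma_algebra_setT sF)|apply/seteqP; split].
rewrite (_ : mkset _ = [set w | E e.1 e.2 w] `&` [set w | forall e, e \in es -> E e.1 e.2 w]).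
  by apply: (sigma_algebra_setI sF) => //; apply: dmeas_bool; exact: dmeas_edge.
apply/seteqP; split => w /= => [h|[h1 h2] f].
  by split=> [|f fes]; apply: h; rewrite inE ?eqxx ?fes ?orbT.
by rewrite inE => /orP[/eqP ->|/h2].
Qed.

Lemma edges_event_le us es : uniq es -> (forall u, u \in us -> (0 < cl u)%N) ->
  (forall e, e \in es -> [/\ (e.1 < e.2 < N0)%N, e.1 \in us & e.2 \in us]) ->
  (P (edges_event us es) <=
   (\prod_(e <- es) kernel_bound e.1 e.2)%:E * P (weights_event us))%E.
Proof.
move=> ues cl0 hes.
apply: (cond_indep_law_le (A := fun _ => [set true]) (girg_edges hG)) => //.
- exact: weights_event_weights.
- exact: (sigma_weights_measurable mN mX mW) (weights_event_weights us).
- by move=> e /hes[/andP[e12 e2N] _ _] w [/config_num NE _] /=; rewrite e12 NE.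
move=> e w /hes[/andP[e12 e2N] e1us e2us] [Bw cw].
have NE := config_num Bw; have e1N := ltn_trans e12 e2N.
have /= := girg_prob_bounds hG (w := w) (i := e.1) (j := e.2).
rewrite NE e12 e2N => /(_ isT); set m := girg_kernel _ _ _ _ _ _ => /andP[pl pu].
have [t1 c1] := config_cell Bw e1N; have [t2 c2] := config_cell Bw e2N.
have cW u : u \in us -> (cl u)%:R <= W u w < (cl u)%:R + 1 /\ 1 <= (cl u)%:R :> R.
  move=> uus; have cu := cw u uus; have c0 := cl0 u uus; split; last by rewrite ler1n.
  rewrite natr1 -cu; apply: Num.Theory.truncn_itv.
  by apply: (@le_trans _ _ 1) => //; rewrite -Num.Theory.truncn_gt0 -/(weight_class W u w) cu.
have [/andP[w1 w1'] k1] := cW _ e1us; have [/andP[w2 w2'] k2] := cW _ e2us.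
have gV : 1 <= g^-1.
  by rewrite invf_ge1//; apply: lt_le_trans g2; lra.
have mk : m <= kernel_bound e.1 e.2.
  rewrite /m /kernel_bound -c1 -c2; apply: girg_kernel_le => //; first 1 last.
  - lra.
  - lra.
  - lra.
  - lra.
  - by rewrite gV.
have m0 : 0 <= m.
  by rewrite /m /girg_kernel; case: ifP => // _; rewrite le_min powR_ge0 ler01.
have k01 : kernel_bound e.1 e.2 <= 1 by rewrite /kernel_bound ge_min lexx.
have p0 : 0 <= p e.1 e.2 w by apply: le_trans pl; rewrite mulr_ge0.
have pk : p e.1 e.2 w <= kernel_bound e.1 e.2.
  by apply: (le_trans pu); apply: le_trans mk; rewrite ler_piMl.
by rewrite bernoulli_true ?lee_fin ?p0// (le_trans pk).
Qed.

Definition degrees_event us es (ps : seq nat) := edges_event us es `&`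
  [set w | forall u, u \in ps -> (cl u)%:R <= M2 * (degree N E u w)%:R].

Definition start_event us es (s : nat) ps :=
  degrees_event us es ps `&` S @^-1` [set s].

Lemma degrees_event_graph us es ps : sigma_graph N X W E (degrees_event us es ps).
Proof.
have sF := sigma_algebra_join (sigma_weights N X W) (fun ij : nat * nat => E ij.1 ij.2).
apply: (sigma_algebra_setI sF) => //; first exact: edges_event_graph.
elim: ps => [|u ps IH].
  by rewrite (_ : mkset _ = setT); [exact: (sigma_algebra_setT sF)|apply/seteqP; split].
rewrite (_ : mkset _ = [set w | (cl u)%:R <= M2 * (degree N E u w)%:R] `&`
   [set w | forall v, v \in ps -> (cl v)%:R <= M2 * (degree N E v w)%:R]).
  apply: (sigma_algebra_setI sF) => //.
  apply: (dmeas_bool (b := fun w => (cl u)%:R <= M2 * (degree N E u w)%:R)).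
  have dd : dmeas (sigma_graph N X W E) (degree N E u) by exact: dmeas_degree.
  exact: (dmeas_comp (fun k : nat => (cl u)%:R <= M2 * k%:R) dd).
apply/seteqP; split => w /= => [h|[h1 h2] v].
  by split=> [|v vus]; apply: h; rewrite inE ?eqxx ?vus ?orbT.
by rewrite inE => /orP[/eqP ->|/h2].
Qed.

Lemma start_event_start us es s ps : sigma_start N X W E S (start_event us es s ps).
Proof.
have sF := sigma_algebra_join (sigma_graph N X W E) (fun _ : unit => S).
apply: (sigma_algebra_setI sF) => //.
  by apply: sub_sigma_join; exact: degrees_event_graph.
exact: dmeas_start.
Qed.

Lemma start_event_le us es s ps : (0 < N0)%N ->
  (P (start_event us es s ps) <= (N0%:R^-1)%:E * P (edges_event us es))%E.
Proof.
move=> N00; have sG := degrees_event_graph us es ps.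
apply: (@le_trans _ _ ((N0%:R^-1 : R)%:E * P (degrees_event us es ps))%E); last first.
  apply: lee_wpmul2l; first by rewrite lee_fin invr_ge0.
  apply: le_measure; rewrite ?inE; last by apply: subIsetl.
    exact: (sigma_graph_measurable mN mX mW mE) sG.
  exact: (sigma_graph_measurable mN mX mW mE) (edges_event_graph us es).
have := @cond_indep_law_le _ _ _ P (sigma_graph N X W E) _ _ _ _ _ _ [:: tt]
  (fun _ => [set s]) _ (fun _ => N0%:R^-1) (start_uniform hP) isT _ sG.
rewrite big_seq1 => h.
have -> : start_event us es s ps = degrees_event us es ps `&`
    [set w | forall i : unit, i \in [:: tt] -> [set s] (S w)].
  by congr (_ `&` _); apply/seteqP; split => w /=; [move=> ->|apply; exact: mem_head].
apply: h => //.
- exact: (sigma_graph_measurable mN mX mW mE) sG.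
- by move=> i _ w [[[/config_num /= -> _] _] _].
- move=> i w _ [[[/config_num -> _] _] _].
  by have := @uniform_on_le R _ (iota 0 N0) s [set s] (iota_uniq _ _) (@subset_refl _ _); rewrite size_iota.
Qed.

(* [((r, u), v)] in [ch] stands for: [u] contacts [v] in round [r]. *)
Definition choices_event us es s ps (ch : seq ((nat * nat) * nat)) :=
  start_event us es s ps `&`
  [set w | forall c, c \in ch -> Y c.1.1 c.1.2 w = c.2].

Lemma choices_event_le us es s ps ch : 0 < M2 -> uniq (map fst ch) ->
  (forall c, c \in ch -> [/\ c.1.2 \in ps, (c.1.2 < N0)%N, (c.2 < N0)%N, (0 < cl c.1.2)%N &
     (minn c.1.2 c.2, maxn c.1.2 c.2) \in es]) ->
  (P (choices_event us es s ps ch) <=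
   (\prod_(c <- ch) (M2 / (cl c.1.2)%:R))%:E * P (start_event us es s ps))%E.
Proof.
move=> M20 uch hch.
pose A (ri : nat * nat) : set nat := [set v | forall c, c \in ch -> c.1 = ri -> v = c.2].
have := @cond_indep_law_le _ _ _ P (sigma_start N X W E S) _ _ _ _ _ _ (map fst ch)
  A (start_event us es s ps) (fun ri => M2 / (cl ri.2)%:R) (choice_uniform hP) uch.
rewrite big_map => h.
have -> : choices_event us es s ps ch = start_event us es s ps `&`
    [set w | forall i, i \in map fst ch -> A i (Y i.1 i.2 w)].
  congr (_ `&` _); apply/seteqP; split => w /= => [hw _ /mapP[c cch ->] c' c'ch <-|hw c cch].
    by rewrite hw.
  by apply: (hw c.1) => //; apply: map_f.
have nb c w : c \in ch -> start_event us es s ps w ->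
    c.2 \in neighbours (N w) (fun i j => E i j w) c.1.2.
  move=> cch [[[[Bw _] ew] _] _]; have [_ _ c2 _ ces] := hch c cch.
  rewrite mem_filter mem_iota (config_num Bw) c2 andbT /=.
  have := ew _ ces => /=.
  have [Esym _] := girg_simple hG w.
  by rewrite leq0n andbT /minn /maxn; case: ifP => // _; rewrite (Esym c.2).
apply: h => //.
- exact: start_event_start.
- exact: (sigma_start_measurable mN mX mW mE mS) (start_event_start _ _ _ _).
- move=> _ /mapP[c cch ->] w sw; have [_ c1 _ _ _] := hch c cch; split => /=.
    by case: sw => [[[[/config_num -> _] _] _] _].
  by have := nb c w cch sw; case: neighbours.
move=> _ w /mapP[c cch ->] sw.
have Ac : A c.1 `<=` [set c.2] by move=> v; apply.
have us' : uniq (neighbours (N w) (fun i j => E i j w) c.1.2).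
  by rewrite filter_uniq// iota_uniq.
have /andP[h1 h2] := @uniform_on_le R _ _ c.2 (A c.1) us' Ac.
rewrite h1/=; apply: (le_trans h2); rewrite lee_fin.
have [cps _ _ c0 _] := hch c cch.
have := sw => -[[_ /(_ _ cps)] + _]; rewrite -/(degree N E c.1.2 w) => hd.
have cl0 : 0 < (cl c.1.2)%:R :> R by rewrite ltr0n.
have deg0 : 0 < (degree N E c.1.2 w)%:R :> R.
  by rewrite -(pmulr_rgt0 _ M20); apply: lt_le_trans hd.
by rewrite ler_pdivlMr// mulrC ler_pdivrMr.
Qed.

End skeleton_event.

Lemma step_usage_le {R : realType} (g A a b L : R) :
  1 / 2 <= g -> g <= 1 -> 1 <= A -> 1 <= a -> 1 <= b -> 1 <= L ->
  Num.min 1 ((A * (a * b) / L) `^ g^-1) / Num.min a b <=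
  A `^ g^-1 * (if L <= Num.max a b * Num.min a b `^ g then 1
               else (Num.max a b * Num.min a b `^ g / L) `^ g^-1).
Proof.
move=> g2 g1 A1 a1 b1 L1.
have g0 : 0 < g by apply: lt_le_trans g2; lra.
have gV1 : 1 <= g^-1 by rewrite invf_ge1.
have gV2 : g^-1 <= 2.
  by rewrite -[2]invrK lef_pV2 ?posrE ?invr_gt0 //; have := g2; lra.
have -> : a * b = Num.max a b * Num.min a b.
  by have [ab|ab] := leP a b; rewrite // mulrC.
have hi1 : 1 <= Num.max a b by rewrite le_max a1.
have lo1 : 1 <= Num.min a b by rewrite le_min a1.
move: (Num.max a b) (Num.min a b) hi1 lo1 => u v u1 v1.
have u0 : 0 < u by apply: lt_le_trans u1.
have v0 : 0 < v by apply: lt_le_trans v1.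
have L0 : 0 < L by apply: lt_le_trans L1.
have A0 : 0 < A by apply: lt_le_trans A1.
have Ag1 : 1 <= A `^ g^-1 by apply: (le_trans A1); exact: le1r_powR.
case: ifP => _.
  rewrite mulr1; apply: le_trans Ag1.
  rewrite ler_pdivrMr// mul1r; apply: le_trans v1.
  by rewrite ge_min lexx.
have gK : (v `^ g) `^ g^-1 = v by rewrite -powRrM mulfV ?gt_eqF// powRr1// ltW.
have -> : (u * v `^ g / L) `^ g^-1 = u `^ g^-1 * v / L `^ g^-1.
  rewrite powRM ?invr_ge0 ?mulr_ge0 ?powR_ge0 ?(ltW u0) ?(ltW L0)//.
  by rewrite powRM ?powR_ge0 ?(ltW u0)// gK powR_invr ?(ltW L0).
apply: (@le_trans _ _ ((A * (u * v) / L) `^ g^-1 / v)).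
  by rewrite ler_wpM2r ?invr_ge0 ?(ltW v0)// ge_min lexx orbT.
have -> : (A * (u * v) / L) `^ g^-1 = A `^ g^-1 * (u `^ g^-1 * v `^ g^-1) / L `^ g^-1.
  rewrite powRM ?invr_ge0 ?mulr_ge0 ?(ltW A0) ?(ltW u0) ?(ltW v0) ?(ltW L0)//.
  rewrite powRM ?mulr_ge0 ?(ltW A0) ?(ltW u0) ?(ltW v0)//.
  by rewrite powRM ?(ltW u0) ?(ltW v0)// powR_invr ?(ltW L0).
have vv : v `^ g^-1 / v <= v.
  rewrite ler_pdivrMr// -expr2 -powR_mulrn ?(ltW v0)//; exact: ler_powR.
set B := L `^ g^-1.
rewrite [leLHS](_ : _ = A `^ g^-1 * u `^ g^-1 / B * (v `^ g^-1 / v)); last by ring.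
rewrite [leRHS](_ : _ = A `^ g^-1 * u `^ g^-1 / B * v); last by ring.
by rewrite ler_wpM2l// !mulr_ge0 ?invr_ge0 ?powR_ge0.
Qed.

Section skeleton_lists.

Lemma min_max_eq (u v x y : nat) : minn u v = minn x y -> maxn u v = maxn x y ->
  u = x \/ u = y.
Proof. lia. Qed.

Definition steps (u : nat) (us : seq nat) (rts : seq (nat * nat)) :=
  zip (zip (u :: us) us) rts.

Definition used_steps u us rts := [seq st <- steps u us rts | st.2.2 != 0%N].

Definition step_edge (st : (nat * nat) * (nat * nat)) :=
  (minn st.1.1 st.1.2, maxn st.1.1 st.1.2).

Definition step_choice (st : (nat * nat) * (nat * nat)) :=
  if st.2.2 == 1%N then ((st.2.1, st.1.1), st.1.2) else ((st.2.1, st.1.2), st.1.1).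

Lemma steps_cons u v us r rts :
  steps u (v :: us) (r :: rts) = ((u, v), r) :: steps v us rts.
Proof. by []. Qed.

Lemma steps_mem u us rts st : st \in steps u us rts ->
  [/\ st.1.1 \in u :: us, st.1.2 \in us & st.2 \in rts].
Proof.
elim: us u rts => [|v us IH] u [|r rts]; rewrite ?steps_cons //.
rewrite inE => /orP[/eqP -> /=|/IH[h1 h2 h3]].
  by rewrite !inE !eqxx ?orbT.
by rewrite inE h1 orbT inE h2 orbT inE h3 orbT.
Qed.

Lemma steps_edges_uniq u us rts : uniq (u :: us) ->
  uniq (map step_edge (steps u us rts)).
Proof.
elim: us u rts => [|v us IH] u [|r rts] //.
rewrite steps_cons cons_uniq => /andP[uNvus vus].
rewrite map_cons cons_uniq IH// andbT; apply/negP => /mapP[st /steps_mem[h1 h2 _]].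
rewrite /step_edge /= => -[e1 e2].
have h2' : st.1.2 \in v :: us by rewrite inE h2 orbT.
have uE := min_max_eq e1 e2.
by case: uE => uE; move: uNvus; rewrite uE ?h1 ?h2'.
Qed.

Lemma steps_rounds u us rts : {subset map (fun st => st.2.1) (steps u us rts) <= map fst rts} /\
  (uniq (map fst rts) -> uniq (map (fun st => st.2.1) (steps u us rts))).
Proof.
elim: us u rts => [|v us IH] u [|r rts]; rewrite ?steps_cons //.
have [h1 h2] := IH v rts; split.
  move=> x; rewrite map_cons inE => /orP[/eqP ->|/h1 h]; first by rewrite inE eqxx.
  by rewrite inE h orbT.
rewrite !map_cons !cons_uniq => /andP[rN /h2 ->]; rewrite andbT.
by apply: contra rN => /h1.
Qed.

End skeleton_lists.

Section skeleton_sum.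
Context {R : realType} {disp : measure_display} {Omega : measurableType disp}.
Context {d q n : nat} {alpha theta1 theta2 : R}.
Context {D : probability (measurableTypeR R) R} {P : probability Omega R}.
Context {N : Omega -> nat} {X : nat -> Omega -> torus_point R d}.
Context {W : nat -> Omega -> measurableTypeR R}.
Context {p : nat -> nat -> Omega -> measurableTypeR R}.
Context {E : nat -> nat -> Omega -> bool} {S : Omega -> nat}.
Context {Y : nat -> nat -> Omega -> nat}.
Hypothesis hG : girg alpha theta1 theta2 D n P N X W p E.
Hypothesis hP : push_pull P N X W E S Y.
Hypotheses (theta1_ge0 : 0 <= theta1) (theta2_le1 : theta2 <= 1).
Variables (g C M2 : R).
Hypotheses (g2 : 1 / 2 <= g) (g1 : g <= 1) (galpha : g^-1 <= alpha).
Hypothesis hC : forall m : nat, (0 < m)%N ->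
  (D (unit_itv m) <= (C * m%:R `^ (- (2 + g)))%:E)%E.
Hypothesis lam2 : 2 ^+ d <= n%:R / q.+1%:R ^+ d :> R.

Variable kappa : seq {ffun 'I_d -> 'I_q.+1}.
Let N0 := size kappa.

Hypothesis M21 : 1 <= M2.
Hypothesis C0 : 0 < C.
Local Notation Bk := (config_event (N := N) (X := X) kappa).
Local Notation cell_at := (cell_at kappa).

Definition usage_const : R := M2 * (4 * 2 ^+ d) `^ g^-1.

Definition label_vol (i j : nat) : R := grid_vol (cell_at i) (cell_at j).

Definition class_weight (cl : nat -> nat) (i : nat) : R := (cl i)%:R.

Let A1' : 1 <= 4 * 2 ^+ d :> R.
Proof. by rewrite -[leLHS]mul1r ler_pM ?exprn_ege1 ?ler1n. Qed.

Lemma usage_const_ge1 : 1 <= usage_const.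
Proof.
rewrite -[leLHS]mul1r ler_pM//; apply: (le_trans A1'); apply: le1r_powR => //.
by rewrite invf_ge1//; apply: lt_le_trans g2; lra.
Qed.

Lemma used_step_le (cl : nat -> nat) u v x : (0 < cl u)%N -> (0 < cl v)%N ->
  (x = u \/ x = v) ->
  kernel_bound g kappa cl u v * (M2 / (cl x)%:R) <=
  usage_const * conn g (class_weight cl) label_vol u v.
Proof.
move=> cu cv xuv; rewrite /usage_const -mulrA mulrCA ler_wpM2l ?(le_trans ler01)//.
have := @step_usage_le R g (4 * 2 ^+ d) (cl u)%:R (cl v)%:R (label_vol u v) g2 g1 A1'.
rewrite !ler1n => /(_ cu cv (grid_vol_ge1 _ _)) h; apply: le_trans h.
rewrite ler_wpM2l//; first by rewrite /kernel_bound le_min powR_ge0 ler01.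
rewrite lef_pV2 ?posrE ?lt_min ?ltr0n ?cu ?cv//.
  by case: xuv => ->; rewrite ge_min lexx ?orbT.
by case: xuv => ->.
Qed.

Lemma skeleton_prob_le (cl : nat -> nat) u us rts :
  let nc := used_steps u us rts in
  let ch := map step_choice nc in
  uniq (u :: us) ->
  (forall v, v \in u :: us -> (v < N0)%N /\ (0 < cl v)%N) ->
  uniq (map fst rts) ->
  (forall st, st \in steps u us rts -> st.2.2 = 0%N ->
     captured g (class_weight cl) label_vol st.1.1 st.1.2) ->
  (P (choices_event (N := N) (X := X) (W := W) (E := E) (S := S) (Y := Y)
       M2 kappa cl (u :: us) (map step_edge nc) u (map (fun c => c.1.2) ch) ch) <=
   (N0%:R^-1 * (\prod_(v <- u :: us) (C * (cl v)%:R `^ (- (2 + g)))) *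
    \prod_(st <- steps u us rts) (usage_const *
       conn g (class_weight cl) label_vol st.1.1 st.1.2))%:E * P Bk)%E.
Proof.
move=> nc ch uus hus urts hcap.
have M20 : 0 < M2 by apply: lt_le_trans M21.
have N00 : (0 < N0)%N.
  by have [h _] := hus u (mem_head _ _); exact: leq_ltn_trans h.
have ncP st : st \in nc -> [/\ st \in steps u us rts, st.1.1 \in u :: us, st.1.2 \in u :: us & st.2.2 != 0%N].
  rewrite mem_filter => /andP[-> sst]; have [h1 h2 _] := steps_mem sst.
    by split=> //; rewrite inE h2 orbT.
have ch_uniq : uniq (map fst ch).
  rewrite -map_comp; have ur : uniq (map (fun st => st.2.1) nc).
    apply: (subseq_uniq (map_subseq _ (filter_subseq _ _))).
    exact: (steps_rounds u us rts).2.
  have : map (fun st => st.2.1) nc = map fst (map (fst \o step_choice) nc).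
    by rewrite -map_comp; apply: eq_map => st /=; rewrite /step_choice; case: ifP.
  by move=> e; move: ur; rewrite e => /map_uniq.
apply: (le_trans (choices_event_le hG hP _ _ _ ch_uniq _)) => //.
  move=> c cch; split; first exact: (map_f (fun c => c.1.2)).
  - case/mapP: cch => st /ncP[_ /hus[h1 _] /hus[h2 _] _] ->.
    by rewrite /step_choice; case: ifP.
  - case/mapP: cch => st /ncP[_ /hus[h1 _] /hus[h2 _] _] ->.
    by rewrite /step_choice; case: ifP.
  - case/mapP: cch => st /ncP[_ /hus[_ h1] /hus[_ h2] _] ->.
    by rewrite /step_choice; case: ifP.
  case/mapP: cch => st snc ->; rewrite (_ : (_, _) = step_edge st); first exact: map_f.
  by rewrite /step_choice /step_edge; case: ifP => //= _; rewrite minnC maxnC.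
have ch0 : 0 <= \prod_(c <- ch) (M2 / (cl c.1.2)%:R).
  by apply: prodr_ge0 => c _; rewrite divr_ge0// ltW.
apply: (le_trans (lee_wpmul2l _ (start_event_le hG hP _ _ _ _ _ _ N00))).
  by rewrite lee_fin.
rewrite muleA -EFinM.
have es_uniq : uniq (map step_edge nc).
  apply: (subseq_uniq (map_subseq _ (filter_subseq _ _))).
  exact: steps_edges_uniq.
have step_neq st : st \in steps u us rts -> st.1.1 != st.1.2.
  clear -uus; elim: us u rts uus => [|v us IH] u [|r rts] //.
  rewrite steps_cons cons_uniq => /andP[uN vus]; rewrite inE => /orP[/eqP -> /=|/IH].
    by apply: contraNneq uN => ->; rewrite mem_head.
  exact.
have a0 : 0 <= (\prod_(c <- ch) (M2 / (cl c.1.2)%:R)) * N0%:R^-1 by rewrite mulr_ge0 ?invr_ge0.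
apply: (le_trans (lee_wpmul2l _ (edges_event_le hG theta1_ge0 theta2_le1 g2 g1 galpha lam2 es_uniq _ _))).
- by rewrite lee_fin.
- by move=> v /hus[].
- move=> e /mapP[st /ncP[sst h1 h2 _] ->]; have := step_neq _ sst.
  have [k1 _] := hus _ h1; have [k2 _] := hus _ h2.
  rewrite /step_edge /= /minn /maxn; case: (ltngtP st.1.1 st.1.2) => // h _.
    by split; rewrite ?h.
  by split; rewrite ?h.
rewrite muleA -EFinM.
have e0 : 0 <= \prod_(e <- map step_edge nc) kernel_bound g kappa cl e.1 e.2.
  by apply: prodr_ge0 => e _; rewrite /kernel_bound le_min powR_ge0 ler01.
apply: (le_trans (lee_wpmul2l _ (weights_event_le hG hC kappa uus _))).
- by rewrite lee_fin mulr_ge0.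
- by move=> v /hus[].
rewrite muleA -EFinM; apply: lee_wpmul2r; first exact: measure_ge0.
rewrite lee_fin; set pm := \prod_(v <- u :: us) _.
have pm0 : 0 <= pm by apply: prodr_ge0 => v _; rewrite mulr_ge0 ?powR_ge0// ltW.
rewrite [leLHS](_ : _ = N0%:R^-1 * pm * ((\prod_(e <- map step_edge nc) kernel_bound g kappa cl e.1 e.2) *
   \prod_(c <- ch) (M2 / (cl c.1.2)%:R))); last by ring.
rewrite ler_wpM2l//; first by rewrite mulr_ge0 ?invr_ge0.
rewrite /ch !big_map -big_split /= /nc /used_steps big_filter big_mkcond /=.
rewrite big_seq [leRHS]big_seq; apply: ler_prod => st sst; case: ifPn => [nz|/negPn/eqP z].
  have [h1 h2 _] := steps_mem sst; have [_ c1] := hus _ h1.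
  have [|_ c2] := hus st.1.2; first by rewrite inE h2 orbT.
  have -> : kernel_bound g kappa cl (step_edge st).1 (step_edge st).2 = kernel_bound g kappa cl st.1.1 st.1.2.
    rewrite /step_edge /= /minn /maxn; case: ifP => // _; exact: kernel_boundC.
  rewrite used_step_le ?andbT//; last first.
    by rewrite /step_choice; case: ifP; [left|right].
  rewrite mulr_ge0 ?divr_ge0 ?(ltW M20)//.
  by rewrite /kernel_bound le_min powR_ge0 ler01.
rewrite ler01 /conn hcap// mulr1 usage_const_ge1.
by [].
Qed.

End skeleton_sum.

Lemma shortcut_free_map (T U : eqType) (f : T -> U) (cap : rel T) (cap' : rel U) (s : seq T) :
  (forall x y, x \in s -> y \in s -> cap x y = cap' (f x) (f y)) ->
  shortcut_free cap s = shortcut_free cap' (map f s).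
Proof.
elim: s => //= x s IH h; rewrite IH => [|a b as_ bs]; last by apply: h; rewrite inE ?as_ ?bs orbT.
congr (_ && _); rewrite behead_map all_map; apply: eq_in_all => y ys /=.
by rewrite (h x y) ?mem_head// inE (mem_behead ys) orbT.
Qed.

Section skeleton_tuples.
Context {R : realType} {disp : measure_display} {Omega : measurableType disp}.
Context {d q n : nat} {alpha theta1 theta2 : R}.
Context {D : probability (measurableTypeR R) R} {P : probability Omega R}.
Context {N : Omega -> nat} {X : nat -> Omega -> torus_point R d}.
Context {W : nat -> Omega -> measurableTypeR R}.
Context {p : nat -> nat -> Omega -> measurableTypeR R}.
Context {E : nat -> nat -> Omega -> bool} {S : Omega -> nat}.
Context {Y : nat -> nat -> Omega -> nat}.
Hypothesis hG : girg alpha theta1 theta2 D n P N X W p E.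
Hypothesis hP : push_pull P N X W E S Y.
Hypotheses (theta1_ge0 : 0 <= theta1) (theta2_le1 : theta2 <= 1).
Variables (g C M2 : R).
Hypotheses (g2 : 1 / 2 <= g) (g1 : g <= 1) (galpha : g^-1 <= alpha).
Hypothesis hC : forall m : nat, (0 < m)%N ->
  (D (unit_itv m) <= (C * m%:R `^ (- (2 + g)))%:E)%E.
Hypothesis lam2 : 2 ^+ d <= n%:R / q.+1%:R ^+ d :> R.

Variable kappa : seq {ffun 'I_d -> 'I_q.+1}.
Let N0 := size kappa.

Hypothesis M21 : 1 <= M2.
Hypothesis C0 : 0 < C.

Local Notation Bk := (config_event (N := N) (X := X) kappa).
Local Notation label_vol := (label_vol kappa).
Local Notation usage_const := (usage_const (d := d) g M2).

Let Z : finType := ('I_N0 * 'I_n)%type.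
Definition vertex_weight (z : Z) : R := z.2.+1%:R.
Definition vertex_mass (z : Z) : R := C * z.2.+1%:R `^ (- (2 + g)).
Definition vertex_vol (z z' : Z) : R := label_vol z.1 z'.1.
Definition vertex_label (z : Z) : nat := z.1.

(* The value is [0] for labels that do not occur in [zs]. *)
Definition lookup_class (zs : seq Z) (u : nat) : nat :=
  nth 0%N [seq z.2.+1 | z : Z <- zs] (index u (map vertex_label zs)).

Lemma lookup_classE zs z : uniq (map vertex_label zs) -> z \in zs ->
  lookup_class zs (vertex_label z) = z.2.+1.
Proof.
move=> us zzs; rewrite /lookup_class.
have zi : (index z zs < size zs)%N by rewrite index_mem.
rewrite -{1}(nth_index z zzs) -(nth_map z 0%N vertex_label)// index_uniq ?size_map//.
by rewrite (nth_map z)// nth_index.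
Qed.

Lemma conn_lookup cl z z' : cl (vertex_label z) = z.2.+1 -> cl (vertex_label z') = z'.2.+1 ->
  captured g (class_weight cl) label_vol (vertex_label z) (vertex_label z') =
    captured g vertex_weight vertex_vol z z' /\
  conn g (class_weight cl) label_vol (vertex_label z) (vertex_label z') =
    conn g vertex_weight vertex_vol z z'.
Proof.
by move=> hz hz'; rewrite /conn /captured /capture_radius /class_weight hz hz'.
Qed.

Lemma prod_steps_conn cl z zs rts : size rts = size zs ->
  (forall y, y \in z :: zs -> cl (vertex_label y) = y.2.+1) ->
  \prod_(st <- steps (vertex_label z) (map vertex_label zs) rts)
    (usage_const * conn g (class_weight cl) label_vol st.1.1 st.1.2) =
  usage_const ^+ size zs * conn_path g vertex_weight vertex_vol z zs.
Proof.
elim: zs z rts => [|y zs IH] z [|r rts] // => [_ _|[srts] hcl].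
  by rewrite big_nil expr0 mul1r.
rewrite map_cons steps_cons big_cons IH//; last first.
  by move=> x xs; apply: hcl; rewrite inE xs orbT.
have [_ ->] := @conn_lookup cl z y (hcl _ (mem_head _ _)) (hcl y (mem_behead (s := z :: y :: zs) (mem_head _ _))).
by rewrite /= exprS; ring.
Qed.

Definition skeleton_ok (zs : seq Z) (rts : seq (nat * nat)) :=
  let us := map vertex_label zs in
  [&& uniq us, shortcut_free (captured g vertex_weight vertex_vol) zs, uniq (map fst rts) &
    all (fun st => (st.2.2 == 0%N) ==> captured g (class_weight (lookup_class zs)) label_vol st.1.1 st.1.2)
      (steps (head 0%N us) (behead us) rts)].

Definition skeleton_event (zs : seq Z) (rts : seq (nat * nat)) : set Omega :=
  let us := map vertex_label zs in
  let nc := used_steps (head 0%N us) (behead us) rts in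
  let ch := map step_choice nc in
  if skeleton_ok zs rts then
    choices_event (N := N) (X := X) (W := W) (E := E) (S := S) (Y := Y)
       M2 kappa (lookup_class zs) us (map step_edge nc) (head 0%N us)
       (map (fun c => c.1.2) ch) ch
  else set0.

Lemma skeleton_event_le z zs rts : size rts = size zs ->
  (P (skeleton_event (z :: zs) rts) <=
   (N0%:R^-1 * (usage_const ^+ size zs *
     (if shortcut_free (captured g vertex_weight vertex_vol) (z :: zs) then
       skeleton_weight g vertex_weight vertex_mass vertex_vol (z :: zs) else 0)))%:E * P Bk)%E.
Proof.
move=> srts.
have w1 y : 1 <= vertex_weight y by rewrite ler1n.
have wl y : 0 <= vertex_weight y by apply: le_trans (w1 y).
have mass0 y : 0 <= vertex_mass y by rewrite mulr_ge0 ?powR_ge0 ?(ltW C0).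
have cp0 : 0 <= conn_path g vertex_weight vertex_vol z zs.
  elim: (zs) (z) => //= y t IH x; rewrite mulr_ge0// /conn.
  by case: ifP => // _; exact: powR_ge0.
have K1 : 0 <= usage_const by apply: le_trans (usage_const_ge1 g2 g1 M21).
have rhs0 : 0 <= N0%:R^-1 * (usage_const ^+ size zs *
     (if shortcut_free (captured g vertex_weight vertex_vol) (z :: zs) then
       skeleton_weight g vertex_weight vertex_mass vertex_vol (z :: zs) else 0)).
  rewrite mulr_ge0 ?invr_ge0// mulr_ge0 ?exprn_ge0//; case: ifP => // _.
  by rewrite /skeleton_weight !mulr_ge0// prodr_ge0.
rewrite /skeleton_event; case: ifPn => [ok|_]; last first.
  by rewrite measure0 mule_ge0 ?lee_fin ?measure_ge0.
have /and4P[uus sf urts /allP hcap] := ok.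
have lk y : y \in z :: zs -> lookup_class (z :: zs) (vertex_label y) = y.2.+1.
  exact: lookup_classE.
apply: (le_trans (skeleton_prob_le hG hP theta1_ge0 theta2_le1 g2 g1 galpha hC lam2 M21 C0 uus _ urts _)).
- move=> v; rewrite -/(map vertex_label (z :: zs)) => /mapP[y yzs ->].
  by rewrite lk// ltn_ord.
- by move=> st sst z0; have := hcap st sst; rewrite z0 eqxx.
apply: lee_wpmul2r; first exact: measure_ge0.
rewrite lee_fin -mulrA ler_wpM2l ?invr_ge0//.
rewrite (prod_steps_conn srts lk) sf.
rewrite -[X in \prod_(v <- X) _]/(map vertex_label (z :: zs)) big_map.
rewrite (_ : \prod_(v <- z :: zs) _ = \prod_(v <- z :: zs) vertex_mass v); last first.
  by rewrite big_seq [RHS]big_seq; apply: eq_bigr => y yzs; rewrite lk.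
rewrite mulrCA ler_wpM2l ?exprn_ge0// /skeleton_weight ler_wpM2r//.
rewrite -[leLHS]mul1r ler_wpM2r ?prodr_ge0//.
by rewrite -[1]mulr1 ler_pM.
Qed.

Variable k : nat.

Definition skeleton_index : finType :=
  {m : 'I_k.+1 & (m.+1.-tuple Z * m.-tuple ('I_k.+1 * 'I_3))%type}.

Definition index_event (D : skeleton_index) : set Omega :=
  skeleton_event (tagged D).1 [seq (val r.1, val r.2) | r <- (tagged D).2].

Definition index_end (D : skeleton_index) : 'I_N0 := (tnth (tagged D).1 ord_max).1.

Variable M : R.
Hypothesis M0 : 0 <= M.
Hypothesis LM : forall x : Z,
  \sum_z vertex_mass z * (vertex_weight z * vertex_weight z `^ g) / vertex_vol x z <= M.

Definition skeleton_total : R :=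
  \sum_(m < k.+1) (3 * k.+1%:R * usage_const) ^+ m * ((m.+1)`!%:R * (2 * (2 ^+ d) ^+ 2 * M) ^+ m).

Definition second_moment : R := \sum_(j < n) C * j.+1%:R `^ (- (2 + g)) * j.+1%:R ^+ 2.

Lemma sum_index_event_le : (0 < N0)%N ->
  (\sum_D P (index_event D) <= (skeleton_total * second_moment)%:E * P Bk)%E.
Proof.
move=> N00.
have PBfin : P Bk \is a fin_num by apply: fin_num_measure; exact: (measurable_config hG).
pose Ew m (zs : m.+1.-tuple Z) : R := N0%:R^-1 * (usage_const ^+ m *
   (if shortcut_free (captured g vertex_weight vertex_vol) zs then
       skeleton_weight g vertex_weight vertex_mass vertex_vol zs else 0)).
apply: (@le_trans _ _ (\sum_(D : skeleton_index) (Ew _ (tagged D).1)%:E * P Bk)%E).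
  apply: lee_sum => -[m [zs rt]] _; rewrite /index_event /Ew /=.
  case/tupleP: zs => z zs; rewrite -[in usage_const ^+ _](size_tuple zs).
  by apply: skeleton_event_le; rewrite size_map !size_tuple.
rewrite -(fineK PBfin) -EFinM.
rewrite (eq_bigr (fun D : skeleton_index => (Ew _ (tagged D).1 * fine (P Bk))%:E)) => [|I _]; last by rewrite EFinM.
rewrite sumEFin lee_fin -mulr_suml ler_wpM2r ?fine_ge0 ?measure_ge0//.
rewrite /skeleton_total mulr_suml.
rewrite -(sig_big_dep xpredT (fun _ => xpredT) (fun (m : 'I_k.+1) (p : (m.+1.-tuple Z * m.-tuple ('I_k.+1 * 'I_3))%type) => Ew m p.1)) /=.
apply: ler_sum => m _.
rewrite -(pair_bigA _ (fun zs (rt : m.-tuple ('I_k.+1 * 'I_3)) => Ew m zs)) /=.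
under eq_bigr do rewrite sumr_const card_tuple card_prod !card_ord.
rewrite sumrMnl /Ew -mulr_sumr -mulr_sumr -big_mkcond /=.
set Sm := \sum_(zs | _) _.
have hS : Sm <= (m.+1)`!%:R * (2 * (2 ^+ d) ^+ 2 * M) ^+ m * (N0%:R * second_moment).
  have -> : N0%:R * second_moment = \sum_z vertex_mass z * vertex_weight z ^+ 2.
    rewrite -(pair_bigA _ (fun (u : 'I_N0) (j : 'I_n) => C * j.+1%:R `^ (- (2 + g)) * j.+1%:R ^+ 2 : R)) /=.
    by rewrite sumr_const card_ord mulr_natl.
  apply: sum_skeleton_le => //.
  - by rewrite exprn_ege1// ler1n.
  - by move=> z; rewrite ler1n.
  - by move=> z; rewrite mulr_ge0 ?powR_ge0 ?(ltW C0).
  - by move=> x y; exact: grid_vol_ge1.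
  - by move=> x y; exact: grid_volC.
  - by move=> x y z; exact: grid_vol_triangle.
have K1 : 0 <= usage_const by apply: le_trans (usage_const_ge1 g2 g1 M21).
rewrite -[leLHS]mulr_natl natrX natrM.
have N0' : N0%:R != 0 :> R by rewrite pnatr_eq0 -lt0n.
apply: (@le_trans _ _ ((k.+1%:R * 3) ^+ m * (N0%:R^-1 * (usage_const ^+ m *
   ((m.+1)`!%:R * (2 * (2 ^+ d) ^+ 2 * M) ^+ m * (N0%:R * second_moment)))))).
  by rewrite ler_wpM2l ?exprn_ge0 ?mulr_ge0// ler_wpM2l ?invr_ge0// ler_wpM2l ?exprn_ge0.
rewrite le_eqVlt; apply/orP; left; apply/eqP; rewrite !exprMn; field.
by [].
Qed.

Lemma measurable_index_event D' : measurable (index_event D').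
Proof.
have [mN mX _ _ _] := girg_positions hG.
have mW := girg_weight_measurable hG; have mE := girg_edge_measurable hG.
rewrite /index_event /skeleton_event; case: ifP => // _.
apply: measurableI.
  exact: (sigma_start_measurable mN mX mW mE (start_measurable hP)) (start_event_start _ _ _ _ _ _ _).
set ch := map _ _; elim: ch => [|c ch IH].
  by rewrite (_ : mkset _ = setT)//; apply/seteqP; split.
rewrite (_ : mkset _ = (Y c.1.1 c.1.2 @^-1` [set c.2]) `&` [set w | forall c, c \in ch -> Y c.1.1 c.1.2 w = c.2]).
  apply: measurableI => //.
  by rewrite -[X in measurable X]setTI; exact: (choice_measurable hP).
apply/seteqP; split => w /= => [h|[h1 h2] c'].
  by split=> [|c' c'ch]; apply: h; rewrite inE ?eqxx ?c'ch ?orbT.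
by rewrite inE => /orP[/eqP ->|/h2].
Qed.

Definition class_ok w := forall u, (u < N0)%N -> (0 < weight_class W u w <= n)%N.
Definition degree_ok w := forall u, (u < N0)%N -> (0 < degree N E u w)%N ->
  (weight_class W u w)%:R <= M2 * (degree N E u w)%:R.

Lemma informed_skeleton w i : Bk w -> class_ok w -> degree_ok w -> (i < N0)%N ->
  informed N0 (fun a b => E a b w) (S w) (fun r a => Y r a w) k i ->
  exists D', index_event D' w /\ index_end D' = i :> nat.
Proof.
move=> Bw cok dok iN inf.
have [Esym _] := girg_simple hG w.
have SN := informed_start iN inf.
have [l [pl sl lk lN li]] := informed_path Esym iN inf.
pose cap u v := captured g (fun a => (weight_class W a w)%:R) label_vol u v.
have pl' : path (linked (fun a b => E a b w) (fun r a => Y r a w) cap) (0%N, S w) l.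
  by apply: sub_path pl => a b ab; rewrite /linked ab orbT.
have [l' [pl2 sub lst ul sf]] := shorten_path pl'.
have l'N q' : q' \in l' -> (q'.2 < N0)%N by move=> /(mem_subseq sub)/(allP lN).
have l'k q' : q' \in l' -> (q'.1 < k)%N by move=> /(mem_subseq sub)/(allP lk).
have ur : uniq (map fst l').
  apply: (subseq_uniq (map_subseq _ sub)); apply: sorted_uniq sl; first exact: ltn_trans.
  by move=> x; rewrite /= ltnn.
have mk : (size l' < k.+1)%N.
  rewrite ltnS -(size_map fst) -[leqRHS](size_iota 0 k); apply: uniq_leq_size => // r /mapP[q' q'l ->].
  by rewrite mem_iota /= l'k.
have n0 : (0 < n)%N by have /andP[h1 h2] := cok _ iN; exact: leq_trans h1 h2.
pose mkz v : Z := (insubd (Ordinal iN) v, insubd (Ordinal n0) (weight_class W v w).-1).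
set us := map snd ((0%N, S w) :: l') in ul sf.
have usN v : v \in us -> (v < N0)%N.
  by rewrite inE => /orP[/eqP ->//|/mapP[q' /l'N h ->]].
have lab v : v \in us -> vertex_label (mkz v) = v.
  by move=> /usN vN; rewrite /vertex_label /= val_insubd vN.
have cls v : v \in us -> (mkz v).2.+1 = weight_class W v w.
  move=> /usN /cok /andP[h1 h2]; rewrite val_insubd.
  by rewrite prednK// h2 prednK.
pose zs := map mkz us.
have labs : map vertex_label zs = us.
  by rewrite /zs -map_comp -[RHS]map_id; apply/eq_in_map => v /lab.
have szs : size zs == (size l').+1 by rewrite !size_map /=.
pose rts := step_types (fun a b => E a b w) (fun r a => Y r a w) cap (S w) l'.
pose rt := map (fun r => (inord r.1, inord r.2) : 'I_k.+1 * 'I_3) rts.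
have srt : size rt == size l' by rewrite size_map size_step_types.
have rtE : [seq (val r.1, val r.2) | r <- rt] = rts.
  rewrite /rt -map_comp -[RHS]map_id; apply/eq_in_map => r rr /=.
  rewrite !inordK; first by case: r rr.
    exact: step_types_lt3 rr.
  have : r.1 \in map fst l' by rewrite -(step_types_rounds (fun a b => E a b w) (fun r a => Y r a w) cap (S w)) map_f.
  by move=> /mapP[q' /l'k h ->]; exact: leqW.
exists (existT (fun m : 'I_k.+1 => (m.+1.-tuple Z * m.-tuple ('I_k.+1 * 'I_3))%type)
   (Ordinal mk) (Tuple szs, Tuple srt)).
split; last first.
  rewrite /index_end (tnth_nth (mkz i)) /= -/(vertex_label _).
  rewrite -[LHS](nth_map (mkz i) (S w) vertex_label) ?(eqP szs)// labs.
  rewrite /us map_cons -[X in nth _ _ X](size_map snd) -last_nth.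
  by rewrite (last_map snd l' (0%N, S w)) lst.
rewrite /index_event /= rtE.
have lkE v : v \in us -> lookup_class zs v = weight_class W v w.
  by move=> vus; rewrite -{1}(lab v vus) lookup_classE ?labs ?cls//; exact: map_f.
have stp st : st \in steps (S w) (behead us) rts ->
   [/\ st.1.1 \in us, st.1.2 \in us &
     if st.2.2 == 0%N then cap st.1.1 st.1.2
     else E st.1.1 st.1.2 w && (if st.2.2 == 1%N then Y st.2.1 st.1.1 w == st.1.2
                           else Y st.2.1 st.1.2 w == st.1.1)].
  move=> sst; have [h1 h2 _] := steps_mem sst; split=> //; first by rewrite inE h2 orbT.
  exact: step_types_mem pl2 sst.
rewrite /skeleton_event labs; case: ifPn => [ok|/negP[]]; last first.
  apply/and4P; rewrite labs; split; first exact: ul.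
  - rewrite (shortcut_free_map (f := vertex_label) (cap' := cap)) ?labs//.
    move=> _ _ /mapP[u uus ->] /mapP[v vus ->].
    by rewrite /cap /captured /capture_radius /vertex_weight !cls// !lab// /vertex_vol; congr (label_vol _ _ <= _); exact: lab.
  - by rewrite step_types_rounds.
  apply/allP => st sst; have [h1 h2 h3] := stp st sst; apply/implyP => /eqP z0.
  by move: h3; rewrite z0 eqxx /cap /captured /capture_radius /class_weight !lkE.
set nc := used_steps _ _ _.
have ncP st : st \in nc -> [/\ st.1.1 \in us, st.1.2 \in us, E st.1.1 st.1.2 w &
    (if st.2.2 == 1%N then Y st.2.1 st.1.1 w == st.1.2 else Y st.2.1 st.1.2 w == st.1.1)].
  rewrite mem_filter => /andP[nz /stp[h1 h2]]; rewrite (negbTE nz) => /andP[h3 h4].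
  by split.
split.
  split=> //; split.
    split.
      by split=> // v /lkE.
    move=> _ /mapP[st /ncP[_ _ h _] ->]; rewrite /step_edge /= /minn /maxn.
    by case: ifP => // _; rewrite Esym.
  move=> _ /mapP[c /mapP[st /ncP[h1 h2 h3 _] ->] ->].
  have deg a b : a \in us -> b \in us -> E a b w -> (lookup_class zs a)%:R <= M2 * (degree N E a w)%:R.
    move=> ha hb hE; rewrite lkE//; apply: dok; first exact: usN.
    rewrite /degree -has_predT; apply/hasP; exists b => //.
    by rewrite mem_filter hE mem_iota /= (config_num Bw) usN.
  rewrite /step_choice; case: ifP => _ /=; first exact: (deg _ st.1.2).
  by apply: (deg _ st.1.1) => //; rewrite Esym.
move=> c /mapP[st /ncP[_ _ _ h] ->]; move: h.
by rewrite /step_choice; case: ifP => _ /eqP.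
Qed.

Lemma config_markov (t : R) (H : set Omega) : 0 <= t -> (0 < N0)%N ->
  measurable H ->
  (forall w, H w -> [/\ Bk w, class_ok w, degree_ok w &
     t <= (num_informed (N w) (fun a b => E a b w) (S w) (fun r a => Y r a w) k)%:R]) ->
  (t%:E * P H <= (skeleton_total * second_moment)%:E * P Bk)%E.
Proof.
move=> t0 N00 mH hH; apply: le_trans (sum_index_event_le N00).
apply: count_markov => // [I|w /hH[Bw cok dok tw]]; first exact: measurable_index_event.
apply: (le_trans tw); rewrite (config_num Bw) /num_informed -sum1_count.
rewrite (partition_big index_end xpredT) //=.
set inf := informed _ _ _ _ _.
rewrite -[X in iota 0 X]subn0 -/(index_iota 0 N0) big_mkord big_mkcond natr_sum.
apply: ler_sum => i _; have [infi|_] := boolP (inf i); last exact: sumr_ge0.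
have [D' [hD' Di]] := informed_skeleton Bw cok dok (ltn_ord i) infi.
rewrite (bigD1 D') /=; last by apply/eqP/val_inj.
by rewrite indicE mem_set// lerDl sumr_ge0.
Qed.

End skeleton_tuples.

(** * Exceptional weights, degrees and positions *)

Lemma girg_kernelC {R : realType} (alpha : R) n d (x y : torus_point R d) (wu wv : R) :
  girg_kernel alpha n x y wu wv = girg_kernel alpha n y x wv wu.
Proof.
rewrite /girg_kernel (_ : torus_dist x y = torus_dist y x) ?[wu * _]mulrC//.
by apply: eq_bigr => c _; rewrite /circle_dist distrC.
Qed.

Lemma count_injective_le (T : finType) (U : eqType) (A : pred T) (f : T -> U) (s : seq U) :
  (forall x, A x -> f x \in s) -> {in A &, injective f} -> (#|A| <= size s)%N.
Proof.
move=> fs inj; rewrite cardE -(size_map f); apply: uniq_leq_size.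
  by rewrite map_inj_in_uniq ?enum_uniq// => x y; rewrite !mem_enum; exact: inj.
by move=> _ /mapP[x + ->]; rewrite mem_enum => /fs.
Qed.

Lemma weight_class_tail {R : realType} (g C : R) (D : probability (measurableTypeR R) R) n :
  D `[1%R, +oo[%classic = 1%E -> 1 / 2 <= g -> (1 < n)%N -> 0 < C ->
  (forall m : nat, (0 < m)%N -> (D (unit_itv m) <= (C * m%:R `^ (- (2 + g)))%:E)%E) ->
  (D ((fun x : measurableTypeR R => Num.truncn x) @^-1` [set m | ~~ (0 < m <= n)%N])
    <= (2 * C * n%:R `^ (- (3 / 2)))%:E)%E.
Proof.
move=> D1 g2 n1 C0 hC; apply: le_trans (power_law_tail g2 n1 C0 hC).
have mA (A : set nat) := @measurable_truncn R A.
set B : set (measurableTypeR R) := `[1%R, +oo[%classic in D1 *.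
have m1 : measurable B by exact: measurable_itv.
have mn : measurable (`[n%:R, +oo[%classic : set (measurableTypeR R)) by exact: measurable_itv.
apply: (@le_trans _ _ (D (~` B `|` `[n%:R, +oo[%classic))).
  apply: le_measure; rewrite ?inE//; first by apply: measurableU => //; exact: measurableC.
  move=> x; rewrite /B /= !in_itv/= !andbT; have [x1|x1] := ltP x 1; first by left; apply/negP.
  rewrite negb_and -leqNgt -ltnNge => /orP[|h].
    by rewrite leqNgt Num.Theory.truncn_gt0 x1.
  right; apply: (@le_trans _ _ (Num.truncn x)%:R); first by rewrite ler_nat ltnW.
  by rewrite Num.Theory.truncn_le; lra.
apply: le_trans (measureU2 _ _ _) _ => //; first exact: measurableC.
have DB : (D (~` B) <= 0)%E by rewrite probability_setC// D1 subee.
by rewrite -[leRHS]add0e; exact: leeD.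
Qed.

Section bad_configurations.
Context {R : realType} {disp : measure_display} {Omega : measurableType disp}.
Context {d q n : nat} {alpha theta1 theta2 : R}.
Context {D : probability (measurableTypeR R) R} {P : probability Omega R}.
Context {N : Omega -> nat} {X : nat -> Omega -> torus_point R d}.
Context {W : nat -> Omega -> measurableTypeR R}.
Context {p : nat -> nat -> Omega -> measurableTypeR R}.
Context {E : nat -> nat -> Omega -> bool}.
Hypothesis hG : girg alpha theta1 theta2 D n P N X W p E.
Hypotheses (theta1_gt0 : 0 < theta1) (theta12 : theta1 <= theta2) (theta2_le1 : theta2 <= 1).
Hypothesis alpha_ge0 : 0 <= alpha.

Variable kappa : seq {ffun 'I_d -> 'I_q.+1}.
Let N0 := size kappa.
Local Notation Bk := (config_event (N := N) (X := X) kappa).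

Let mN : measurable_fun setT N. Proof. by case: (girg_positions hG). Qed.
Let mX i : measurable_fun setT (X i). Proof. by case: (girg_positions hG). Qed.
Let mW i : measurable_fun setT (W i). Proof. exact: girg_weight_measurable hG i. Qed.
Let mE i j : measurable_fun setT (E i j). Proof. exact: girg_edge_measurable hG i j. Qed.
Let mB : measurable Bk. Proof. exact: measurable_config hG kappa. Qed.

Lemma config_union_bound (I : finType) (A : I -> set Omega) (H : set Omega) (c : R) :
  measurable H -> (forall i, measurable (A i)) ->
  (forall w, H w -> exists i, A i w) ->
  (forall i, (P (A i) <= c%:E * P Bk)%E) ->
  (P H <= (#|I|%:R * c)%:E * P Bk)%E.
Proof.
move=> mH mA h hA; apply: le_trans (union_bound _ mH mA h) _.
have PBfin : P Bk \is a fin_num by exact: fin_num_measure.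
apply: (@le_trans _ _ (\sum_(i : I) (c%:E * P Bk))%E); first exact: lee_sum.
by rewrite -(fineK PBfin) -EFinM sumEFin lee_fin sumr_const -mulrA mulr_natl.
Qed.

Lemma class_fails_le (g C : R) (H : set Omega) :
  D `[1%R, +oo[%classic = 1%E -> 1 / 2 <= g -> (1 < n)%N -> 0 < C ->
  (forall m : nat, (0 < m)%N -> (D (unit_itv m) <= (C * m%:R `^ (- (2 + g)))%:E)%E) ->
  measurable H ->
  (forall w, H w -> Bk w /\ ~ class_ok (n := n) (W := W) kappa w) ->
  (P H <= (N0%:R * (2 * C * n%:R `^ (- (3 / 2))))%:E * P Bk)%E.
Proof.
move=> D1 g2 n1 C0 hC mH hH.
set A0 := (fun x : measurableTypeR R => Num.truncn x) @^-1` [set m | ~~ (0 < m <= n)%N].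
pose A (u : 'I_N0) := Bk `&` W u @^-1` A0.
have mA0 : measurable A0 by exact: measurable_truncn.
rewrite -[in (N0%:R)](card_ord N0).
apply: (config_union_bound (A := A)) => //.
- by move=> u; apply: measurableI => //; rewrite -[X in measurable X]setTI; exact: mW.
- move=> w /hH[Bw /existsNP[u /not_implyP[uN /negP h]]].
  by exists (Ordinal uN).
move=> u.
have := @cond_indep_law_le _ _ _ P (sigma_positions N X) _ _ _ _ _ _ [:: val u]
  (fun _ => A0) Bk (fun _ => 2 * C * n%:R `^ (- (3 / 2))) (girg_weights hG) isT.
rewrite big_seq1 => h.
have -> : A u = Bk `&` [set w | forall i, i \in [:: val u] -> A0 (W i w)].
  by congr (_ `&` _); apply/seteqP; split => w /= h'; [move=> i; rewrite inE => /eqP ->|apply: h'; rewrite mem_head].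
apply: h => //; first exact: config_positions kappa.
move=> i w _ _; rewrite measure_ge0/=; exact: (weight_class_tail D1 g2 n1 C0 hC).
Qed.

Variable h : nat.
Hypothesis crowded : forall c, (h < count_mem c kappa)%N.

(* The threshold on [W u] is where [girg_kernel_near] yields edge probabilities
   at least [theta1] towards all the vertices of the cell [c]. *)
Definition strong_event (u : 'I_N0) (c : {ffun 'I_d -> 'I_q.+1}) : set Omega :=
  Bk `&` [set w | forall i, (i < N0)%N -> 1 <= W i w] `&`
  [set w | n%:R / q.+1%:R ^+ d * 2 ^+ d * grid_vol (cell_at kappa u) c <= W u w].

Lemma strong_event_weights u c : sigma_weights N X W (strong_event u c).
Proof.
have sF := sigma_algebra_join (sigma_positions N X) W.
have hi i (x : R) : sigma_weights N X W [set w | x <= W i w].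
  rewrite (_ : mkset _ = W i @^-1` `[x, +oo[%classic).
    by apply: sigma_join_preimage; exact: measurable_itv.
  by apply/seteqP; split => w /=; rewrite in_itv/= andbT.
apply: (sigma_algebra_setI sF); last exact: hi.
apply: (sigma_algebra_setI sF).
  exact: sub_sigma_join (config_positions kappa).
elim: (N0) => [|m IH].
  by rewrite (_ : mkset _ = setT); [exact: (sigma_algebra_setT sF)|apply/seteqP; split].
rewrite (_ : mkset _ = [set w | 1 <= W m w] `&` [set w | forall i, (i < m)%N -> 1 <= W i w]).
  by apply: (sigma_algebra_setI sF); [exact: hi|exact: IH].
apply/seteqP; split => w /= => [H|[H1 H2] i].
  by split=> [|i im]; apply: H => //; apply: ltnW.
by rewrite ltnS leq_eqVlt => /orP[/eqP ->|/H2].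
Qed.

Definition isolated_from u c w := forall i : 'I_N0, cell_at kappa i = c -> ~~ E u i w.

Lemma measurable_isolated u c : measurable [set w | isolated_from u c w].
Proof.
rewrite (_ : mkset _ = \bigcap_(i in [set i : 'I_N0 | cell_at kappa i = c]) [set w | ~~ E u i w]).
  apply: fin_bigcap_measurable; first exact: finite_finset.
  move=> i _; rewrite (_ : mkset _ = setT `&` E u i @^-1` [set false]); first exact: mE.
  by rewrite setTI; apply/seteqP; split => w /= => [/negbTE|->].
by apply/seteqP; split.
Qed.

Lemma isolated_le (u : 'I_N0) c :
  (P (strong_event u c `&` [set w | isolated_from u c w]) <= ((1 - theta1) ^+ h)%:E * P Bk)%E.
Proof.
have theta1_le1 : theta1 <= 1 by exact: le_trans theta2_le1.
pose a (i : 'I_N0) := cell_at kappa i == c.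
pose s := take h [seq i : 'I_N0 <- enum 'I_N0 | a i && (i != u)].
have hs : size s = h.
  have ca : (#|a| = count_mem c kappa)%N.
    rewrite cardE /enum_mem size_filter -enumT -[in RHS](mkseq_nth [ffun _ => ord0] kappa).
    by rewrite /mkseq -val_enum_ord !count_map; apply: eq_count.
  rewrite size_takel// size_filter.
  have <- : #|[predD1 a & u]| = count (fun i => a i && (i != u)) (enum 'I_N0).
    by rewrite cardE [in LHS]/enum_mem size_filter -enumT; apply: eq_count => i; rewrite !inE andbC.
  have := crowded c; rewrite -ca (cardD1 u) => hc.
  by rewrite -ltnS (leq_trans hc)// -add1n leq_add2r leq_b1.
have us : uniq s by rewrite take_uniq// filter_uniq// enum_uniq.
have si i : i \in s -> cell_at kappa i = c /\ i != u.
  by move=> /mem_take; rewrite mem_filter /a => /andP[/andP[/eqP-> ->]].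
pose e (i : 'I_N0) := (minn u i, maxn u i).
have einj : {in s &, injective e}.
  move=> i j /si[_ iu] /si[_ ju] /eqP; rewrite /e xpair_eqE => /andP[/eqP h1 /eqP h2].
  apply: val_inj => /=; move: h1 h2 iu ju; rewrite -!(inj_eq val_inj)/=; lia.
have ues : uniq (map e s) by rewrite map_inj_in_uniq.
have sw := strong_event_weights u c.
have msw : measurable (strong_event u c) by exact: (sigma_weights_measurable mN mX mW) sw.
apply: (@le_trans _ _ (((1 - theta1) ^+ h)%:E * P (strong_event u c))%E); last first.
  apply: lee_wpmul2l; first by rewrite lee_fin exprn_ge0//; lra.
  by apply: le_measure; rewrite ?inE// => w [[]].
have := @cond_indep_law_le _ _ _ P (sigma_weights N X W) _ _ _ _ _ _ (map e s)
  (fun _ => [set false]) (strong_event u c) (fun _ => 1 - theta1) (girg_edges hG) ues.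
rewrite big_const_seq count_predT size_map hs iter_mulr_1 => hh.
apply: le_trans (hh _ _ _ _ _) => //.
- apply: le_measure; rewrite ?inE//.
  + by apply: measurableI => //; exact: measurable_isolated.
  + apply: measurableI => //.
    rewrite (_ : mkset _ = \bigcap_(i in [set` map e s]) (E i.1 i.2 @^-1` [set false])).
      apply: fin_bigcap_measurable; first exact: finite_seq.
      by move=> i _; rewrite -[X in measurable X]setTI; exact: mE.
    by apply/seteqP; split.
  move=> w [sww iso]; split => //= _ /mapP[i /si[ci iu] ->] /=.
  have [Esym _] := girg_simple hG w; have := iso _ ci => /negbTE.
  by rewrite /minn /maxn; case: ifP => // _; rewrite (Esym i).
- move=> _ /mapP[i /si[_ iu] ->] w [[/(config_num) /= -> _] _].
  have := ltn_ord i; have := ltn_ord u; move: iu; rewrite -(inj_eq val_inj)/=; lia.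
move=> _ w /mapP[i /si[ci iu] ->] [[Bw w1] wu].
have NE := config_num Bw.
have eo : ((e i).1 < (e i).2 < N w)%N.
  by rewrite NE /=; have := ltn_ord i; have := ltn_ord u; move: iu; rewrite -(inj_eq val_inj)/=; lia.
have [tu cu] := config_cell hG Bw (ltn_ord u).
have [ti ci'] := config_cell hG Bw (ltn_ord i).
have ker : girg_kernel alpha n (X u w) (X i w) (W u w) (W i w) = 1.
  apply: (girg_kernel_near (q := q)) => //; first exact: w1.
  by rewrite cu ci' ci.
have := girg_prob_bounds hG eo => /=.
have -> : girg_kernel alpha n (X (minn u i) w) (X (maxn u i) w) (W (minn u i) w) (W (maxn u i) w) = 1.
  by rewrite /minn /maxn; case: ifP => // _; rewrite girg_kernelC.
rewrite !mulr1 => /andP[p1 p2].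
rewrite bernoulli_false ?lee_fin ?subr_ge0 ?lerD2l ?lerN2 ?p1 ?(le_trans p2)//.
by rewrite (le_trans (ltW theta1_gt0) p1)//.

Qed.

Lemma strong_vertex_degree w (u : 'I_N0) : Bk w ->
  (forall i, (i < N0)%N -> 1 <= W i w) ->
  (forall c, ~ (strong_event u c `&` [set w | isolated_from u c w]) w) ->
  (#|[pred c : {ffun 'I_d -> 'I_q.+1} | (n%:R / q.+1%:R ^+ d * 2 ^+ d * grid_vol (cell_at kappa u) c <= W u w :> R)%R]|
    <= degree N E u w)%N.
Proof.
move=> Bw w1 hc.
pose f c : nat := odflt 0%N (omap val [pick i : 'I_N0 | (cell_at kappa i == c) && E u i w]).
have fP c : n%:R / q.+1%:R ^+ d * 2 ^+ d * grid_vol (cell_at kappa u) c <= W u w ->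
    exists i : 'I_N0, [/\ f c = i, cell_at kappa i = c & E u i w].
  move=> cw; rewrite /f; case: pickP => [i /andP[/eqP ci Eui]|none]; first by exists i.
  case: (hc c); split; first by [].
  by move=> i ci; have := none i; rewrite ci eqxx/= => ->.
apply: (count_injective_le (f := f)) => [c /fP[i [-> _ Eui]]|c c' /fP[i [-> ci _]] /fP[j [-> cj _]] ij].
  by rewrite mem_filter Eui mem_iota /= add0n (config_num Bw) ltn_ord.
by rewrite -ci -cj ij.
Qed.

Lemma degree_fails_le (H : set Omega) : 1 <= n%:R / q.+1%:R ^+ d :> R -> measurable H ->
  (forall w, H w -> [/\ Bk w, class_ok (n := n) (W := W) kappa w &
    ~ degree_ok (N := N) (W := W) (E := E) (n%:R / q.+1%:R ^+ d * 4 ^+ d) kappa w]) ->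
  (P H <= ((N0 * q.+1 ^ d)%:R * (1 - theta1) ^+ h)%:E * P Bk)%E.
Proof.
set lam := n%:R / q.+1%:R ^+ d => q_lam mH hH.
have lam0 : 0 < lam by exact: lt_le_trans q_lam.
pose I : finType := ('I_N0 * {ffun 'I_d -> 'I_q.+1})%type.
have cI : #|I| = (N0 * q.+1 ^ d)%N by rewrite card_prod card_ffun !card_ord.
rewrite -cI; apply: (config_union_bound
  (A := fun z : I => strong_event z.1 z.2 `&` [set w | isolated_from z.1 z.2 w])) => //.
- move=> [u c]; apply: measurableI; last exact: measurable_isolated.
  exact: (sigma_weights_measurable mN mX mW) (strong_event_weights u c).
- move=> w /hH[Bw cok]; apply: contra_notP => none u uN degu.
  have /andP[cu0 cun] := cok u uN.
  have w1 i : (i < N0)%N -> 1 <= W i w.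
    by move=> /cok/andP[+ _]; rewrite /weight_class Num.Theory.truncn_gt0.
  have dg := @strong_vertex_degree w (Ordinal uN) Bw w1.
  have {}dg : (#|[pred c : {ffun 'I_d -> 'I_q.+1} | (lam * 2 ^+ d * grid_vol (cell_at kappa u) c <= W u w :> R)%R]| <= degree N E u w)%N.
    by apply: dg => c hc; apply: none; exists (Ordinal uN, c).
  have ball (j : nat) : (j < q.+1)%N -> lam * 2 ^+ d * j.+1%:R ^+ d <= W u w ->
      (j.+1 ^ d <= degree N E u w)%N.
    move=> jq jw; apply: leq_trans dg; apply: leq_trans (card_grid_ball (cell_at kappa u) jq) _.
    apply: subset_leq_card; apply/fintype.subsetP => c; rewrite !inE => cj.
    apply: le_trans jw; rewrite ler_wpM2l ?mulr_ge0 ?(ltW lam0)//.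
    by rewrite /grid_vol lerXn2r ?nnegrE// ler_nat.
  have cW : (weight_class W u w)%:R <= W u w.
    by rewrite Num.Theory.truncn_le ?(le_trans _ (w1 u uN)).
  have [j /orP hj jmin] := ex_minnP (P := fun j => (j == q.+1) || (W u w < lam * 2 ^+ d * j.+1%:R ^+ d))
    (ex_intro _ q.+1 (introT orP (or_introl (eqxx _)))).
  have four : lam * 4 ^+ d = lam * 2 ^+ d * 2 ^+ d :> R.
    by rewrite -mulrA -exprMn; congr (_ * _ ^+ _); ring.
  have pow0 x : 0 <= x -> 0 <= lam * x ^+ d by move=> x0; rewrite mulr_ge0 ?exprn_ge0// ltW.
  case: j hj jmin => [|j] hj jmin.
    case: hj => //; rewrite expr1n mulr1 => hw.
    apply: (le_trans cW); apply: (le_trans (ltW hw)).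
    by rewrite four -[leRHS]mulrA ler_peMr ?pow0// mulr_ege1 ?exprn_ege1 ?ler1n.
  have /norP[jq jW] : ~~ ((j == q.+1) || (W u w < lam * 2 ^+ d * j.+1%:R ^+ d)).
    by apply/negP => /jmin; rewrite ltnn.
  have jQ : (j < q.+1)%N.
    by rewrite ltn_neqAle jq -ltnS (leq_trans (jmin q.+1 _))// eqxx.
  have := ball j jQ; rewrite leNgt jW => /(_ isT) jd.
  apply: (@le_trans _ _ (lam * 4 ^+ d * (j.+1 ^ d)%:R)); last first.
    by rewrite ler_wpM2l ?pow0// ler_nat.
  rewrite natrX; case: hj => [/eqP ->|hw].
    rewrite mulrAC /lam divfK ?expf_neq0//.
    apply: (@le_trans _ _ n%:R); first by rewrite ler_nat.
    by rewrite ler_peMr// exprn_ege1// (ler_nat _ 1 4).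
  apply: (le_trans cW); apply: (le_trans (ltW hw)).
  rewrite four -[leRHS]mulrA -exprMn ler_wpM2l ?pow0// lerXn2r ?nnegrE ?mulr_ge0//.
  by rewrite -natrM ler_nat; lia.
by move=> [u c]; exact: isolated_le.
Qed.
End bad_configurations.

Lemma sum_seq_count_mem {R : numDomainType} (T : finType) (s : seq T) (f : T -> R) :
  \sum_(x <- s) f x = \sum_x (count_mem x s)%:R * f x.
Proof.
elim: s => [|y s IH]; first by rewrite big_nil big1// => x _; rewrite mul0r.
rewrite big_cons IH /= [RHS](eq_bigr (fun x => (y == x)%:R * f x + (count_mem x s)%:R * f x)).
  rewrite big_split/=; congr (_ + _); rewrite (bigD1 y)//= eqxx mul1r big1 ?addr0// => x xy.
  by rewrite eq_sym (negbTE xy) mul0r.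
by move=> x _; rewrite natrD mulrDl.
Qed.

Lemma second_moment_le {R : realType} (n : nat) (g C : R) : 1 / 2 <= g -> 0 <= C ->
  second_moment (n := n) g C <= C * n%:R `^ (1 / 2) * harm_sum n.
Proof.
move=> g2 C0; rewrite /second_moment /harm_sum mulr_sumr; apply: ler_sum => j _.
rewrite -!mulrA ler_wpM2l//; set x : R := j.+1%:R.
have x0 : 0 < x by rewrite ltr0n.
rewrite -(powR_mulrn 2 (ltW x0)) -powRD ?(gt_eqF x0) ?implybT//.
apply: (@le_trans _ _ (x `^ (1 / 2 - 1))).
  by rewrite ler_powR ?ler1n//; lra.
rewrite powRD ?(gt_eqF x0) ?implybT// powR_inv1 ?(ltW x0)// ler_wpM2r ?invr_ge0 ?(ltW x0)//.
by rewrite ge0_ler_powR ?nnegrE ?(ltW x0)// /x ler_nat.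
Qed.

Lemma vertex_sum_le {R : realType} (d q n T : nat) (g C : R) (kappa : seq {ffun 'I_d -> 'I_q.+1}) :
  0 <= C -> (forall c, (count_mem c kappa <= T)%N) ->
  forall x : 'I_(size kappa) * 'I_n,
  \sum_z vertex_mass g C z * (vertex_weight z * vertex_weight z `^ g) / vertex_vol x z <=
    C * harm_sum n * (T%:R * (2 * harm_sum q.+1) ^+ d).
Proof.
move=> C0 hT x.
have hz (z : 'I_(size kappa) * 'I_n) :
    vertex_mass g C z * (vertex_weight z * vertex_weight z `^ g) / vertex_vol x z =
    C * z.2.+1%:R^-1 * (grid_vol (cell_at kappa x.1) (cell_at kappa z.1))^-1.
  rewrite /vertex_mass /vertex_weight /vertex_vol /label_vol; congr (_ * _).
  set y : R := z.2.+1%:R; have y0 : 0 < y by rewrite ltr0n.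
  rewrite -mulrA; congr (_ * _).
  have -> : y * y `^ g = y `^ (1 + g).
    by rewrite powRD ?(gt_eqF y0) ?implybT// powRr1 ?ltW.
  rewrite -powRD ?(gt_eqF y0) ?implybT//.
  by rewrite -powR_inv1 ?(ltW y0)//; congr (_ `^ _); ring.
rewrite (eq_bigr _ (fun z _ => hz z)).
rewrite -(pair_bigA _ (fun (i : 'I_(size kappa)) (j : 'I_n) =>
   C * j.+1%:R^-1 * (grid_vol (cell_at kappa x.1) (cell_at kappa i))^-1)) /=.
under eq_bigr => i _ do rewrite -mulr_suml -mulr_sumr.
rewrite -mulr_sumr ler_wpM2l ?mulr_ge0 ?sumr_ge0//.
rewrite (_ : \sum_(i < _) _ = \sum_(c <- kappa) (grid_vol (cell_at kappa x.1) c : R)^-1); last first.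
  by rewrite (big_nth [ffun _ => ord0]) big_mkord.
rewrite sum_seq_count_mem; apply: le_trans (_ : T%:R * \sum_c (grid_vol (cell_at kappa x.1) c : R)^-1 <= _).
  rewrite mulr_sumr; apply: ler_sum => c _; rewrite ler_wpM2r ?ler_nat//.
  by rewrite invr_ge0 (le_trans ler01) ?grid_vol_ge1.
by rewrite ler_wpM2l// sum_grid_vol_le.
Qed.

Lemma skeleton_total_le {R : realType} (d k : nat) (g M2 M A : R) :
  let B := 6 * (2 ^+ d) ^+ 2 * k.+1%:R ^+ 2 * usage_const (d := d) g M2 * M in
  0 <= M -> 1 <= usage_const (d := d) g M2 -> B <= A -> k.+1%:R <= A -> 1 <= A ->
  skeleton_total (d := d) g M2 k M <= A ^+ k.+1.
Proof.
move=> B M0 u1 BA kA A1; rewrite /skeleton_total.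
have u0 : 0 <= usage_const (d := d) g M2 by apply: le_trans u1.
apply: (@le_trans _ _ (\sum_(m < k.+1) A ^+ k)).
  apply: ler_sum => m _.
  apply: (@le_trans _ _ (B ^+ m)); last first.
    apply: (@le_trans _ _ (A ^+ m)); last by rewrite ler_weXn2l// -ltnS.
    have B0 : 0 <= B by rewrite /B; do 4?apply: mulr_ge0 => //; rewrite ?exprn_ge0.
    by rewrite lerXn2r ?nnegrE ?(le_trans ler01 A1).
  have fact_le : (m.+1`!)%:R <= k.+1%:R ^+ m :> R.
    rewrite -natrX ler_nat; have : (m <= k)%N by rewrite -ltnS.
    elim: (val m) => [//|j IH jk]; rewrite factS expnS leq_mul// IH//; exact: ltnW.
  rewrite [_%:R * _ ^+ m]mulrC mulrA -exprMn.
  apply: (@le_trans _ _ ((3 * k.+1%:R * usage_const (d := d) g M2 * (2 * (2 ^+ d) ^+ 2 * M)) ^+ m * k.+1%:R ^+ m)).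
    rewrite ler_wpM2l//; apply: exprn_ge0.
    by do 3?[apply: mulr_ge0 => //]; apply: mulr_ge0 => //; rewrite mulr_ge0// ?exprn_ge0.
  rewrite -(exprMn m) (_ : 3 * k.+1%:R * _ * _ * k.+1%:R = B)// /B; ring.
by rewrite sumr_const card_ord -mulr_natl exprS ler_wpM2r ?exprn_ge0 ?(le_trans ler01 A1).
Qed.

Section failure_probability.
Context {R : realType} {disp : measure_display} {Omega : measurableType disp}.
Context {d q n : nat} {alpha theta1 theta2 : R}.
Context {D : probability (measurableTypeR R) R} {P : probability Omega R}.
Context {N : Omega -> nat} {X : nat -> Omega -> torus_point R d}.
Context {W : nat -> Omega -> measurableTypeR R}.
Context {p : nat -> nat -> Omega -> measurableTypeR R}.
Context {E : nat -> nat -> Omega -> bool} {S : Omega -> nat}.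
Context {Y : nat -> nat -> Omega -> nat}.
Hypothesis hG : girg alpha theta1 theta2 D n P N X W p E.
Hypothesis hP : push_pull P N X W E S Y.
Hypotheses (theta1_gt0 : 0 < theta1) (theta12 : theta1 <= theta2) (theta2_le1 : theta2 <= 1).
Variables (g C : R).
Hypotheses (g2 : 1 / 2 <= g) (g1 : g <= 1) (galpha : g^-1 <= alpha).
Hypotheses (D1 : D `[1%R, +oo[%classic = 1%E) (C0 : 0 < C).
Hypothesis hC : forall m : nat, (0 < m)%N ->
  (D (unit_itv m) <= (C * m%:R `^ (- (2 + g)))%:E)%E.
Let lam : R := n%:R / q.+1%:R ^+ d.
Hypotheses (n1 : (1 < n)%N) (lam2 : 2 ^+ d <= lam).
Variables (h T k : nat) (t : R).
Hypothesis t0 : 0 < t.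

Let M2 := lam * 4 ^+ d.
Let M := C * harm_sum n * (T%:R * (2 * harm_sum q.+1) ^+ d) : R.

Definition rumour_spread := [set w |
  ~~ ((num_informed (N w) (fun a b => E a b w) (S w) (fun r a => Y r a w) k)%:R <= t)].

Definition failure_bound : R :=
  (T * q.+1 ^ d)%:R * (2 * C * n%:R `^ (- (3 / 2))) +
  (T * q.+1 ^ d * q.+1 ^ d)%:R * (1 - theta1) ^+ h +
  skeleton_total (d := d) g M2 k M * second_moment (n := n) g C / t.

Let mN : measurable_fun setT N. Proof. by case: (girg_positions hG). Qed.
Let mX i : measurable_fun setT (X i). Proof. by case: (girg_positions hG). Qed.
Let mW i : measurable_fun setT (W i). Proof. exact: girg_weight_measurable hG i. Qed.
Let mE i j : measurable_fun setT (E i j). Proof. exact: girg_edge_measurable hG i j. Qed.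
Let mS : measurable_fun setT S. Proof. exact: start_measurable hP. Qed.
Let mY r i : measurable_fun setT (Y r i). Proof. exact: choice_measurable hP r i. Qed.

Lemma measurable_rumour_spread : measurable rumour_spread.
Proof.
have := dmeas_num_informed mN mX mW mE mS mY k.
by move=> /(dmeas_comp (fun c => ~~ (c%:R <= t))) /dmeas_bool.
Qed.

Lemma measurable_class_ok kappa : measurable (class_ok (d := d) (q := q) (n := n) (W := W) kappa).
Proof.
rewrite (_ : class_ok _ = \bigcap_(u in [set: 'I_(size kappa)])
   [set w | (0 < weight_class W u w <= n)%N]).
  apply: fin_bigcap_measurable; first exact: finite_finset.
  move=> u _.
  have : dmeas measurable (weight_class W u).
    exact: (dmeas_sub (sigma_weights_measurable mN mX mW) (@dmeas_weight_class _ _ _ _ _ _ _ _)).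
  by move=> /(dmeas_comp (fun c => (0 < c <= n)%N)) /dmeas_bool.
apply/seteqP; split=> w; first by move=> hw u _; exact: hw.
by move=> hw u uN; exact: (hw (Ordinal uN)).
Qed.

Lemma measurable_degree_ok kappa : measurable (degree_ok (d := d) (q := q) (N := N) (W := W) (E := E) M2 kappa).
Proof.
rewrite (_ : degree_ok _ _ = \bigcap_(u in [set: 'I_(size kappa)])
   [set w | (0 < degree N E u w)%N ==> ((weight_class W u w)%:R <= M2 * (degree N E u w)%:R)]).
  apply: fin_bigcap_measurable; first exact: finite_finset.
  move=> u _.
  have h1 : dmeas measurable (weight_class W u).
    exact: (dmeas_sub (sigma_weights_measurable mN mX mW) (@dmeas_weight_class _ _ _ _ _ _ _ _)).
  have h2 : dmeas measurable (degree N E u).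
    exact: (dmeas_sub (sigma_graph_measurable mN mX mW mE) (@dmeas_degree _ _ _ _ _ _ _ _ _)).
  have := dmeas2 (@sigma_algebra_measurable _ _) (fun c e => (0 < e)%N ==> (c%:R <= M2 * e%:R)) h1 h2.
  by move=> /dmeas_bool.
apply/seteqP; split=> w; first by move=> hw u _; apply/implyP; exact: hw.
by move=> hw u uN; apply/implyP; exact: (hw (Ordinal uN)).
Qed.

Lemma config_failure_le kappa :
  (forall c : {ffun 'I_d -> 'I_q.+1}, (h < count_mem c kappa <= T)%N) ->
  (P (rumour_spread `&` cell_seq q N X @^-1` [set kappa]) <=
    failure_bound%:E * P (cell_seq q N X @^-1` [set kappa]))%E.
Proof.
move=> hkappa; set Bk := _ @^-1` _.
have hT c : (count_mem c kappa <= T)%N by case/andP: (hkappa c).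
have hh c : (h < count_mem c kappa)%N by case/andP: (hkappa c).
have mB : measurable Bk := measurable_config hG kappa.
have mH := measurable_rumour_spread.
have mcok := measurable_class_ok kappa; have mdok := measurable_degree_ok kappa.
set H := rumour_spread `&` Bk; set cok := class_ok kappa in mcok; set dok := degree_ok M2 kappa in mdok.
have mHB : measurable H by exact: measurableI.
have pow2 : 1 <= 2 ^+ d :> R by rewrite exprn_ege1// (ler_nat _ 1 2).
have lam1 : 1 <= lam by exact: le_trans lam2.
have M21 : 1 <= M2 by rewrite mulr_ege1// exprn_ege1// (ler_nat _ 1 4).
have N0T : (size kappa <= T * q.+1 ^ d)%N.
  have -> : (q.+1 ^ d = #|{ffun 'I_d -> 'I_q.+1}|)%N by rewrite card_ffun !card_ord.
  rewrite -sum1_size mulnC -sum_nat_const.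
  rewrite (_ : (\sum_(i <- kappa) 1 = \sum_(c : {ffun 'I_d -> 'I_q.+1}) count_mem c kappa)%N).
    by apply: leq_sum => c _; exact: hT.
  apply/eqP; rewrite -(eqr_nat R) !natr_sum (sum_seq_count_mem kappa (fun _ => 1%:R)).
  by apply/eqP; apply: eq_bigr => c _; rewrite mulr1.
have N00 : (0 < size kappa)%N.
  by rewrite (leq_trans _ (count_size (pred1 [ffun _ => ord0]) kappa))// (leq_ltn_trans _ (hh _)).
have PBfin : P Bk \is a fin_num by exact: fin_num_measure.
have b1 : (P (H `&` ~` cok) <= ((T * q.+1 ^ d)%:R * (2 * C * n%:R `^ (- (3 / 2))))%:E * P Bk)%E.
  apply: (le_trans (class_fails_le hG D1 g2 n1 C0 hC (kappa := kappa) _ _)).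
  - by apply: measurableI => //; exact: measurableC.
  - by move=> w [[_ Bw] hw]; split.
  rewrite -(fineK PBfin) -!EFinM lee_fin ler_wpM2r ?fine_ge0//.
  by rewrite ler_wpM2r ?ler_nat// !mulr_ge0 ?powR_ge0// ltW.
have alpha0 : 0 <= alpha.
  by apply: le_trans galpha; rewrite invr_ge0 (le_trans _ g2).
have th1 : 0 <= 1 - theta1 by rewrite subr_ge0 (le_trans theta12).
have b2 : (P (H `&` cok `&` ~` dok) <= ((T * q.+1 ^ d * q.+1 ^ d)%:R * (1 - theta1) ^+ h)%:E * P Bk)%E.
  apply: (le_trans (degree_fails_le hG theta1_gt0 theta12 theta2_le1 alpha0 hh lam1 _ _)).
  - by apply: measurableI; [exact: measurableI|exact: measurableC].
  - by move=> w [[[_ Bw] hw] hd]; split.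
  rewrite -(fineK PBfin) -!EFinM lee_fin ler_wpM2r ?fine_ge0//.
  by rewrite ler_wpM2r ?exprn_ge0// ler_nat leq_mul2r N0T orbT.
have b3 : (P (H `&` cok `&` dok) <=
    (skeleton_total (d := d) g M2 k M * second_moment (n := n) g C / t)%:E * P Bk)%E.
  have mHcd : measurable (H `&` cok `&` dok) by apply: measurableI => //; exact: measurableI.
  have PHfin : P (H `&` cok `&` dok) \is a fin_num by exact: fin_num_measure.
  rewrite -(fineK PBfin) -(fineK PHfin) -EFinM lee_fin mulrAC ler_pdivlMr// mulrC.
  rewrite -lee_fin EFinM [leRHS]EFinM !fineK//.
  apply: (config_markov hG hP (ltW theta1_gt0) theta2_le1 g2 g1 galpha hC lam2 M21 C0
     (vertex_sum_le g (ltW C0) hT) (k := k) (ltW t0) N00 mHcd).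
  by move=> w [[[/negP hw Bw] cw] dw]; split => //; rewrite ltW// ltNge; apply/negP.
have -> : H = (H `&` ~` cok) `|` (H `&` cok `&` ~` dok) `|` (H `&` cok `&` dok).
  apply/seteqP; split => w; last by case => [[[]|[[]]]|[[]]].
  move=> Hw; have [cw|cw] := pselect (cok w); last by left; left.
  by have [dw|dw] := pselect (dok w); [right|left; right].
apply: (le_trans (measureU2 _ _ _)) => /=.
- by apply: measurableU; apply: measurableI => //; try exact: measurableC; exact: measurableI.
- by apply: measurableI => //; exact: measurableI.
rewrite /failure_bound EFinD muleDl//.
apply: leeD b3; apply: (le_trans (measureU2 _ _ _)) => /=.
- by apply: measurableI => //; exact: measurableC.
- by apply: measurableI; [exact: measurableI|exact: measurableC].
by rewrite EFinD muleDl//; exact: leeD.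
Qed.

End failure_probability.

Section cell_counts.
Context {R : realType} {disp : measure_display} {Omega : measurableType disp}.
Context {d q n : nat} {P : probability Omega R}.
Context {N : Omega -> nat} {X : nat -> Omega -> torus_point R d}.
Hypothesis hX : poisson_point_process P n%:R N X.
Let lam : R := n%:R / q.+1%:R ^+ d.
Hypothesis n0 : (0 < n)%N.
Variables h T : nat.

Definition balanced (kappa : seq {ffun 'I_d -> 'I_q.+1}) :=
  [forall c, (h < count_mem c kappa <= T)%N].

Let mN : measurable_fun setT N. Proof. by case: hX. Qed.
Let mX i : measurable_fun setT (X i). Proof. by case: hX. Qed.

Lemma dmeas_measurable_cell_seq : dmeas measurable (cell_seq q N X).
Proof.
exact: (dmeas_sub (sigma_positions_measurable mN mX) (@dmeas_cell_seq _ _ _ _ _ _ _)).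
Qed.

Lemma cell_count_law c k :
  P [set w | count_mem c (cell_seq q N X w) = k] = poisson_prob lam 0 [set k].
Proof.
have [_ _ hT hA _] := hX.
rewrite -[lam]/(n%:R * (q.+1%:R ^- d)) -[q.+1%:R ^- d]/(fine (q.+1%:R ^- d)%:E).
rewrite -(torus_vol_cell_set c) -hA; last exact: measurable_cell_set.
congr (P _); apply/seteqP; rewrite /mkset; suff E w : num_points N X (cell_set c) w =
    count_mem c (cell_seq q N X w) by split => w; rewrite E.
rewrite /num_points /cell_seq count_map; apply: eq_in_count => i.
rewrite mem_iota /= => iN; apply/idP/eqP; first by move=> /set_mem[].
by move=> ci; apply/mem_set; split => //; exact: hT.
Qed.

Lemma unbalanced_le :
  (P [set w | ~~ balanced (cell_seq q N X w)] <=
   (q.+1%:R ^+ d * (2 ^- T.+1 * expR lam + 2 ^+ h * expR (- (lam / 2))))%:E)%E.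
Proof.
have dk := dmeas_measurable_cell_seq.
have dc c : dmeas measurable (fun w => count_mem c (cell_seq q N X w)).
  exact: (dmeas_comp (fun s => count_mem c s) dk).
have lam0 : 0 < lam by rewrite divr_gt0 ?exprn_gt0 ?ltr0n.
pose A c := [set w | (T.+1 <= count_mem c (cell_seq q N X w))%N] `|`
            [set w | (count_mem c (cell_seq q N X w) <= h)%N].
have mA1 c : measurable [set w | (T.+1 <= count_mem c (cell_seq q N X w))%N].
  exact: (dc c [set m | (T.+1 <= m)%N]).
have mA2 c : measurable [set w | (count_mem c (cell_seq q N X w) <= h)%N].
  exact: (dc c [set m | (m <= h)%N]).
apply: (@le_trans _ _ (\sum_c P (A c))%E).
  apply: union_bound => [|c|w /=].
  - exact: (dmeas_bool (dmeas_comp (fun s => ~~ balanced s) dk)).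
  - exact: measurableU.
  move=> /forallPn[c]; rewrite negb_and -leqNgt -ltnNge => /orP[hc|hc]; exists c; [by right|by left].
apply: (@le_trans _ _ (\sum_(c : {ffun 'I_d -> 'I_q.+1}) (2 ^- T.+1 * expR lam + 2 ^+ h * expR (- (lam / 2)))%:E)%E).
  apply: lee_sum => c _; apply: (le_trans (measureU2 _ _ _)) => //; rewrite EFinD; apply: leeD.
    by apply: poisson_upper_tail => // k; [exact: (dc c [set k])|exact: cell_count_law].
  by apply: poisson_lower_tail => // k; [exact: (dc c [set k])|exact: cell_count_law].
by rewrite sumEFin lee_fin sumr_const card_ffun !card_ord -[X in X <= _]mulr_natl natrX.
Qed.

End cell_counts.

Lemma harm_sum_ge0 {R : realType} n : 0 <= harm_sum n :> R.
Proof. by apply: sumr_ge0 => i _; rewrite invr_ge0. Qed.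

Lemma second_moment_ge0 {R : realType} (n : nat) (g C : R) : 0 <= C ->
  0 <= second_moment (n := n) g C.
Proof. by move=> C0; apply: sumr_ge0 => j _; rewrite !mulr_ge0 ?powR_ge0 ?exprn_ge0. Qed.

Lemma skeleton_total_ge0 {R : realType} (d k : nat) (g M2 M : R) :
  0 <= usage_const (d := d) g M2 -> 0 <= M -> 0 <= skeleton_total (d := d) g M2 k M.
Proof.
move=> u0 M0; apply: sumr_ge0 => j _; apply: mulr_ge0.
  by apply: exprn_ge0; rewrite mulr_ge0.
by apply: mulr_ge0 => //; apply: exprn_ge0; rewrite mulr_ge0// mulr_ge0// ?exprn_ge0.
Qed.

Lemma failure_bound_ge0 {R : realType} (d q n h T k : nat) (theta1 g C t : R) :
  0 <= C -> theta1 <= 1 -> 0 <= t ->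
  0 <= failure_bound (d := d) (q := q) (n := n) (theta1 := theta1) g C h T k t.
Proof.
move=> C0 th1 t0; rewrite /failure_bound; apply: addr_ge0; first apply: addr_ge0.
- by rewrite !mulr_ge0 ?powR_ge0.
- by rewrite mulr_ge0// exprn_ge0// subr_ge0.
apply: divr_ge0 => //; apply: mulr_ge0; last exact: second_moment_ge0.
apply: skeleton_total_ge0.
  by rewrite /usage_const mulr_ge0 ?powR_ge0// mulr_ge0 ?exprn_ge0// divr_ge0 ?exprn_ge0.
by apply: mulr_ge0; apply: mulr_ge0 => //; rewrite ?exprn_ge0 ?mulr_ge0 ?harm_sum_ge0.
Qed.

Lemma rumour_spread_le {R : realType} {disp : measure_display} {Omega : measurableType disp}
    {d q n : nat} {alpha theta1 theta2 : R}
    {D : probability (measurableTypeR R) R} {P : probability Omega R}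
    {N : Omega -> nat} {X : nat -> Omega -> torus_point R d}
    {W : nat -> Omega -> measurableTypeR R}
    {p : nat -> nat -> Omega -> measurableTypeR R}
    {E : nat -> nat -> Omega -> bool} {S : Omega -> nat}
    {Y : nat -> nat -> Omega -> nat} (g C t : R) (h T k : nat) :
  girg alpha theta1 theta2 D n P N X W p E -> push_pull P N X W E S Y ->
  0 < theta1 -> theta1 <= theta2 -> theta2 <= 1 ->
  1 / 2 <= g -> g <= 1 -> g^-1 <= alpha -> D `[1%R, +oo[%classic = 1%E -> 0 < C ->
  (forall m : nat, (0 < m)%N -> (D (unit_itv m) <= (C * m%:R `^ (- (2 + g)))%:E)%E) ->
  (1 < n)%N -> 2 ^+ d <= n%:R / q.+1%:R ^+ d :> R -> 0 < t ->
  (P (rumour_spread (N := N) (E := E) (S := S) (Y := Y) k t) <=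
   (failure_bound (d := d) (q := q) (n := n) (theta1 := theta1) g C h T k t +
    q.+1%:R ^+ d * (2 ^- T.+1 * expR (n%:R / q.+1%:R ^+ d) + 2 ^+ h * expR (- (n%:R / q.+1%:R ^+ d / 2))))%:E)%E.
Proof.
move=> hG hP th1 th12 th2 g2 g1 galpha D1 C0 hC n1 lam2 t0.
have hX := girg_positions hG.
have mH := measurable_rumour_spread hG hP k t.
have dk := dmeas_measurable_cell_seq (q := q) hX.
set H := rumour_spread _ _ in mH *.
pose B := [set w | balanced h T (cell_seq q N X w)].
have mB : measurable B by exact: (dmeas_bool (dmeas_comp (fun s => balanced h T s) dk)).
apply: (@le_trans _ _ (P (H `&` B) + P (~` B))%E).
  apply: (@le_trans _ _ (P ((H `&` B) `|` ~` B))).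
    apply: le_measure; rewrite ?inE//.
      by apply: measurableU; [exact: measurableI|exact: measurableC].
    by move=> w Hw; have [Bw|Bw] := pselect (B w); [left|right].
  by apply: measureU2; [exact: measurableI|exact: measurableC].
rewrite EFinD; apply: leeD; last first.
  rewrite (_ : ~` B = [set w | ~~ balanced h T (cell_seq q N X w)]).
    by apply: unbalanced_le => //; exact: ltnW.
  by apply/seteqP; split => w /= /negP.
apply: (disintegrate_le (f := cell_seq q N X)) => [||a|a].
- by apply: failure_bound_ge0; [exact: ltW|exact: le_trans th2|exact: ltW].
- exact: measurableI.
- exact: (dk [set a]).
have [ba|ba] := boolP (balanced h T a); last first.
  rewrite (_ : _ `&` _ = set0) ?measure0.
    by rewrite mule_ge0// lee_fin failure_bound_ge0 ?(ltW C0) ?(ltW t0) ?(le_trans th12).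
  by apply/seteqP; split => // w [[_ +] /= ca]; rewrite /B /= ca; exact/negP.
apply: le_trans (config_failure_le hG hP th1 th12 th2 g2 g1 galpha D1 C0 hC n1 lam2 k t0 _); last first.
  by move=> c; exact: (forallP ba c).
apply: le_measure; rewrite ?inE//.
- by apply: measurableI; [exact: measurableI|exact: (dk [set a])].
- by apply: measurableI; [|exact: (dk [set a])].
by move=> w [[Hw _] ca].
Qed.

(** * Asymptotics *)

Section real_estimates.
Context {R : realType}.
Implicit Types x : R.

Lemma harm_sum_le_ln n : (0 < n)%N -> harm_sum n <= 1 + ln n%:R :> R.
Proof.
rewrite /harm_sum; elim: n => // -[_ _|n IH _]; first by rewrite big_ord1 ln1 invr1 addr0.
rewrite big_ord_recr/=; have := IH isT; set a : R := n.+1%:R; set b : R := n.+2%:R => h.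
have a0 : 0 < a by rewrite ltr0n.
have b0 : 0 < b by rewrite ltr0n.
have ab : a = b - 1 by rewrite /a /b -[n.+2%:R]natr1 addrK.
have bi : b^-1 < 1 by rewrite invf_lt1// /b (ltr_nat _ 1).
have := @le_ln1Dx R (- b^-1); rewrite ltrN2 bi => /(_ isT).
have -> : 1 + - b^-1 = a / b by rewrite ab mulrDl mulfV ?gt_eqF// mulN1r.
rewrite ln_div ?posrE// => hb; apply: (le_trans (lerD h (lexx _))).
by rewrite -addrA lerD2l -lerBrDl -lerN2 opprB.
Qed.

Lemma harm_sum_mono m n : (m <= n)%N -> harm_sum m <= harm_sum n :> R.
Proof.
move=> /subnKC <-; rewrite /harm_sum big_split_ord /= lerDl.
by apply: sumr_ge0 => j _; rewrite invr_ge0.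
Qed.

Lemma expR_ge_id x : x <= expR x.
Proof. by apply: le_trans (expR_ge1Dx x); rewrite lerDr. Qed.

Lemma expRN_le_inv x : 0 < x -> expR (- x) <= x^-1.
Proof. by move=> x0; rewrite expRN lef_pV2 ?posrE ?expR_gt0// expR_ge_id. Qed.

Lemma exprn_le_expR m x : 0 <= x -> x ^+ m <= m`!%:R * expR x.
Proof.
move=> x0; case: m => [|m]; first by rewrite mul1r (le_trans _ (expR_ge1Dx x))// lerDl.
rewrite mulrC -ler_pdivrMr ?ltr0n ?fact_gt0//.
by apply: le_trans (expR_ge1Dxn m x0); rewrite lerDr.
Qed.

Lemma two_le_expR1 : 2 <= expR 1 :> R.
Proof. by have := expR_ge1Dx (1 : R); lra. Qed.

Lemma expR_half_le2 : expR (1 / 2) <= 2 :> R.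
Proof.
have := expR_ge1Dx (- (1 / 2) : R); rewrite expRN => h.
have e0 := expR_gt0 (1 / 2 : R).
by rewrite -lef_pV2 ?posrE//; lra.
Qed.

Lemma pow2_expR m : 2 ^+ m <= expR m%:R :> R.
Proof.
rewrite -[m%:R]mulr1 expRM_natl.
by rewrite lerXn2r ?nnegrE ?expR_ge0 ?two_le_expR1.
Qed.

Lemma pow2N_expR m : 2 ^- m <= expR (- (m%:R / 2)) :> R.
Proof.
rewrite expRN lef_pV2 ?posrE ?expR_gt0 ?exprn_gt0//.
have -> : m%:R / 2 = m%:R * (1 / 2) :> R by rewrite mul1r.
by rewrite expRM_natl lerXn2r ?nnegrE ?expR_ge0 ?expR_half_le2.
Qed.

Lemma grid_size (d : nat) x : (0 < d)%N -> 1 <= x ->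
  exists q : nat, q.+1%:R ^+ d <= x < q.+2%:R ^+ d.
Proof.
move=> d0 x1; have x0 : 0 <= x by lra.
have ex : exists q : nat, (q.+1 ^ d <= Num.truncn x)%N.
  by exists 0%N; rewrite exp1n Num.Theory.truncn_gt0.
have bd q : (q.+1 ^ d <= Num.truncn x)%N -> (q <= Num.truncn x)%N.
  by move=> h; apply: leq_trans h; apply: ltnW; rewrite -(prednK d0) expnS leq_pmulr ?expn_gt0.
have [q hq qmax] := ex_maxnP ex bd; exists q.
have /andP[t1 t2] := Num.Theory.truncn_itv x0.
rewrite -!natrX (le_trans _ t1) ?ler_nat//= (lt_le_trans t2)// ler_nat ltnNge.
by apply/negP => /qmax; rewrite ltnn.
Qed.

End real_estimates.

Section failure_asymptotics.
Context {R : realType}.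
Variables (d q n T h : nat) (l lam : R).
Hypotheses (lE : l = ln n%:R) (lamE : lam = n%:R / q.+1%:R ^+ d).
Hypotheses (TE : T = Num.truncn (4 * lam)) (hE : h = Num.truncn (lam / 4)).
Hypotheses (d0 : (0 < d)%N) (l8 : 8 <= l) (lam1 : l ^+ 2 <= lam) (lam2 : lam <= 2 ^+ d * l ^+ 2).

Let l0 : 0 < l. Proof. by apply: lt_le_trans l8. Qed.

Let n0 : 0 < n%:R :> R.
Proof. by rewrite ltNge; apply/negP => n0; move: l0; rewrite lE ln0// ltxx. Qed.

Let nE : n%:R = expR l :> R. Proof. by rewrite lE lnK ?posrE. Qed.

Let powE a : n%:R `^ a = expR (a * l) :> R.
Proof. by rewrite /powR (gt_eqF n0) lE. Qed.

Let ll : l <= l ^+ 2.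
Proof. by rewrite expr2 ler_peMr ?(ltW l0)//; move: l8; lra. Qed.

Let lam8 : 8 <= lam. Proof. by apply: le_trans lam1; apply: le_trans ll. Qed.

Let Q0 : 0 < q.+1%:R ^+ d :> R. Proof. by rewrite exprn_gt0// ltr0n. Qed.

Let lamQ : lam * q.+1%:R ^+ d = n%:R. Proof. by rewrite lamE divfK// gt_eqF. Qed.

Let Qn : q.+1%:R ^+ d <= n%:R :> R.
Proof. by rewrite -lamQ ler_peMl ?(ltW Q0)//; move: lam8; lra. Qed.

Let T_le : T%:R <= 4 * lam.
Proof. by rewrite TE Num.Theory.truncn_le; move: lam8; lra. Qed.

Lemma class_error_le (C : R) : 0 <= C ->
  (T * q.+1 ^ d)%:R * (2 * C * n%:R `^ (- (3 / 2))) <= 16 * C / l.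
Proof.
move=> C0; apply: (@le_trans _ _ (4 * n%:R * (2 * C * n%:R `^ (- (3 / 2))))).
  by rewrite ler_wpM2r ?mulr_ge0 ?powR_ge0// natrM natrX -lamQ mulrA ler_wpM2r ?(ltW Q0).
have -> : 4 * n%:R * (2 * C * n%:R `^ (- (3 / 2))) = 8 * C * expR (- (l / 2)).
  rewrite powE nE.
  have -> : 4 * expR l * (2 * C * expR (- (3 / 2) * l)) = 8 * C * (expR l * expR (- (3 / 2) * l)) by ring.
  by rewrite -expRD; congr (_ * expR _); field.
have := expRN_le_inv (divr_gt0 l0 (ltr0Sn R 1)); rewrite invf_div => hl.
apply: (@le_trans _ _ (8 * C * (2 / l))); first by rewrite ler_wpM2l ?mulr_ge0.
by rewrite le_eqVlt; apply/orP; left; apply/eqP; ring.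
Qed.

Lemma degree_error_le (theta1 : R) : 0 <= theta1 <= 1 -> 12 <= theta1 * l ->
  (T * q.+1 ^ d * q.+1 ^ d)%:R * (1 - theta1) ^+ h <= 4 * expR 1 / l.
Proof.
move=> /andP[th0 th1] thl.
have hh : lam / 4 - 1 <= h%:R.
  have l40 : 0 <= lam / 4 by move: lam8; lra.
  by have /andP[_] := Num.Theory.truncn_itv l40; rewrite -hE -natr1; lra.
have hth : (1 - theta1) ^+ h <= expR (1 - 3 * l).
  apply: (@le_trans _ _ (expR (- theta1) ^+ h)).
    by rewrite lerXn2r ?nnegrE ?expR_ge0 ?subr_ge0//; exact: expR_ge1Dx.
  rewrite -expRM_natr ler_expR.
  have : theta1 * (lam / 4 - 1) <= theta1 * h%:R by rewrite ler_wpM2l.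
  have : theta1 * l ^+ 2 <= theta1 * lam by rewrite ler_wpM2l.
  have : 12 * l <= theta1 * l * l by rewrite ler_wpM2r ?(ltW l0).
  rewrite expr2; lra.
apply: (@le_trans _ _ (4 * n%:R * n%:R * expR (1 - 3 * l))).
  apply: ler_pM => //; first by rewrite exprn_ge0// subr_ge0.
  rewrite !natrM !natrX ler_pM ?mulr_ge0 ?(ltW Q0)//.
  by rewrite -lamQ mulrA ler_wpM2r ?(ltW Q0).
rewrite nE; have -> : 4 * expR l * expR l * expR (1 - 3 * l) = 4 * expR 1 * expR (- l).
  by rewrite -!mulrA -!expRD; congr (_ * _); congr expR; ring.
by rewrite ler_wpM2l ?mulr_ge0 ?expR_ge0 ?expRN_le_inv.
Qed.

Lemma position_error_le :
  q.+1%:R ^+ d * (2 ^- T.+1 * expR lam + 2 ^+ h * expR (- (lam / 2))) <= 2 / l.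
Proof.
have T4 : 4 * lam <= T.+1%:R.
  have l40 : 0 <= 4 * lam by move: lam8; lra.
  by have /andP[_ /ltW] := Num.Theory.truncn_itv l40; rewrite -TE.
have h4 : h%:R <= lam / 4 by rewrite hE Num.Theory.truncn_le; move: lam8; lra.
have e1 : 2 ^- T.+1 * expR lam <= expR (- (lam / 4)).
  apply: (@le_trans _ _ (expR (- (T.+1%:R / 2)) * expR lam)).
    by rewrite ler_wpM2r ?expR_ge0 ?pow2N_expR.
  by rewrite -expRD ler_expR; move: lam8 T4; lra.
have e2 : 2 ^+ h * expR (- (lam / 2)) <= expR (- (lam / 4)).
  apply: (@le_trans _ _ (expR h%:R * expR (- (lam / 2)))).
    by rewrite ler_wpM2r ?expR_ge0 ?pow2_expR.
  by rewrite -expRD ler_expR; lra.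
apply: (@le_trans _ _ (n%:R * (2 * expR (- (lam / 4))))).
  apply: ler_pM => //.
  by rewrite mulr_natl mulr2n lerD.
rewrite nE mulrCA -expRD; apply: (@le_trans _ _ (2 * expR (- l))).
  rewrite ler_wpM2l// ler_expR.
  have : 8 * l <= l ^+ 2 by rewrite expr2 ler_wpM2r ?(ltW l0).
  move: lam1; lra.
by rewrite ler_wpM2l ?expRN_le_inv.
Qed.

Let n_gt0 : (0 < n)%N. Proof. by rewrite -(ltr0n R). Qed.

Let harm_n : harm_sum n <= 2 * l :> R.
Proof. by apply: le_trans (harm_sum_le_ln n_gt0) _; rewrite -lE; move: l8; lra. Qed.

Let harm_q : harm_sum q.+1 <= 2 * l :> R.
Proof.
apply: le_trans harm_n; apply: harm_sum_mono; rewrite -(ler_nat R).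
by apply: le_trans Qn; rewrite -(prednK d0) exprS ler_peMr// exprn_ege1// ler1n.
Qed.

Variables (g C : R) (J k : nat).
Hypotheses (g2 : 1 / 2 <= g) (g1 : g <= 1) (C0 : 0 < C) (JE : J = (8 + d)%N) (lnl : 1 <= ln l).
Hypothesis kE : k = Num.truncn (l / (8 * J%:R * ln l)).
(* The constants in the factor lost at each step of a skeleton; the powers of
   [l] in that factor add up to [7 + d]. *)
Let c1 : R := 6 * 4 ^+ d * 8 ^+ d * 16 * 4 ^+ d * C * 8 * 2 ^+ d * 4 ^+ d.
Hypothesis lc : c1 <= l.

Let J0 : 0 < J%:R :> R. Proof. by rewrite ltr0n JE. Qed.

Let k_le : k%:R <= l / (8 * J%:R * ln l).
Proof.
rewrite kE Num.Theory.truncn_le divr_ge0 ?(ltW l0)//.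
by rewrite !mulr_ge0 ?(ltW J0)// (le_trans _ lnl).
Qed.

Let k1_le : k.+1%:R <= l.
Proof.
have : l / (8 * J%:R * ln l) <= l / 8.
  rewrite ler_wpM2l ?(ltW l0)// lef_pV2 ?posrE ?mulr_gt0// ?(lt_le_trans _ lnl)//.
  by rewrite -mulrA ler_peMr// mulr_ege1// ler1n JE.
by move=> /(le_trans k_le); move: l8; rewrite -[k.+1%:R]natr1; lra.
Qed.

Let M2 := lam * 4 ^+ d.
Let M := C * harm_sum n * (T%:R * (2 * harm_sum q.+1) ^+ d).

Let usage_le : usage_const (d := d) g M2 <= 8 ^+ d * l ^+ 2 * (16 * 4 ^+ d).
Proof.
rewrite /usage_const; apply: ler_pM; rewrite ?powR_ge0//.
- by rewrite mulr_ge0 ?exprn_ge0//; move: lam8; lra.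
- rewrite /M2 (_ : 8 ^+ d = 2 ^+ d * 4 ^+ d :> R); last by rewrite -exprMn; congr (_ ^+ _); ring.
  by rewrite mulrAC ler_wpM2r ?exprn_ge0.
have b1 : 1 <= 4 * 2 ^+ d :> R by rewrite mulr_ege1 ?exprn_ege1// ?ler1n// (ler_nat _ 1 2).
apply: (@le_trans _ _ ((4 * 2 ^+ d) `^ 2)).
  by rewrite ler_powR// -lef_pV2 ?posrE ?invrK ?invr_gt0//; move: g2; lra.
rewrite powR_mulrn; last by lra.
rewrite exprMn -exprM mulnC exprM.
by rewrite -!natrX.
Qed.

Let M_ge0 : 0 <= M.
Proof.
by rewrite /M !mulr_ge0 ?(ltW C0) ?harm_sum_ge0 ?exprn_ge0 ?mulr_ge0 ?harm_sum_ge0.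
Qed.

Let M_le : M <= C * (2 * l) * (4 * (2 ^+ d * l ^+ 2) * (4 * l) ^+ d).
Proof.
rewrite /M; apply: ler_pM.
- by rewrite mulr_ge0 ?(ltW C0) ?harm_sum_ge0.
- by rewrite mulr_ge0 ?exprn_ge0 ?mulr_ge0 ?harm_sum_ge0.
- by rewrite ler_pM2l.
apply: ler_pM => //.
- by rewrite exprn_ge0 ?mulr_ge0 ?harm_sum_ge0.
- by apply: (le_trans T_le); rewrite ler_pM2l.
rewrite lerXn2r ?nnegrE ?mulr_ge0 ?harm_sum_ge0 ?(ltW l0)//.
by move: harm_q; lra.
Qed.

Let usage_ge1 : 1 <= usage_const (d := d) g M2.
Proof.
apply: usage_const_ge1 => //; rewrite mulr_ege1 ?exprn_ege1 ?(ler_nat _ 1 4)//.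
by move: lam8; lra.
Qed.

Let skeleton_base_le :
  6 * (2 ^+ d) ^+ 2 * k.+1%:R ^+ 2 * usage_const (d := d) g M2 * M <= l ^+ J.
Proof.
have u0 : 0 <= usage_const (d := d) g M2 by apply: le_trans usage_ge1.
apply: (@le_trans _ _ (6 * 4 ^+ d * l ^+ 2 * (8 ^+ d * l ^+ 2 * (16 * 4 ^+ d)) *
   (C * (2 * l) * (4 * (2 ^+ d * l ^+ 2) * (4 * l) ^+ d)))).
  apply: ler_pM => //.
    by rewrite mulr_ge0// !mulr_ge0// ?exprn_ge0.
  apply: ler_pM => //.
  apply: ler_pM => //.
    rewrite ler_pM2l// -exprM mulnC exprM.
    by rewrite -natrX.
  by rewrite lerXn2r ?nnegrE ?(ltW l0).
apply: (@le_trans _ _ (c1 * l ^+ (7 + d))).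
  rewrite le_eqVlt; apply/orP; left; apply/eqP.
  rewrite exprMn exprD /c1; ring.
by rewrite JE (_ : (8 + d = (7 + d).+1)%N)// exprS ler_wpM2r ?exprn_ge0 ?(ltW l0).
Qed.

Lemma skeleton_error_le :
  skeleton_total (d := d) g M2 k M * second_moment (n := n) g C / n%:R `^ (3 / 4) <=
  2 * C * (8 ^+ (J + 2) * ((J + 2)`!)%:R) / l.
Proof.
have l1 : 1 <= l by move: l8; lra.
have tot : skeleton_total (d := d) g M2 k M <= (l ^+ J) ^+ k.+1.
  apply: skeleton_total_le => //; last by rewrite exprn_ege1.
  by apply: (le_trans k1_le); rewrite -[leLHS]expr1 ler_weXn2l// JE.
have pw : (l ^+ J) ^+ k.+1 <= l ^+ J * expR (l / 8).
  rewrite exprS ler_wpM2l ?exprn_ge0 ?(ltW l0)//.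
  have lexp : l = expR (ln l) by rewrite lnK ?posrE.
  rewrite -exprM [in leLHS]lexp -expRM_natr ler_expR natrM.
  have : k%:R * (8 * J%:R * ln l) <= l.
    by rewrite -ler_pdivlMr// !mulr_gt0// (lt_le_trans _ lnl).
  lra.
have sm := @second_moment_le R n g C g2 (ltW C0).
have sm2 : second_moment (n := n) g C <= C * n%:R `^ (1 / 2) * (2 * l).
  by apply: (le_trans sm); rewrite ler_wpM2l// mulr_ge0 ?powR_ge0 ?(ltW C0).
rewrite ler_pdivrMr ?powR_gt0//.
apply: (@le_trans _ _ (l ^+ J * expR (l / 8) * (C * n%:R `^ (1 / 2) * (2 * l)))).
  apply: ler_pM => //.
  - by apply: skeleton_total_ge0 => //; exact: le_trans ler01 usage_ge1.
  - by apply: second_moment_ge0; exact: ltW.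
  - exact: le_trans pw.
have fl : l ^+ (J + 2) <= 8 ^+ (J + 2) * ((J + 2)`!)%:R * expR (l / 8).
  have l80 : 0 <= l / 8 by rewrite divr_ge0 ?(ltW l0).
  have := exprn_le_expR (J + 2) l80.
  by rewrite expr_div_n ler_pdivrMr ?exprn_gt0// mulrC mulrA.
rewrite [leRHS]mulrAC ler_pdivlMr// !powE.
have -> : l ^+ J * expR (l / 8) * (C * expR (1 / 2 * l) * (2 * l)) * l =
    2 * C * l ^+ (J + 2) * expR (5 / 8 * l).
  have -> : expR (5 / 8 * l) = expR (l / 8) * expR (1 / 2 * l).
    by rewrite -expRD; congr expR; field.
  by rewrite exprD; ring.
rewrite -[leLHS]mulrA -[leRHS]mulrA ler_wpM2l ?mulr_ge0 ?(ltW C0)//.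
apply: (@le_trans _ _ (8 ^+ (J + 2) * (J + 2)`!%:R * expR (l / 8) * expR (5 / 8 * l))).
  by rewrite ler_wpM2r ?expR_ge0.
by rewrite -mulrA -expRD ler_wpM2l ?mulr_ge0 ?exprn_ge0// ler_expR; lra.
Qed.

End failure_asymptotics.

Lemma near_ln_ge {R : realType} (L : R) : \forall n \near \oo, L <= ln n%:R.
Proof.
exists (Num.truncn (expR L)).+1 => // n /= Ln.
have eL : expR L <= n%:R.
  have /andP[_ /ltW h] := Num.Theory.truncn_itv (expR_ge0 L).
  by apply: (le_trans h); rewrite ler_nat.
by rewrite -[L]expRK ler_ln ?posrE ?expR_gt0// (lt_le_trans _ eL)// expR_gt0.
Qed.

Lemma truncn_ge_half {R : realType} (x : R) : 1 <= x -> x / 2 <= (Num.truncn x)%:R.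
Proof.
move=> x1; have x0 : 0 <= x by lra.
have /andP[_] := Num.Theory.truncn_itv x0; rewrite -[(_).+1%:R]natr1.
have : 1 <= (Num.truncn x)%:R :> R by rewrite ler1n Num.Theory.truncn_gt0.
lra.
Qed.

Definition round_count {R : realType} (J n : nat) : nat :=
  Num.truncn (ln n%:R / (8 * J%:R * ln (ln n%:R)) : R).

Lemma round_count_Omega {R : realType} (J : nat) : (0 < J)%N ->
  (fun n => (round_count (R := R) J n)%:R : R) \is
    'Omega_\oo (fun n => ln n%:R / ln (ln n%:R) : R).
Proof.
move=> J0; have J0' : 0 < J%:R :> R by rewrite ltr0n.
apply/asboolP; exists (16 * J%:R)^-1; first by rewrite invr_gt0 mulr_gt0.
apply: filterS (near_ln_ge (expR (16 * J%:R))) => n; set l : R := ln n%:R => hl.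
have l0 : 0 < l by apply: lt_le_trans hl; exact: expR_gt0.
set y := ln l; have yJ : 16 * J%:R <= y.
  by rewrite /y -[leLHS]expRK ler_ln ?posrE ?expR_gt0 //; exact: hl.
have y0 : 0 < y by apply: lt_le_trans yJ; rewrite mulr_gt0.
have ly : 8 * J%:R * y <= l.
  have : y ^+ 2 <= 2 * l.
    by have := exprn_le_expR 2 (ltW y0); rewrite /y lnK ?posrE.
  have : 16 * J%:R * y <= y * y by rewrite ler_pM2r.
  rewrite expr2; lra.
have x1 : 1 <= l / (8 * J%:R * y) by rewrite ler_pdivlMr ?mul1r ?mulr_gt0.
rewrite !ger0_norm ?divr_ge0 ?(ltW l0) ?(ltW y0)//.
apply: le_trans (truncn_ge_half x1).
rewrite le_eqVlt; apply/orP; left; apply/eqP.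
by field; rewrite !gt_eqF.
Qed.

Section spread_probability.
Context {R : realType} (tau alpha theta1 theta2 : R) (d : nat).
Context (D : probability (measurableTypeR R) R).
Hypotheses (htau : 5 / 2 < tau) (halpha : 1 < alpha) (halphatau : (tau - 2)^-1 < alpha).
Hypotheses (htheta1 : 0 < theta1) (htheta12 : theta1 <= theta2) (htheta2 : theta2 <= 1).
Hypotheses (hd : (0 < d)%N) (hD : power_law tau D).

Lemma spread_probability_le : exists K L : R, forall n
  (disp : measure_display) (Omega : measurableType disp) (P : probability Omega R)
  (N : Omega -> nat) (X : nat -> Omega -> torus_point R d)
  (W : nat -> Omega -> measurableTypeR R)
  (p : nat -> nat -> Omega -> measurableTypeR R)
  (E : nat -> nat -> Omega -> bool) (S : Omega -> nat)
  (Y : nat -> nat -> Omega -> nat),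
  girg alpha theta1 theta2 D n P N X W p E -> push_pull P N X W E S Y ->
  L <= ln n%:R ->
  (P (rumour_spread (R := R) (N := N) (E := E) (S := S) (Y := Y) (round_count (R := R) (8 + d) n)
        (n%:R `^ (3 / 4))) <= (K / ln n%:R)%:E)%E.
Proof.
pose g := Num.min (tau - 2) 1.
have t2 : 0 < tau - 2 by move: htau; lra.
have g2 : 1 / 2 <= g by rewrite le_min; move: htau; lra.
have g1 : g <= 1 by rewrite ge_min lexx orbT.
have g0 : 0 <= g by lra.
have gtau : 2 + g <= tau.
  by rewrite -lerBrDl ge_min lexx.
have galpha : g^-1 <= alpha.
  by rewrite /g minEle; case: ifP => _; [exact: ltW|rewrite invr1 ltW].
have tau0 : 0 <= tau by move: htau; lra.
have [C [C0 hC]] := power_law_mass hD tau0 g0 gtau.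
have [D1 _] := hD.
pose J := (8 + d)%N.
pose c1 : R := 6 * 4 ^+ d * 8 ^+ d * 16 * 4 ^+ d * C * 8 * 2 ^+ d * 4 ^+ d.
have c10 : 0 <= c1 by rewrite !mulr_ge0 ?exprn_ge0 ?(ltW C0).
pose K := 16 * C + 4 * expR 1 + 2 * C * (8 ^+ (J + 2) * ((J + 2)`!)%:R) + 2.
exists K, (8 + c1 + expR (16 * J%:R) + 12 / theta1 + 2 ^+ d).
move=> n disp Omega P N X W p E S Y hG hP; set l : R := ln n%:R => lL.
have [l8 lc le1 lth ld] : [/\ 8 <= l, c1 <= l, expR 1 <= l, 12 <= theta1 * l & 2 ^+ d <= l].
  have e0 := expR_gt0 (16 * J%:R : R); have e1 : expR 1 <= expR (16 * J%:R) :> R.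
    by rewrite ler_expR -natrM ler1n.
  have th0 : 0 <= 12 / theta1 by rewrite divr_ge0// ltW.
  have d20 : 0 <= 2 ^+ d :> R by rewrite exprn_ge0.
  split; try lra.
  by rewrite mulrC -ler_pdivrMr//; lra.
have l0 : 0 < l by lra.
have n0 : 0 < n%:R :> R by rewrite ltNge; apply/negP => n0; move: l0; rewrite /l ln0// ltxx.
have nE : n%:R = expR l :> R by rewrite /l lnK ?posrE.
have n1 : (1 < n)%N.
  by rewrite -(ltr_nat R) nE; apply: lt_le_trans (expR_ge1Dx l); rewrite ltrDl.
have lnl : 1 <= ln l by rewrite -[leLHS]expRK ler_ln ?posrE ?expR_gt0.
have l2n : 1 <= n%:R / l ^+ 2.
  rewrite ler_pdivlMr ?exprn_gt0// mul1r nE.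
  have h3 := exprn_le_expR 3 (ltW l0).
  rewrite -(ler_pM2l l0) -exprS; apply: (le_trans h3).
  by rewrite ler_wpM2r ?expR_ge0//; apply: le_trans l8; rewrite (ler_nat _ 6 8).
have [q /andP[q1 q2]] := grid_size hd l2n.
have Q0 : 0 < q.+1%:R ^+ d :> R by rewrite exprn_gt0// ltr0n.
have l20 : 0 < l ^+ 2 by rewrite exprn_gt0.
have lam1 : l ^+ 2 <= n%:R / q.+1%:R ^+ d.
  by rewrite ler_pdivlMr// mulrC -ler_pdivlMr.
have lam2 : n%:R / q.+1%:R ^+ d <= 2 ^+ d * l ^+ 2.
  move: q2; rewrite ltr_pdivrMr// ler_pdivrMr// => /ltW/le_trans; apply.
  rewrite mulrAC -exprMn ler_pM2r// lerXn2r ?nnegrE ?mulr_ge0//.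
  by rewrite -natrM ler_nat mul2n -addnn addSn ltnS leq_addl.
have lam2' : 2 ^+ d <= n%:R / q.+1%:R ^+ d :> R.
  by apply: le_trans lam1; apply: (le_trans ld); rewrite expr2 ler_peMr ?(ltW l0)//; lra.
have t0 : 0 < n%:R `^ (3 / 4) :> R by rewrite powR_gt0.
set lam : R := n%:R / q.+1%:R ^+ d in lam1 lam2 lam2'.
pose T := Num.truncn (4 * lam); pose h := Num.truncn (lam / 4).
apply: (le_trans (@rumour_spread_le _ _ _ _ q _ _ _ _ _ _ _ _ _ _ _ _ _ g C _ h T _
  hG hP htheta1 htheta12 htheta2 g2 g1 galpha D1 C0 hC n1 lam2' t0)).
rewrite lee_fin /failure_bound.
have e1 := class_error_le (erefl l) (erefl lam) (erefl T) l8 lam1 (ltW C0).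
have th1 : 0 <= theta1 <= 1 by rewrite ltW// (le_trans htheta12).
have e2 := degree_error_le (erefl l) (erefl lam) (erefl T) (erefl h) l8 lam1 th1 lth.
have e3 := position_error_le (erefl l) (erefl lam) (erefl T) (erefl h) l8 lam1.
have e4 := skeleton_error_le (erefl l) (erefl lam) (erefl T) hd l8 lam1 lam2 g2 g1 C0 (erefl J) lnl erefl lc.
apply: (le_trans (lerD (lerD (lerD e1 e2) e4) e3)).
by rewrite le_eqVlt; apply/orP; left; apply/eqP; rewrite /K; ring.
Qed.

End spread_probability.

Theorem theorem2p7 (R : realType) (tau alpha theta1 theta2 : R) (d : nat)
    (D : probability (measurableTypeR R) R)
    (htau : 5 / 2 < tau) (halpha : 1 < alpha) (halphatau : (tau - 2)^-1 < alpha)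
    (htheta1 : 0 < theta1) (htheta12 : theta1 <= theta2) (htheta2 : theta2 <= 1)
    (hd : (0 < d)%N) (hD : power_law tau D) :
  exists (rho : R) (k : nat -> nat) (C : R),
    [/\ 0 < rho,
        (fun n => (k n)%:R : R) \is
          'Omega_\oo (fun n => ln n%:R / ln (ln n%:R) : R) &
        forall (disp : nat -> measure_display)
          (Omega : forall n, measurableType (disp n))
          (P : forall n, probability (Omega n) R)
          (N : forall n, Omega n -> nat)
          (X : forall n, nat -> Omega n -> torus_point R d)
          (W : forall n, nat -> Omega n -> measurableTypeR R)
          (p : forall n, nat -> nat -> Omega n -> measurableTypeR R)
          (E : forall n, nat -> nat -> Omega n -> bool)
          (S : forall n, Omega n -> nat)
          (Y : forall n, nat -> nat -> Omega n -> nat),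
          (forall n, girg alpha theta1 theta2 D n (P n) (N n) (X n) (W n)
             (p n) (E n)) ->
          (forall n, push_pull (P n) (N n) (X n) (W n) (E n) (S n) (Y n)) ->
          (fun n => P n [set w |
             (num_informed (N n w) (fun i j => E n i j w) (S n w)
                (fun r i => Y n r i w) (k n))%:R <= C * n%:R `^ (1 - rho)])
            @ \oo --> 1%E].
Proof.
have [K [L hKL]] := spread_probability_le htau halpha halphatau htheta1 htheta12 htheta2 hd hD.
exists (1 / 4), (round_count (R := R) (8 + d)), 1; split; first by lra.
  exact: round_count_Omega.
move=> disp Omega P N X W p E S Y hG hP.
pose spread n := rumour_spread (R := R) (N := N n) (E := E n) (S := S n) (Y := Y n)
  (round_count (R := R) (8 + d) n) (n%:R `^ (3 / 4)).
have mspread n : measurable (spread n) by exact: (measurable_rumour_spread (hG n) (hP n)).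
rewrite (_ : (fun n => _) = (fun n => 1 - P n (spread n))%E); last first.
  apply/funext => n; rewrite -(probability_setC (P n) (mspread n)); congr (P n _).
  have e34 : 1 - 1 / 4 = 3 / 4 :> R by field.
  rewrite mul1r e34; apply/seteqP; split => w /=; rewrite /spread /rumour_spread /=.
    by move=> ->.
  by move=> /negP; rewrite negbK.
apply: (@squeeze_cvge _ _ _ _ (fun n => (1 - K / ln n%:R)%:E) _ (fun _ => 1%E)).
- apply: filterS (near_ln_ge L) => n Ln; apply/andP; split.
    by rewrite EFinB leeB//; exact: hKL (hG n) (hP n) Ln.
  by rewrite -[leRHS]sube0 leeB.
- apply: cvg_EFin; first exact: nearW.
  apply/cvgrPdist_le => e e0.
  apply: filterS (near_ln_ge (1 + `|K| / e)) => n hn; rewrite /= opprB addrC subrK.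
  have l0 : 0 < ln n%:R :> R.
    by apply: lt_le_trans hn; rewrite ltr_pwDl// divr_ge0// ltW.
  rewrite normrM normfV (gtr0_norm l0) ler_pdivrMr// -ler_pdivrMl// mulrC.
  by apply: le_trans hn; rewrite lerDr.
- exact: cvg_cst.
Qed.
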